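(* Let $(p_X^\tau)_{\tau\in[0,1]}$ be a path of probability densities on $\mathbb{R}^d$ (the prior path) with potentials $U_X^\tau=-\log p_X^\tau$ satisfying the Path Assumption stated in the context on the index set $I=[0,1]$. Let $A$ be a real matrix with $d$ columns, $\sigma>0$, $y$ a fixed vector in the codomain of $A$, and let the likelihood satisfy $p_{Y|X}(y|x)\propto\exp\big(-\frac{|Ax-y|^2}{2\sigma^2}\big)$ as a function of $x$. Define the posterior path $(p_\tau)_{\tau\in[0,1]}$ as the probability densities $p_\tau(x)\propto p_{Y|X}(y|x)\,p_X^\tau(x)$ and let $U_\tau=-\log p_\tau$. Then $(p_\tau)_{\tau\in[0,1]}$ satisfies the Path Assumption on $I=[0,1]$. Moreover, the Lipschitz constant of $\nabla U_\tau$ exceeds that of $\nabla U_X^\tau$ by at most $\sigma^{-2}\|A^\top A\|$.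
   Context: $\|\cdot\|$ is the spectral norm. A vector field $v:\mathbb{R}^d\to\mathbb{R}^d$ is dissipative with constants $a,b,R>0$ if $\langle x,v(x)\rangle\ge a|x|^2-b\,\mathbf{1}_{B_R(0)}(x)$ for all $x\in\mathbb{R}^d$, where $B_R(0)$ is the open ball of radius $R$ around $0$. A probability measure $\nu$ satisfies the log-Sobolev inequality (LSI) if there is $C>0$ such that $\int f^2\log\big(f^2/\overline{f^2}\big)\,\mathrm{d}\nu\le C\int|\nabla f|^2\,\mathrm{d}\nu$ for all $f\in C_c^\infty(\mathbb{R}^d)$, where $\overline{f^2}=\int f^2\,\mathrm{d}\nu$; the smallest such $C$ is the log-Sobolev constant of $\nu$. Path Assumption on an interval $I\subset[0,\infty)$ containing $0$, for probability densities $(p_\tau)_{\tau\in I}$ with $U_\tau:=-\log p_\tau$ and $\pi_\tau(\mathrm{d}x)=p_\tau(x)\,\mathrm{d}x$: (1) $\tau\mapsto U_\tau(x)$ is differentiable and there is $c>0$ with $|\partial_\tau U_\tau(x)|\le c(|x|^2+1)$ for all $x\in\mathbb{R}^d$, $\tau\in I$. (2) $U_\tau$ is differentiable and $\nabla U_\tau$ is $L_\tau$-Lipschitz. (3) For every $\tau\in I$, $\tau>0$, $\nabla U_\tau$ is dissipative with constants $a_\tau,b_\tau,R_\tau>0$. (4) Over $\tau\in I$, $\tau>0$: $\sup L_\tau<\infty$, $\inf a_\tau>0$, $\sup b_\tau<\infty$, $\sup R_\tau<\infty$. (5) Each $\pi_\tau$ satisfies the LSI with constant $C_{\mathrm{LSI}}(\tau)$,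 and $\sup_{\tau\in I}C_{\mathrm{LSI}}(\tau)<\infty$. *)

(* Defs.v *)
From HB Require Import structures.
From mathcomp Require Import all_boot all_order all_algebra.
From mathcomp Require Import all_classical all_reals all_analysis.

Set Implicit Arguments.
Unset Strict Implicit.
Unset Printing Implicit Defensive.
Import Order.TTheory GRing.Theory Num.Theory.
Import numFieldNormedType.Exports.

Local Open Scope classical_set_scope.
Local Open Scope ring_scope.

(* The product sigma-algebra on matrices, generated by the entries; for
   [T := R] it is the Borel sigma-algebra. *)
Definition measure_matrix_display : measure_display -> measure_display.
Proof. exact. Qed.

Section measurable_matrix.
Context {d} {T : measurableType d}.
Variables m n : nat.

Definition entry_preimages : set (set 'M[T]_(m, n)) :=
  [set A | exists i j, exists2 B, measurable B & 
    A = (fun M : 'M[T]_(m, n) => M i j) @^-1` B].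

Let matrix_set0 : <<s entry_preimages >> set0.
Proof. exact: sigma_algebra0. Qed.

Let matrix_setC A : <<s entry_preimages >> A -> <<s entry_preimages >> (~` A).
Proof. exact: sigma_algebraC. Qed.

Let matrix_bigcup (F : (set 'M[T]_(m, n))^nat) :
  (forall i, <<s entry_preimages >> (F i)) ->
  <<s entry_preimages >> (\bigcup_i F i).
Proof. exact: sigma_algebra_bigcup. Qed.

HB.instance Definition _ := @isMeasurable.Build (measure_matrix_display d)
  'M[T]_(m, n) <<s entry_preimages >> matrix_set0 matrix_setC matrix_bigcup.

End measurable_matrix.

Section measurable_matrix_fun.
Context {d d'} {T : measurableType d} {T' : measurableType d'}.
Variables m n : nat.

Lemma measurable_entry (i : 'I_m) (j : 'I_n) :
  measurable_fun [set: 'M[T]_(m, n)] (fun M => M i j).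
Proof.
move=> _ B mB; rewrite setTI; apply: sub_sigma_algebra.
by exists i, j; exists B.
Qed.

Lemma measurable_matrixP (f : T' -> 'M[T]_(m, n)) :
  (forall i j, measurable_fun [set: T'] (fun x => f x i j)) ->
  measurable_fun [set: T'] f.
Proof.
move=> mf; apply: (@measurability _ _ _ _ setT f (@entry_preimages _ T m n)) => //.
by move=> _ [_ [i [j [B mB ->]]] <-]; exact: mf.
Qed.

End measurable_matrix_fun.

Section lebesgue_measure_cV.
Variable R : realType.
Local Open Scope ereal_scope.

Definition cons_cV n (z : 'cV[R]_n * R) : 'cV[R]_n.+1 :=
  \col_i if unlift ord0 i is Some j then z.1 j 0%R else z.2.

Lemma cons_cV0 n (z : 'cV[R]_n * R) j : cons_cV z ord0 j = z.2.
Proof. by rewrite mxE unlift_none. Qed.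

Lemma cons_cVS n (z : 'cV[R]_n * R) i j : cons_cV z (lift ord0 i) j = z.1 i j.
Proof. by rewrite mxE liftK (ord1 j). Qed.

Lemma measurable_cons_cV n : measurable_fun setT (@cons_cV n).
Proof.
apply: measurable_matrixP => i j; case: (unliftP ord0 i) => [k|] ->.
- under eq_fun do rewrite cons_cVS.
  apply: (measurableT_comp (f := fun M : 'cV[R]_n => M k j)).
    exact: measurable_entry.
  exact: measurable_fst.
- by under eq_fun do rewrite cons_cV0; exact: measurable_snd.
Qed.

Fixpoint lebesgue_cV n : set 'cV[R]_n -> \bar R :=
  match n with
  | 0 => \d_ (0%R : 'cV[R]_0)
  | n'.+1 => pushforward (@lebesgue_cV n' \x @lebesgue_measure R) (@cons_cV n')
  end.

Lemma lebesgue_cV_measure n :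
  exists mu : {measure set 'cV[R]_n -> \bar R}, @lebesgue_cV n = mu.
Proof.
elim: n => [|n [mu /= ->]]; first by exists \d_ (0%R : 'cV[R]_0).
by unshelve eexists (pushforward (mu \x @lebesgue_measure R) (@cons_cV n));
  first exact: measurable_cons_cV.
Qed.

Section instance.
Variable n : nat.

Let lebesgue_cV0 : @lebesgue_cV n set0 = 0.
Proof. by have [mu ->] := lebesgue_cV_measure n. Qed.

Let lebesgue_cV_ge0 A : 0 <= @lebesgue_cV n A.
Proof. by have [mu ->] := lebesgue_cV_measure n. Qed.

Let lebesgue_cV_sigma_additive : semi_sigma_additive (@lebesgue_cV n).
Proof.
by have [mu ->] := lebesgue_cV_measure n; exact: measure_semi_sigma_additive.
Qed.

HB.instance Definition _ := isMeasure.Build _ _ _ (@lebesgue_cV n)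
  lebesgue_cV0 lebesgue_cV_ge0 lebesgue_cV_sigma_additive.

End instance.

Lemma lebesgue_cV_box n (B : 'I_n -> set R) : (forall i, measurable (B i)) ->
  lebesgue_cV [set x : 'cV[R]_n | forall i, B i (x i 0%R)] =
  \prod_(i < n) lebesgue_measure (B i).
Proof.
elim: n B => [|n IH] B mB.
  by rewrite big_ord0 /= diracE mem_set//; case.
rewrite big_ord_recl /= -IH; last by move=> i; exact: mB.
rewrite /pushforward.
rewrite [X in product_measure1 _ _ X](_ : _ =
  [set x : 'cV[R]_n | forall i, B (lift ord0 i) (x i 0%R)] `*` B ord0).
  rewrite product_measure1E//; [by rewrite muleC| |exact: mB].
  rewrite (_ : [set x : 'cV[R]_n | _] = \bigcap_(i in [set: 'I_n])
      ((fun x : 'cV[R]_n => x i 0%R) @^-1` B (lift ord0 i))).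
    apply: fin_bigcap_measurable => // i _.
    by rewrite -[X in measurable X]setTI; exact: measurable_entry.
  by apply/seteqP; split=> x /= h i; [move=> _|]; exact: h.
apply/seteqP; split=> [z /= h|z /= [h1 h2] i].
  by split=> [i|]; [rewrite -cons_cVS|rewrite -(cons_cV0 z 0%R)]; exact: h.
by case: (unliftP ord0 i) => [j|] ->; rewrite ?cons_cV0 ?cons_cVS.
Qed.

End lebesgue_measure_cV.

(* The library norm of ['cV[R]_n] is the sup norm; it is used only through the
   topology it induces. *)

Section euclidean.
Variable R : realType.

Definition dotp n (u v : 'cV[R]_n) : R := (u^T *m v) 0 0.

Definition enorm n (u : 'cV[R]_n) : R := Num.sqrt (dotp u u).

Definition spectral_norm m n (M : 'M[R]_(m, n)) : R :=
  sup [set enorm (M *m x) | x in [set x : 'cV[R]_n | enorm x <= 1]].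

Definition grad n (f : 'cV[R]_n -> R) (x : 'cV[R]_n) : 'cV[R]_n :=
  \col_i 'D_(delta_mx i 0) f x.

Definition lipschitz_with n (v : 'cV[R]_n -> 'cV[R]_n) (L : R) : Prop :=
  0 <= L /\ forall x x', enorm (v x - v x') <= L * enorm (x - x').

(* [+oo] when [v] is not Lipschitz. *)
Definition lip_const n (v : 'cV[R]_n -> 'cV[R]_n) : \bar R :=
  ereal_inf [set L%:E | L in [set L | lipschitz_with v L]].

Definition dissipative n (v : 'cV[R]_n -> 'cV[R]_n) (a b r : R) : Prop :=
  [/\ 0 < a, 0 < b, 0 < r &
    forall x, a * enorm x ^+ 2 - b * \1_[set z : 'cV[R]_n | enorm z < r] x
              <= dotp x (v x)].

(* Being of class C^(k.+1) is being differentiable with all partial derivatives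
   of class C^k. *)
Fixpoint Cn n (k : nat) (f : 'cV[R]_n -> R) : Prop :=
  match k with
  | 0 => continuous f
  | k'.+1 => (forall x, differentiable f x) /\
             forall i : 'I_n, Cn k' (fun x => 'D_(delta_mx i 0) f x)
  end.

Definition test_function n (f : 'cV[R]_n -> R) : Prop :=
  (forall k, Cn k f) /\ compact (closure [set x | f x != 0]).

End euclidean.

Section log_sobolev.
Variables (R : realType) (n : nat).
Implicit Types (nu : set 'cV[R]_n -> \bar R) (C : R).

(* Where [f x = 0], and also when the mean of [f ^+ 2] is zero, the left
   integrand is [0], in accordance with the convention [0 * log 0 = 0]. *)
Definition log_sobolev nu C : Prop :=
  forall f : 'cV[R]_n -> R, test_function f ->
    let mean := fine (\int[nu]_x (f x ^+ 2)%:E) in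
    (\int[nu]_x (f x ^+ 2 * ln (f x ^+ 2 / mean))%:E
     <= C%:E * \int[nu]_x (enorm (grad f x) ^+ 2)%:E)%E.

Definition satisfies_LSI nu : Prop := exists2 C, 0 < C & log_sobolev nu C.

Definition lsi_const nu : \bar R :=
  ereal_inf [set C%:E | C in [set C | 0 < C /\ log_sobolev nu C]].

End log_sobolev.

Section paths.
Variables (R : realType) (n : nat).
Implicit Types (p : 'cV[R]_n -> R) (I : set R).

Definition prob_density p : Prop :=
  [/\ measurable_fun setT p, forall x, 0 <= p x &
      (\int[@lebesgue_cV R n]_x (p x)%:E = 1)%E].

Definition with_density p : set 'cV[R]_n -> \bar R :=
  fun B => (\int[@lebesgue_cV R n]_(x in B) (p x)%:E)%E.

Definition potential p (x : 'cV[R]_n) : R := - ln (p x).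

(* Derivative at [t] of a function of which only the restriction to [I]
   matters; one-sided at the end points of [I]. *)
Definition has_derivative_within I (u : R -> R) (t l : R) : Prop :=
  (u s - u t) / (s - t) @[s --> within I t^'] --> l.

(* Positivity is what makes the potentials real-valued. *)
Record path_assumption I (p : R -> 'cV[R]_n -> R) : Prop := {
  path_density : forall t, I t -> prob_density (p t) ;
  path_positive : forall t, I t -> forall x, 0 < p t x ;
  path_time : exists2 c : R, 0 < c &
    forall x t, I t -> exists2 l : R,
      has_derivative_within I (fun s => potential (p s) x) t l &
      `|l| <= c * (enorm x ^+ 2 + 1) ;
  path_differentiable : forall t, I t ->
    forall x, differentiable (potential (p t)) x ;
  path_constants : exists L a b r : R -> R,
    let I' := I `&` [set t | 0 < t] in
    [/\ forall t, I t -> lipschitz_with (grad (potential (p t))) (L t),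
        forall t, I' t ->
          dissipative (grad (potential (p t))) (a t) (b t) (r t) &
        [/\ (ereal_sup [set (L t)%:E | t in I'] < +oo)%E,
            (0 < ereal_inf [set (a t)%:E | t in I'])%E,
            (ereal_sup [set (b t)%:E | t in I'] < +oo)%E &
            (ereal_sup [set (r t)%:E | t in I'] < +oo)%E]] ;
  path_LSI : forall t, I t -> satisfies_LSI (with_density (p t)) ;
  path_LSI_bound :
    (ereal_sup [set lsi_const (with_density (p t)) | t in I] < +oo)%E }.

Definition propto p (q : 'cV[R]_n -> R) : Prop :=
  exists2 c : R, 0 < c & forall x, p x = c * q x.

Definition posterior (lik p : 'cV[R]_n -> R) (x : 'cV[R]_n) : R :=
  lik x * p x / fine (\int[@lebesgue_cV R n]_z (lik z * p z)%:E)%E.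

End paths.

(* Main.v *)
(* The posterior potential is [U t + V + ln (Z t)] with [V] the least squares potential
   and [Z t] the partition function. Smoothness, dissipativity and Lipschitz bounds of
   [V] are explicit, and [Z t] is differentiated under the integral, dominated by a
   Gaussian bound that is uniform in [t]; dissipativity passes to time 0 because the
   potentials converge there with uniformly Lipschitz gradients.

   For the log-Sobolev inequality no bounded perturbation argument is available, since
   [V] grows quadratically. Testing the inequality of the prior with [h * expR (- V / 2)]
   gives a defective inequality for the posterior, whose defect is the integral of
   [h ^+ 2 * (1 + enorm x ^+ 2)]. Dissipativity gives a Lyapunov inequality that bounds
   this by [h ^+ 2] and [enorm (grad h x) ^+ 2]; the same inequality, with the Poincare
   inequality of a cube, gives a Poincare inequality, which removes the remaining defect.
   All constants depend only on bounds that are uniform along the prior path. *)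

(* A defective log-Sobolev inequality is usually tightened by applying it to the function minus its
   mean. Here it is known only for compactly supported functions, a class that is not stable under
   subtracting a constant. So [ramp (f x)] takes the place of [f x - m]: [ramp] vanishes at 0, which
   keeps the support, and to second order at 1, the value around which [f] is normalized. The
   Poincare inequality is proved for the larger class of bounded C^1 functions with bounded
   gradient, because its proof does subtract values of the function.

   No constant involves a lower bound on the mass [Z] of the posterior weight: weights stay
   unnormalized and test functions are scaled to have mass [Z]. Since [V] is nonnegative and the
   prior is normalized, [Z <= 1], which gives [Z * ln Z] its favourable sign.

   Dissipativity is assumed at positive times only, whereas the log-Sobolev inequality of the
   posterior is required at time 0 too; this is why dissipativity has to be extended to time 0. *)
Require Import Defs.
From HB Require Import structures.
From mathcomp Require Import all_boot all_order all_algebra.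
From mathcomp Require Import all_classical all_reals all_analysis.
From mathcomp Require Import measurable_realfun ring lra.

Set Implicit Arguments.
Unset Strict Implicit.
Unset Printing Implicit Defensive.

Import Order.TTheory GRing.Theory Num.Theory.
Import numFieldNormedType.Exports.

Local Open Scope classical_set_scope.
Local Open Scope ring_scope.

(** * The Euclidean norm *)

Section euclidean_norm.
Variable R : realType.

Section dot_product.
Variable n : nat.
Implicit Types (u v w : 'cV[R]_n) (k : R).

Lemma dotpE u v : dotp u v = \sum_i u i 0 * v i 0.
Proof. by rewrite /dotp mxE; apply: eq_bigr => i _; rewrite mxE. Qed.

Lemma dotpC u v : dotp u v = dotp v u.
Proof. by rewrite !dotpE; apply: eq_bigr => i _; rewrite mulrC. Qed.

Lemma dotpDl u v w : dotp (u + v) w = dotp u w + dotp v w.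
Proof. by rewrite /dotp linearD mulmxDl mxE. Qed.

Lemma dotpDr u v w : dotp w (u + v) = dotp w u + dotp w v.
Proof. by rewrite dotpC dotpDl !(dotpC w). Qed.

Lemma dotpZl k u v : dotp (k *: u) v = k * dotp u v.
Proof. by rewrite /dotp linearZ /= -scalemxAl mxE. Qed.

Lemma dotpZr k u v : dotp u (k *: v) = k * dotp u v.
Proof. by rewrite dotpC dotpZl dotpC. Qed.

Lemma dotpNl u v : dotp (- u) v = - dotp u v.
Proof. by rewrite -scaleN1r dotpZl mulN1r. Qed.

Lemma dotpNr u v : dotp u (- v) = - dotp u v.
Proof. by rewrite dotpC dotpNl dotpC. Qed.

Lemma dotpBl u v w : dotp (u - v) w = dotp u w - dotp v w.
Proof. by rewrite dotpDl dotpNl. Qed.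

Lemma dotpBr u v w : dotp w (u - v) = dotp w u - dotp w v.
Proof. by rewrite dotpDr dotpNr. Qed.

Lemma dotp0l u : dotp 0 u = 0.
Proof. by rewrite -(scale0r u) dotpZl mul0r. Qed.

Lemma dotp0r u : dotp u 0 = 0.
Proof. by rewrite dotpC dotp0l. Qed.

Lemma dotp_ge0 u : 0 <= dotp u u.
Proof. by rewrite dotpE; apply: sumr_ge0 => i _; rewrite -expr2 sqr_ge0. Qed.

Lemma sqr_enorm u : enorm u ^+ 2 = dotp u u.
Proof. by rewrite sqr_sqrtr // dotp_ge0. Qed.

Lemma sqr_enormE u : enorm u ^+ 2 = \sum_i u i 0 ^+ 2.
Proof. by rewrite sqr_enorm dotpE; apply: eq_bigr => i _; rewrite expr2. Qed.

Lemma enorm_ge0 u : 0 <= enorm u.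
Proof. exact: sqrtr_ge0. Qed.

Lemma enorm_eq0 u : enorm u = 0 -> u = 0.
Proof.
move=> u0; have : \sum_i u i 0 ^+ 2 = 0 by rewrite -sqr_enormE u0 expr0n.
move/eqP; rewrite psumr_eq0; last by move=> i _; exact: sqr_ge0.
move=> /allP ui; apply/colP => i; rewrite mxE; apply/eqP.
by have := ui i (mem_index_enum _); rewrite sqrf_eq0.
Qed.

Lemma enorm0 : enorm (0 : 'cV[R]_n) = 0.
Proof. by rewrite /enorm dotp0l sqrtr0. Qed.

Lemma enormZ k u : enorm (k *: u) = `|k| * enorm u.
Proof.
by rewrite /enorm dotpZl dotpZr mulrA -expr2 sqrtrM ?sqr_ge0 // sqrtr_sqr.
Qed.

Lemma enormN u : enorm (- u) = enorm u.
Proof. by rewrite -scaleN1r enormZ normrN1 mul1r. Qed.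

Lemma ler_dotp u v : dotp u v <= enorm u * enorm v.
Proof.
have [u0|u0] := eqVneq (enorm u) 0.
  by rewrite (enorm_eq0 u0) dotp0l enorm0 mul0r.
have [v0|v0] := eqVneq (enorm v) 0.
  by rewrite (enorm_eq0 v0) dotp0r enorm0 mulr0.
have u_gt0 : 0 < enorm u by rewrite lt_def u0 enorm_ge0.
have v_gt0 : 0 < enorm v by rewrite lt_def v0 enorm_ge0.
have := dotp_ge0 (enorm v *: u - enorm u *: v).
rewrite !(dotpBl, dotpBr, dotpZl, dotpZr) (dotpC v u) -!sqr_enorm.
rewrite [leRHS](_ : _ = (2 * (enorm u * enorm v)) * (enorm u * enorm v - dotp u v));
  last by ring.
by rewrite pmulr_rge0 ?subr_ge0 // !mulr_gt0.
Qed.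

Lemma ler_norm_dotp u v : `|dotp u v| <= enorm u * enorm v.
Proof.
by rewrite ler_norml ler_dotp andbT lerNl -dotpNl -(enormN u) ler_dotp.
Qed.

Lemma ler_enormD u v : enorm (u + v) <= enorm u + enorm v.
Proof.
rewrite -ler_sqr ?nnegrE ?addr_ge0 ?enorm_ge0 //.
rewrite sqrrD !sqr_enorm dotpDl !dotpDr (dotpC v u) -mulr_natl.
have := ler_dotp u v; lra.
Qed.

Lemma ler_enorm_add2 u v : enorm (u + v) ^+ 2 <= 2 * enorm u ^+ 2 + 2 * enorm v ^+ 2.
Proof.
have := dotp_ge0 (u - v).
rewrite !sqr_enorm !(dotpBl, dotpBr, dotpDl, dotpDr) (dotpC v u); lra.
Qed.

Lemma ler_coord_enorm u i : `|u i 0| <= enorm u.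
Proof.
rewrite -ler_sqr ?nnegrE ?enorm_ge0 // real_normK ?num_real // sqr_enormE.
by rewrite (bigD1 i) //= lerDl; apply: sumr_ge0 => j _; exact: sqr_ge0.
Qed.

Lemma dotp_delta u i : dotp u (delta_mx i 0) = u i 0.
Proof.
rewrite dotpE (bigD1 i) //= mxE !eqxx mulr1 big1 ?addr0 // => j ji.
by rewrite mxE (negPf ji) mulr0.
Qed.

End dot_product.

Lemma dotp_trmx m n (M : 'M[R]_(m, n)) u v :
  dotp (M^T *m u) v = dotp u (M *m v).
Proof. by rewrite /dotp trmx_mul trmxK mulmxA. Qed.

(** The constant is the Frobenius norm. Some bound has to come before any use of [spectral_norm],
    since [sup] is an upper bound only for bounded sets. *)
Lemma enorm_mulmx_bound m n (M : 'M[R]_(m, n)) :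
  exists2 C : R, 0 <= C & forall x, enorm (M *m x) <= C * enorm x.
Proof.
exists (Num.sqrt (\sum_i enorm ((row i M)^T) ^+ 2)); first exact: sqrtr_ge0.
move=> x; rewrite -ler_sqr ?nnegrE ?mulr_ge0 ?sqrtr_ge0 ?enorm_ge0 //.
rewrite exprMn [in leRHS]sqr_sqrtr; last by apply: sumr_ge0 => i _; exact: sqr_ge0.
rewrite sqr_enormE mulr_suml; apply: ler_sum => i _.
rewrite -exprMn.
have -> : (M *m x) i 0 = dotp (row i M)^T x.
  by rewrite dotpE mxE; apply: eq_bigr => j _; rewrite !mxE.
rewrite -real_normK ?num_real // ler_sqr ?nnegrE ?mulr_ge0 ?enorm_ge0 //.
exact: ler_norm_dotp.
Qed.

Lemma enorm_mulmx m n (M : 'M[R]_(m, n)) x :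
  enorm (M *m x) <= spectral_norm M * enorm x.
Proof.
have [C C0 MC] := enorm_mulmx_bound M.
have [x0|x0] := eqVneq (enorm x) 0.
  by rewrite (enorm_eq0 x0) mulmx0 !enorm0 mulr0.
have x_gt0 : 0 < enorm x by rewrite lt_def x0 enorm_ge0.
have h : enorm (M *m ((enorm x)^-1 *: x)) <= spectral_norm M.
  apply: ub_le_sup.
    exists C => _ [z /= z1 <-]; apply: le_trans (MC z) _.
    by rewrite -[leRHS]mulr1 ler_wpM2l.
  exists ((enorm x)^-1 *: x) => //=.
  by rewrite enormZ normfV (ger0_norm (enorm_ge0 x)) mulVf.
move: h; rewrite -scalemxAr enormZ normfV (ger0_norm (enorm_ge0 x)).
by rewrite mulrC ler_pdivrMr.
Qed.

Lemma spectral_norm_ge0 m n (M : 'M[R]_(m, n)) : 0 <= spectral_norm M.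
Proof.
have [C C0 MC] := enorm_mulmx_bound M.
apply: ub_le_sup.
  exists C => _ [z /= z1 <-]; apply: le_trans (MC z) _.
  by rewrite -[leRHS]mulr1 ler_wpM2l.
by exists 0; rewrite /= ?enorm0 ?ler01 // mulmx0 enorm0.
Qed.

End euclidean_norm.

(** * Lebesgue measure on column vectors *)

Section lebesgue_cV_theory.
Variable R : realType.
Local Notation leb n := (@lebesgue_cV R n).

(** The sigma-algebra is generated by the entries and the topology is that of the sup norm. An open
    set is the union of the boxes inside it with rational centre and radius [k.+1%:R^-1], and there
    are countably many of these. *)
Lemma open_measurable_cV n (U : set 'cV[R]_n) : open U -> measurable U.
Proof.
move=> oU.
pose box (qk : 'cV[rat]_n * nat) : set 'cV[R]_n :=
  [set x | forall i, `|x i 0 - ratr (qk.1 i 0)| < qk.2.+1%:R^-1].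
have -> : U = \bigcup_qk (if `[< box qk `<=` U >] then box qk else set0).
  apply/seteqP; split=> [x Ux|x [qk _]]; last by case: asboolP => // + ?; exact.
  have /nbhs_ballP [e /= e0 xU] : nbhs x U by exact: open_nbhs_nbhs.
  have [k ke] : exists k, k.+1%:R^-1 < e / 2.
    have := @ltr_add_invr _ (0 : R) (e / 2); rewrite divr_gt0 // => /(_ isT) [k].
    by rewrite add0r; exists k.
  have /choice [q qP] : forall i, exists r : rat, `|x i 0 - ratr r| < k.+1%:R^-1.
    move=> i; have := @rat_in_itvoo R (x i 0 - k.+1%:R^-1) (x i 0 + k.+1%:R^-1).
    rewrite ltrBlDr -addrA ltrDl addr_gt0 ?invr_gt0 ?ltr0n // => /(_ isT) [r].
    by rewrite in_itv /= => rP; exists r; rewrite ltr_distlC.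
  exists (\col_i q i, k) => //; case: asboolP => [_ i|[]].
    by rewrite /= mxE; exact: qP.
  move=> z zb; apply: xU; split=> // i j; rewrite (ord1 j) /ball /= .
  rewrite -(subrK (ratr (q i)) (x i 0)) -addrA.
  apply: le_lt_trans (ler_normD _ _) _.
  rewrite [e]splitr ltrD //; first exact: lt_trans (qP i) ke.
  by have := zb i; rewrite /= mxE distrC => /lt_trans; apply.
apply: countable_bigcupT_measurable => [|qk]; first exact: countableP.
case: asboolP => // _.
have -> : box qk = \bigcap_(i in [set: 'I_n])
    ((fun x : 'cV[R]_n => x i 0) @^-1`
     [set s : R | `|s - ratr (qk.1 i 0)| < qk.2.+1%:R^-1]).
  by apply/seteqP; split=> x /= h i; [move=> _|]; exact: h.
apply: fin_bigcap_measurable => // i _.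
rewrite -[X in measurable X]setTI; apply: measurable_entry => //.
apply: open_measurable.
rewrite (_ : [set s : R | _] = ball (ratr (qk.1 i 0) : R) qk.2.+1%:R^-1).
  exact: ball_open.
by apply/seteqP; split=> s /=; rewrite /ball /= distrC.
Qed.

Lemma continuous_measurable_cV n (f : 'cV[R]_n -> R) :
  continuous f -> measurable_fun setT f.
Proof.
move=> /continuousP cf; apply: (measurability _ (RGenOpens.measurableE R)).
move=> _ [_ [a [b ->] <-]]; rewrite setTI; apply: open_measurable_cV.
exact/cf/interval_open.
Qed.

Lemma sigma_finite_lebesgue_cV n : sigma_finite setT (leb n).
Proof.
pose F (k : nat) := [set x : 'cV[R]_n | forall i, `[- k%:R, k%:R]%classic (x i 0)].
have mF k : measurable (F k).
  have -> : F k = \bigcap_(i in [set: 'I_n])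
      ((fun x : 'cV[R]_n => x i 0) @^-1` `[- k%:R, k%:R]%classic).
    by apply/seteqP; split=> x /= h i; [move=> _|]; exact: h.
  apply: fin_bigcap_measurable => // i _.
  by rewrite -[X in measurable X]setTI; apply: measurable_entry.
exists F => [|k].
  apply/esym/seteqP; split=> // x _.
  exists (Num.truncn (enorm x)).+1 => // i; rewrite /= in_itv /= -ler_norml.
  by apply: le_trans (ler_coord_enorm x i) _; rewrite ltW // truncnS_gt.
split=> //.
rewrite /F (@lebesgue_cV_box R n (fun=> `[- k%:R, k%:R]%classic)) //.
rewrite -[ltLHS]fineK ?ltry //.
apply: (big_ind (fun u : \bar R => u \is a fin_num)) => // [u v|i _].
  exact: fin_numM.
by rewrite lebesgue_measure_itv /=; case: ifP => _; rewrite ?EFinN.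
Qed.

HB.instance Definition _ n :=
  @Measure_isSigmaFinite.Build _ _ _ (leb n) (sigma_finite_lebesgue_cV n).

Lemma differentiable_sum_fun (V : normedModType R) n (F : 'I_n -> V -> R) (x : V) :
  (forall i, differentiable (F i) x) -> differentiable (fun z => \sum_i F i z)%R x.
Proof.
move=> dF; have -> : (fun z => \sum_i F i z)%R = (\sum_i F i)%R.
  by apply/funext => z; rewrite fct_sumE.
exact: differentiable_sum.
Qed.

Lemma differentiable_dotp n (u v : 'cV[R]_n -> 'cV[R]_n) (x : 'cV[R]_n) :
  (forall i, differentiable (fun z => u z i 0) x) ->
  (forall i, differentiable (fun z => v z i 0) x) ->
  differentiable (fun z => dotp (u z) (v z)) x.
Proof.
move=> du dv; under eq_fun do rewrite dotpE.
by apply: differentiable_sum_fun => i; apply: differentiableM.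
Qed.

Lemma continuous_enorm n : continuous (@enorm R n).
Proof.
move=> x; apply: (@continuous_comp _ _ _ (fun u => dotp u u) (@Num.sqrt R)).
  apply: differentiable_continuous.
  by apply: (@differentiable_dotp _ id id) => i; exact: differentiable_coord.
exact: sqrt_continuous.
Qed.

Lemma measurable_enorm n : measurable_fun setT (@enorm R n).
Proof. by apply: continuous_measurable_cV; exact: continuous_enorm. Qed.

Local Open Scope ereal_scope.

Lemma integral_cVS n (f : 'cV[R]_n.+1 -> \bar R) :
  measurable_fun setT f -> (forall x, 0 <= f x) ->
  \int[leb n.+1]_x f x =
  \int[leb n]_x \int[lebesgue_measure]_s f (cons_cV (x, s)).
Proof.
move=> mf f0.
rewrite /= (@ge0_integral_pushforward _ _ ('cV[R]_n * measurableTypeR R)%type _ R _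
  (@measurable_cons_cV R n) (leb n \x @lebesgue_measure R) setT f) //.
rewrite preimage_setT.
apply: (@fubini_tonelli1 _ _ 'cV[R]_n (measurableTypeR R) R (leb n)
  (@lebesgue_measure R) (f \o @cons_cV R n)) => [|z]; last exact: f0.
exact: measurableT_comp mf (@measurable_cons_cV R n).
Qed.

Lemma measurable_add_cV n (v : 'cV[R]_n) : measurable_fun setT (+%R v).
Proof.
apply: measurable_matrixP => i j; under eq_fun do rewrite mxE.
by apply: measurable_funD => //; exact: measurable_entry.
Qed.

(** The image of Lebesgue measure under the translation has the same values on half-open intervals,
    and these determine the measure. *)
Lemma ge0_integral_addR (f : R -> \bar R) (c : R) :
  measurable_fun setT f -> (forall x, 0 <= f x) ->
  \int[lebesgue_measure]_s f (c + s)%R = \int[lebesgue_measure]_s f s.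
Proof.
move=> mf f0.
have mc : measurable_fun setT (+%R c : R -> R) by exact: measurable_funD.
have pE := @ge0_integral_pushforward _ _ (measurableTypeR R) (measurableTypeR R)
  R (+%R c) mc (@lebesgue_measure R) setT f measurableT mf (fun x _ => f0 x).
rewrite preimage_setT in pE; rewrite -[LHS]pE.
apply: eq_measure_integral => /= A mA _; apply/esym.
apply: (lebesgue_measure_unique (mu :=
  pushforward (@lebesgue_measure R) (+%R c : measurableTypeR R -> measurableTypeR R)))
  => //.
move=> _ [[a b] _ <-] /=; rewrite /pushforward /=.
have -> : (+%R c @^-1` `]a, b] = `]a - c, b - c]%classic)%R.
  by apply/seteqP; split=> s /=; rewrite !in_itv /= ltrBlDl lerBrDl.
by rewrite !lebesgue_measure_itv /= !lte_fin ltrD2r -!EFinB opprB addrA subrK.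
Qed.

Lemma ge0_integral_add_cV n (v : 'cV[R]_n) (f : 'cV[R]_n -> \bar R) :
  measurable_fun setT f -> (forall x, 0 <= f x) ->
  \int[leb n]_x f (v + x)%R = \int[leb n]_x f x.
Proof.
elim: n v f => [|n IH] v f mf f0.
  by apply: eq_integral => x _; congr f; apply/colP => -[].
pose v' := (\col_i v (lift ord0 i) 0)%R.
have vE (x : 'cV[R]_n) s :
    (v + cons_cV (x, s) = cons_cV (v' + x, v ord0 0 + s))%R.
  apply/colP => i; rewrite mxE; case: (unliftP ord0 i) => [k|] ->.
    by rewrite !cons_cVS !mxE.
  by rewrite !cons_cV0.
have mfv (u : 'cV[R]_n.+1) : measurable_fun setT (fun x => f (u + x)%R).
  exact: measurableT_comp mf (measurable_add_cV u).
rewrite integral_cVS // [RHS]integral_cVS //.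
have mF : measurable_fun setT
    (fun x : 'cV[R]_n => \int[lebesgue_measure]_s f (cons_cV (x, s))).
  apply: (@measurable_fun_fubini_tonelli_F _ _ _ _ _ lebesgue_measure
    (fun z => f (cons_cV z))) => //.
  exact: measurableT_comp mf (@measurable_cons_cV R n).
rewrite -[RHS](IH v') //; last by move=> x; exact: integral_ge0.
apply: eq_integral => x _.
under eq_integral do rewrite vE.
rewrite (@ge0_integral_addR (fun s => f (cons_cV (v' + x, s))%R)) //.
apply: measurableT_comp mf _; apply: measurableT_comp (@measurable_cons_cV R n) _.
exact: measurable_pair1.
Qed.

Lemma integral_add_cV n (v : 'cV[R]_n) (f : 'cV[R]_n -> \bar R) :
  measurable_fun setT f ->
  \int[leb n]_x f (v + x)%R = \int[leb n]_x f x.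
Proof.
move=> mf; rewrite integralE [RHS]integralE; congr (_ - _).
  rewrite -(@ge0_integral_add_cV _ v f^\+) //; first by apply: eq_integral => x _; rewrite !funeposE.
  exact: measurable_funepos.
rewrite -(@ge0_integral_add_cV _ v f^\-) //; first by apply: eq_integral => x _; rewrite !funenegE.
  exact: measurable_funeneg.
Qed.

Lemma integral_gaussR_lty (k : R) : (0 < k)%R ->
  \int[lebesgue_measure]_s (expR (- (k * s ^+ 2)))%:E < +oo.
Proof.
(* The standard deviation for which the normal density is proportional to the integrand. *)
move=> k0; pose s0 : R := (Num.sqrt (2 * k))^-1%R.
have s0_gt0 : (0 < s0)%R by rewrite invr_gt0 sqrtr_gt0 mulr_gt0.
have sE : (s0 ^+ 2 *+ 2 = k^-1)%R.
  rewrite exprVn sqr_sqrtr ?mulr_ge0 ?ltW // -mulr_natl; field.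
  exact: lt0r_neq0.
have p_gt0 := normal_peak_gt0 (lt0r_neq0 s0_gt0).
have E x : (expR (- (k * x ^+ 2)))%:E =
    (normal_peak s0)^-1%:E * (normal_pdf 0 s0 x)%:E.
  rewrite normal_pdfE ?lt0r_neq0 //= /normal_fun subr0 sE invrK -EFinM.
  by rewrite mulKf ?lt0r_neq0 // mulNr mulrC.
under eq_integral do rewrite E.
rewrite ge0_integralZl_EFin //.
- by rewrite integral_normal_pdf mule1 ltry.
- by move=> x _; rewrite lee_fin normal_pdf_ge0.
- by apply/measurable_EFinP; exact: measurable_normal_pdf.
- by rewrite invr_ge0 ltW.
Qed.

Lemma integral_gauss_cV_lty n (k : R) : (0 < k)%R ->
  \int[leb n]_x (expR (- (k * enorm x ^+ 2)))%:E < +oo.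
Proof.
move=> k0.
have mg m : measurable_fun setT
    (fun x : 'cV[R]_m => (expR (- (k * enorm x ^+ 2)))%:E).
  apply/measurable_EFinP/measurableT_comp => //.
  apply: measurableT_comp => //; apply: measurable_funM => //.
  apply: measurable_funX; exact: measurable_enorm.
elim: n => [|n IH].
  rewrite [X in X < _](_ : _ = (expR (- (k * enorm (0 : 'cV[R]_0) ^+ 2)))%:E) ?ltry //.
  rewrite /= integral_dirac //; last exact: mg.
  by rewrite /dirac indicT mul1e.
rewrite integral_cVS; [|exact: mg|by move=> x; rewrite lee_fin expR_ge0].
have E (x : 'cV[R]_n) : \int[lebesgue_measure]_s
    (expR (- (k * enorm (cons_cV (x, s)) ^+ 2)))%:E =
    \int[lebesgue_measure]_s (expR (- (k * s ^+ 2)))%:E *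
    (expR (- (k * enorm x ^+ 2)))%:E.
  rewrite muleC -ge0_integralZl_EFin //.
  - apply: eq_integral => s _; rewrite -EFinM -expRD; congr (expR _)%:E.
    rewrite !sqr_enormE big_ord_recl cons_cV0 /=.
    under eq_bigr do rewrite cons_cVS.
    by rewrite mulrDr opprD addrC.
  - apply/measurable_EFinP/measurableT_comp => //.
    by apply: measurableT_comp => //; apply: measurable_funM => //; exact: measurable_funX.
under eq_integral do rewrite E.
have J0 : 0 <= \int[lebesgue_measure]_s (expR (- (k * s ^+ 2)))%:E :> \bar R.
  by apply: integral_ge0 => s _; rewrite lee_fin expR_ge0.
have Jfin : \int[lebesgue_measure]_s (expR (- (k * s ^+ 2)))%:E \is a fin_num.
  by rewrite ge0_fin_numE // integral_gaussR_lty.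
rewrite -(fineK Jfin) ge0_integralZl_EFin //; [|exact: mg|exact: fine_ge0].
by rewrite lte_mul_pinfty // lee_fin fine_ge0.
Qed.

End lebesgue_cV_theory.

(** * Gaussian domination and quadratic growth *)

Section calculus.
Variables (R : realType) (n : nat).
Implicit Types (f g h : 'cV[R]_n -> R) (x v : 'cV[R]_n).

Lemma derive_grad f x v : differentiable f x -> 'D_v f x = dotp (grad f x) v.
Proof.
move=> df; rewrite deriveE // [in LHS](_ : v = \sum_i v i 0 *: delta_mx i 0).
  rewrite linear_sum dotpE; apply: eq_bigr => i _.
  by rewrite linearZ /= mxE deriveE // mulrC.
apply/colP => i; rewrite summxE (bigD1 i) //= !mxE !eqxx mulr1 big1 ?addr0 // => j ji.
by rewrite !mxE eq_sym (negPf ji) mulr0.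
Qed.

Lemma is_derive_line f x v (t : R) : differentiable f (x + t *: v) ->
  is_derive t 1 (fun s => f (x + s *: v)) (dotp (grad f (x + t *: v)) v).
Proof.
move=> df.
have E : (fun s : R => s^-1 *: (((fun s => f (x + s *: v)) \o shift t) (s *: 1) -
      f (x + t *: v))) =
    (fun s : R => s^-1 *: ((f \o shift (x + t *: v)) (s *: v) - f (x + t *: v))).
  apply/funext => s /=; congr (_ *: (f _ - _)).
  by rewrite [_%:A]mulr1 scalerDl addrCA.
have dv : derivable f (x + t *: v) v by exact: diff_derivable.
apply: DeriveDef.
  by move: dv; rewrite /derivable /= E.
by rewrite -derive_grad // /derive /= E.
Qed.

End calculus.

Section gaussian_domination.
Variables (R : realType) (n : nat).
Implicit Types (f g h : 'cV[R]_n -> R) (x v : 'cV[R]_n).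
Local Notation leb := (@lebesgue_cV R n).

(** Weights are [gauss_dom] and the functions integrated against them are [quad_growth]; by
    [gauss_domM] the products are again [gauss_dom], hence integrable. *)
Definition gauss_dom g := measurable_fun setT g /\
  exists K k : R, 0 < k /\ forall x, `|g x| <= K * expR (- (k * enorm x ^+ 2)).

Definition quad_growth g := measurable_fun setT g /\
  exists C : R, forall x, `|g x| <= C * (1 + enorm x ^+ 2).

Lemma measurable_gauss (k : R) :
  measurable_fun setT (fun x : 'cV[R]_n => expR (- (k * enorm x ^+ 2))).
Proof.
apply: measurableT_comp => //; apply: measurableT_comp => //.
by apply: measurable_funM => //; apply: measurable_funX; exact: measurable_enorm.
Qed.

Lemma integrable_gauss (K k : R) : 0 < k ->
  leb.-integrable setT (EFin \o (fun x => K * expR (- (k * enorm x ^+ 2)))).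
Proof.
move=> k0.
have : leb.-integrable setT (EFin \o (fun x => expR (- (k * enorm x ^+ 2)))).
  apply/integrableP; split.
    by apply/measurable_EFinP; exact: measurable_gauss.
  under eq_integral do rewrite /= ger0_norm ?expR_ge0 //.
  exact: integral_gauss_cV_lty.
by move=> /(integrableZl measurableT K); apply: eq_integrable.
Qed.

Lemma gauss_dom_integrable g : gauss_dom g -> leb.-integrable setT (EFin \o g).
Proof.
move=> [mg [K [k [k0 gK]]]]; apply: (le_integrable measurableT _ _ (integrable_gauss K k0)).
  exact/measurable_EFinP.
by move=> x _; rewrite /= lee_fin; exact: le_trans (gK x) (ler_norm _).
Qed.

Lemma gauss_domW f g : measurable_fun setT f -> gauss_dom g ->
  (forall x, `|f x| <= `|g x|) -> gauss_dom f.
Proof.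
move=> mf [_ [K [k [k0 gK]]]] fg; split=> //; exists K, k; split=> // x.
exact: le_trans (fg x) (gK x).
Qed.

(** Half of the Gaussian rate absorbs the polynomial factor, by
    [1 + u <= (1 + 2 / k) * expR (k / 2 * u)]. *)
Lemma gauss_domM p g : quad_growth p -> gauss_dom g -> gauss_dom (fun x => p x * g x).
Proof.
move=> [mp [C pC]] [mg [K [k [k0 gK]]]]; split; first exact: measurable_funM.
exists (`|C| * (1 + 2 / k) * `|K|), (k / 2); split=> [|x]; first exact: divr_gt0.
set u := enorm x ^+ 2; have u0 : 0 <= u by exact: sqr_ge0.
rewrite normrM.
have e1 : 1 + u <= (1 + 2 / k) * expR (k / 2 * u).
  have k2 : 0 <= 2 / k by rewrite divr_ge0 // ltW.
  have ku : 0 <= k / 2 * u by rewrite mulr_ge0 // divr_ge0 // ltW.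
  apply: le_trans (_ : (1 + 2 / k) * (1 + k / 2 * u) <= _).
    rewrite mulrDl mul1r mulrDr mulr1.
    rewrite (_ : 2 / k * (k / 2 * u) = u); last by field; exact: lt0r_neq0.
    lra.
  by rewrite ler_wpM2l ?expR_ge1Dx // addr_ge0.
have p1 : `|p x| <= `|C| * ((1 + 2 / k) * expR (k / 2 * u)).
  apply: le_trans (pC x) _; apply: le_trans (_ : `|C| * (1 + u) <= _).
    by rewrite ler_wpM2r ?ler_norm // addr_ge0.
  by rewrite ler_wpM2l.
have g1 : `|g x| <= `|K| * expR (- (k * u)).
  by apply: le_trans (gK x) _; rewrite ler_wpM2r ?expR_ge0 ?ler_norm.
apply: le_trans (ler_pM _ _ p1 g1) _ => //.
rewrite -/u [leLHS](_ : _ = `|C| * (1 + 2 / k) * `|K| *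
  (expR (k / 2 * u) * expR (- (k * u)))); last by ring.
by rewrite -expRD (_ : k / 2 * u - k * u = - (k / 2 * u)) //; field.
Qed.

Lemma quad_growthD f g : quad_growth f -> quad_growth g ->
  quad_growth (fun x => f x + g x).
Proof.
move=> [mf [C fC]] [mg [D gD]]; split; first exact: measurable_funD.
exists (C + D) => x; rewrite mulrDl.
by apply: le_trans (ler_normD _ _) _; apply: lerD.
Qed.

Lemma quad_growth_bounded f (C : R) : measurable_fun setT f ->
  (forall x, `|f x| <= C) -> quad_growth f.
Proof.
move=> mf fC; split=> //; exists C => x; apply: le_trans (fC x) _.
rewrite ler_peMr ?lerDl ?sqr_ge0 //; exact: le_trans (fC 0).
Qed.

Lemma quad_growthMl f g (C : R) : measurable_fun setT f ->
  (forall x, `|f x| <= C) -> quad_growth g -> quad_growth (fun x => f x * g x).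
Proof.
move=> mf fC [mg [D gD]]; split; first exact: measurable_funM.
exists (C * D) => x; rewrite normrM -mulrA; exact: ler_pM.
Qed.

Lemma dominated_Rintegral (F : nat -> 'cV[R]_n -> R) f (G : 'cV[R]_n -> R) :
  (forall j, measurable_fun setT (F j)) -> measurable_fun setT f ->
  (forall x, F ^~ x @ \oo --> f x) ->
  leb.-integrable setT (EFin \o G) ->
  (forall j x, `|F j x| <= G x) ->
  (fun j => \int[leb]_x F j x) @ \oo --> \int[leb]_x f x.
Proof.
move=> mF mf Ff iG FG.
have [|||||i1 _ h] := @dominated_convergence _ _ R leb setT measurableT
  (fun j => EFin \o F j) (EFin \o f) (EFin \o G).
- by move=> j; exact/measurable_EFinP.
- exact/measurable_EFinP.
- by apply: aeW => x _; apply: cvg_EFin; [exact: nearW|exact: Ff].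
- exact: iG.
- by apply: aeW => x j _; rewrite /= lee_fin.
apply: fine_cvg; rewrite fineK //; exact: integrable_fin_num.
Qed.

(** By translation invariance the difference quotients of [h] along [v] have integral 0, and they
    converge to the directional derivative under a Gaussian majorant. This is the source of all
    integrations by parts. *)
Lemma integral_dotp_grad h v (K k : R) : 0 < k ->
  (forall x, differentiable h x) ->
  measurable_fun setT (fun x => dotp (grad h x) v) ->
  gauss_dom h ->
  (forall x, `|dotp (grad h x) v| <= K * expR (- (k * enorm x ^+ 2))) ->
  \int[leb]_x (dotp (grad h x) v) = 0.
Proof.
move=> k0 dh mD [mh hdom] Dle.
have K0 : 0 <= K.
  by have := le_trans (normr_ge0 _) (Dle 0); rewrite pmulr_lge0 // expR_gt0.
have ih := gauss_dom_integrable (conj mh hdom).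
pose e (k : nat) : R := k.+1%:R^-1.
have e0 j : 0 < e j by rewrite invr_gt0.
have e1 j : e j <= 1 by rewrite invf_le1 ?ltr0n // ler1n.
pose f (j : nat) x := (e j)^-1 * (h (e j *: v + x) - h x).
have mhv j : measurable_fun setT (fun x => h (e j *: v + x)).
  exact: measurableT_comp mh (measurable_add_cV _).
have mf j : measurable_fun setT (f j).
  by apply: measurable_funM => //; apply: measurable_funB.
have ihv j : leb.-integrable setT (EFin \o (fun x => h (e j *: v + x))).
  apply/integrableP; split; first exact/measurable_EFinP.
  have /integrableP[_] := ih; congr (_ < _)%E; symmetry.
  apply: (@integral_add_cV _ _ _ (fun x => `|(h x)%:E|%E)).
  by apply: measurableT_comp => //; exact/measurable_EFinP.
have f0 j : (\int[leb]_x (f j x)%:E = 0)%E.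
  rewrite /f; under eq_integral do rewrite EFinM.
  rewrite integralZl //; last by apply: (integrableB measurableT (ihv j) ih).
  rewrite (_ : (\int[leb]_x _)%E = 0%E) ?mule0 //.
  have -> := integralB_EFin measurableT (ihv j) ih.
  rewrite (@integral_add_cV _ _ _ (EFin \o h)); last exact/measurable_EFinP.
  by rewrite subee //; exact: integrable_fin_num.
(* By the mean value theorem [f j x] is a derivative at [x + s *: v] with [0 < s < 1]. Since |x|^2
   <= 2 |x + s v|^2 + 2 |v|^2, the Gaussian at that point is at most a centred one with half the
   rate. *)
pose G x := (K * expR (k * enorm v ^+ 2)) * expR (- (k / 2 * enorm x ^+ 2)).
have fG j x : `|f j x| <= G x.
  have der (s : R) : is_derive s 1 (fun t => h (x + t *: v))
      (dotp (grad h (x + s *: v)) v) by apply: is_derive_line.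
  have [s] := MVT (e0 j) (fun s _ => der s) (derivable_within_continuous
    (fun s _ => @ex_derive _ _ _ _ _ _ _ (der s))).
  rewrite in_itv /= => /andP[s0 s1].
  rewrite scale0r addr0 subr0 /f (addrC _ x) => ->.
  rewrite mulrC mulfK ?lt0r_neq0 //.
  apply: le_trans (Dle _) _; rewrite /G -mulrA ler_wpM2l // -expRD ler_expR.
  have := ler_enorm_add2 (x + s *: v) (- (s *: v)).
  rewrite addrK enormN enormZ exprMn (ger0_norm (ltW s0)).
  have : s ^+ 2 * enorm v ^+ 2 <= enorm v ^+ 2.
    by rewrite ler_piMl ?sqr_ge0 // expr_le1 // ltW // (lt_le_trans s1).
  set a := enorm _ ^+ 2; set b := enorm _ ^+ 2; set c := enorm _ ^+ 2.
  move=> h1 h2; have h3 : b <= 2 * c + 2 * a by lra.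
  have := ler_wpM2l (ltW k0) h3; lra.
have fcvg x : f ^~ x @ \oo --> dotp (grad h x) v.
  have dv : derivable h x v by exact: diff_derivable.
  rewrite -derive_grad //.
  have ecvg : e @ \oo --> 0^'.
    move=> /= P P0; have /= H := @cvg_harmonic R _ P0.
    by apply: (@filterS _ \oo _ _ _ _ H) => j; apply; exact: lt0r_neq0 (e0 j).
  exact: (cvg_comp _ _ ecvg dv).
have := @dominated_Rintegral f _ G mf mD fcvg (integrable_gauss _ (divr_gt0 k0 (ltr0Sn R 1))) fG.
have -> : (fun j => \int[leb]_x f j x) = cst 0.
  by apply/funext => j; rewrite /Rintegral f0.
by move=> /(cvg_unique _ (cvg_cst 0)) ->.
Qed.

End gaussian_domination.

(** * Poincare inequality on a cube *)

Section tensorization.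
Local Open Scope ereal_scope.
Context d1 d2 (T1 : measurableType d1) (T2 : measurableType d2) (R : realType).
Variables (m1 : {finite_measure set T1 -> \bar R}).
Variables (m2 : {finite_measure set T2 -> \bar R}).
Let P := m1 \x m2.
HB.instance Definition _ := Measure.on P.

Let fin_num_P : fin_num_fun P.
Proof.
move=> A mA; rewrite ge0_fin_numE //.
apply: (@le_lt_trans _ _ (P setT)); first by apply: le_measure; rewrite ?inE.
rewrite /P -setXTT product_measure1E // lte_mul_pinfty ?fin_num_measure //.
by rewrite -ge0_fin_numE // fin_num_measure.
Qed.

HB.instance Definition _ := @Measure_isFinite.Build _ (T1 * T2)%type _ P fin_num_P.

(** Between [z] and [w] insert the point [(w.1, z.2)], which shares a component with each of them,
    and use [(p + q) ^+ 2 <= 2 * p ^+ 2 + 2 * q ^+ 2]. Each of the two terms ignores one variable;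
    integrating over it produces the total masses in the constants. *)
Lemma tensorized_variance (F G1 G2 : T1 * T2 -> R) (C1 C2 : R) :
  measurable_fun setT F -> measurable_fun setT G1 -> measurable_fun setT G2 ->
  (0 <= C1)%R -> (0 <= C2)%R ->
  (forall z, 0 <= G1 z)%R -> (forall z, 0 <= G2 z)%R ->
  (forall s, \int[m1]_x \int[m1]_y ((F (x, s) - F (y, s)) ^+ 2)%:E
     <= C1%:E * \int[m1]_x (G1 (x, s))%:E) ->
  (forall y, \int[m2]_t \int[m2]_s ((F (y, s) - F (y, t)) ^+ 2)%:E
     <= C2%:E * \int[m2]_s (G2 (y, s))%:E) ->
  \int[m1 \x m2]_z \int[m1 \x m2]_w ((F z - F w) ^+ 2)%:E <=
  (2 * fine (m2 setT) * C1)%:E * \int[m1 \x m2]_z (G1 z)%:E +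
  (2 * fine (m1 setT) * C2)%:E * \int[m1 \x m2]_z (G2 z)%:E.
Proof.
move=> mF mG1 mG2 C10 C20 G10 G20 H1 H2; rewrite -/P.
have m1E : m1 setT = (fine (m1 setT))%:E by rewrite fineK // fin_num_measure.
have m2E : m2 setT = (fine (m2 setT))%:E by rewrite fineK // fin_num_measure.
pose A (zw : (T1 * T2) * (T1 * T2)) : \bar R :=
  (2 * (F zw.1 - F (zw.2.1, zw.1.2)) ^+ 2)%:E.
pose B (zw : (T1 * T2) * (T1 * T2)) : \bar R :=
  (2 * (F (zw.2.1, zw.1.2) - F zw.2) ^+ 2)%:E.
have m_1 : measurable_fun setT (fun zw : (T1 * T2) * (T1 * T2) => F zw.1).
  exact: measurableT_comp mF measurable_fst.
have m_2 : measurable_fun setT (fun zw : (T1 * T2) * (T1 * T2) => F zw.2).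
  exact: measurableT_comp mF measurable_snd.
have m_h : measurable_fun setT
    (fun zw : (T1 * T2) * (T1 * T2) => F (zw.2.1, zw.1.2)).
  apply: measurableT_comp mF _; apply: measurable_fun_pair => /=.
    exact: measurableT_comp measurable_fst measurable_snd.
  exact: measurableT_comp measurable_snd measurable_fst.
have mA : measurable_fun setT A.
  apply/measurable_EFinP; apply: measurable_funM => //; apply: measurable_funX.
  exact: measurable_funB.
have mB : measurable_fun setT B.
  apply/measurable_EFinP; apply: measurable_funM => //; apply: measurable_funX.
  exact: measurable_funB.
have A0 zw : 0 <= A zw by rewrite lee_fin mulr_ge0 ?sqr_ge0.
have B0 zw : 0 <= B zw by rewrite lee_fin mulr_ge0 ?sqr_ge0.
have mH : measurable_fun setT (fun zw : (T1 * T2) * (T1 * T2) =>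
    ((F zw.1 - F zw.2) ^+ 2)%:E).
  apply/measurable_EFinP; apply: measurable_funX; exact: measurable_funB.
have mJA := @measurable_fun_fubini_tonelli_F _ _ _ _ _ P _ mA A0.
have mJB := @measurable_fun_fubini_tonelli_F _ _ _ _ _ P _ mB B0.
apply: (@le_trans _ _ (\int[P]_z (\int[P]_w A (z, w) + \int[P]_w B (z, w)))).
  apply: ge0_le_integral => //.
  - by move=> z _; apply: integral_ge0 => w _; rewrite lee_fin sqr_ge0.
  - apply: (@measurable_fun_fubini_tonelli_F _ _ _ _ _ P _ mH) => zw.
    by rewrite lee_fin sqr_ge0.
  - exact: emeasurable_funD.
  move=> z _; rewrite -ge0_integralD //; last 2 first.
  - exact: measurableT_comp mA (measurable_pair1 z).
  - exact: measurableT_comp mB (measurable_pair1 z).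
  apply: ge0_le_integral => //.
  - by move=> w _; rewrite lee_fin sqr_ge0.
  - exact: measurableT_comp mH (measurable_pair1 z).
  - apply: emeasurable_funD.
      exact: measurableT_comp mA (measurable_pair1 z).
    exact: measurableT_comp mB (measurable_pair1 z).
  move=> w _; rewrite -EFinD lee_fin /=.
  have := sqr_ge0 ((F z - F (w.1, z.2)) - (F (w.1, z.2) - F w)).
  nra.
rewrite ge0_integralD //; last 2 first.
- by move=> z _; exact: integral_ge0.
- by move=> z _; exact: integral_ge0.
apply: leeD.
  have EA z : \int[P]_w A (z, w) =
      (2 * fine (m2 setT))%:E * \int[m1]_y ((F z - F (y, z.2)) ^+ 2)%:E.
    rewrite /P fubini_tonelli1 //; last first.
      exact: measurableT_comp mA (measurable_pair1 z).
    rewrite -ge0_integralZl_EFin //; last 3 first.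
    - by move=> y _; rewrite lee_fin sqr_ge0.
    - apply/measurable_EFinP; apply: measurable_funX; apply: measurable_funB => //.
      exact: measurableT_comp mF (measurable_pair2 z.2).
    - by rewrite mulr_ge0 ?fine_ge0.
    apply: eq_integral => y _; rewrite /fubini_F /A /= integral_cst //.
    by rewrite [X in _ * X]m2E -EFinM mulrAC.
  under eq_integral do rewrite EA.
  have mK : measurable_fun setT
      (fun zy : (T1 * T2) * T1 => ((F zy.1 - F (zy.2, zy.1.2)) ^+ 2)%:E).
    apply/measurable_EFinP; apply: measurable_funX; apply: measurable_funB.
      exact: measurableT_comp mF measurable_fst.
    apply: measurableT_comp mF _; apply: measurable_fun_pair => /=.
      exact: measurable_snd.
    exact: measurableT_comp measurable_snd measurable_fst.
  have K0 zy : 0 <= ((F zy.1 - F (zy.2, zy.1.2)) ^+ 2)%:E :> \bar R.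
    by rewrite lee_fin sqr_ge0.
  have mJK := @measurable_fun_fubini_tonelli_F _ _ _ _ _ m1 _ mK K0.
  rewrite ge0_integralZl_EFin //; last 2 first.
  - by move=> z _; apply: integral_ge0 => y _; rewrite lee_fin sqr_ge0.
  - by rewrite mulr_ge0 ?fine_ge0.
  rewrite [(_ * C1)%:E]EFinM -muleA lee_wpmul2l ?lee_fin ?mulr_ge0 ?fine_ge0 //.
  have mG1' : measurable_fun setT (fun z => (G1 z)%:E) by exact/measurable_EFinP.
  rewrite /P fubini_tonelli2 //; last by move=> z; apply: integral_ge0 => y _; rewrite lee_fin sqr_ge0.
  rewrite fubini_tonelli2 //.
  rewrite -ge0_integralZl_EFin //; last 2 first.
  - by move=> s _; apply: integral_ge0 => x _; rewrite lee_fin.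
  - by apply: (@measurable_fun_fubini_tonelli_G _ _ _ _ _ _ _ mG1') => z; rewrite lee_fin.
  apply: ge0_le_integral => //.
  - by move=> s _; apply: integral_ge0 => x _; apply: integral_ge0 => y _; rewrite lee_fin sqr_ge0.
  - by apply: (@measurable_fun_fubini_tonelli_G _ _ _ _ _ _ _ mJK) => z; apply: integral_ge0 => y _; rewrite lee_fin sqr_ge0.
  - apply: measurable_funeM; apply: (@measurable_fun_fubini_tonelli_G _ _ _ _ _ _ _ mG1') => z.
    by rewrite lee_fin.
  by move=> s _; exact: H1.
(* [B] depends on [z] only through [z.2], so here the integral over [z] is taken first. *)
rewrite [leLHS](@fubini_tonelli _ _ _ _ _ P P B mB B0).
have EB w : \int[P]_z B (z, w) =
    (2 * fine (m1 setT))%:E * \int[m2]_s ((F (w.1, s) - F w) ^+ 2)%:E.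
  rewrite /P fubini_tonelli2 //; last first.
    exact: measurableT_comp mB (measurable_pair2 w).
  rewrite -ge0_integralZl_EFin //; last 3 first.
  - by move=> y _; rewrite lee_fin sqr_ge0.
  - apply/measurable_EFinP; apply: measurable_funX; apply: measurable_funB => //.
    exact: measurableT_comp mF (measurable_pair1 w.1).
  - by rewrite mulr_ge0 ?fine_ge0.
  apply: eq_integral => y _; rewrite /fubini_G /B /= integral_cst //.
  by rewrite [X in _ * X]m1E -EFinM mulrAC.
under eq_integral do rewrite EB.
have mK : measurable_fun setT
    (fun ws : (T1 * T2) * T2 => ((F (ws.1.1, ws.2) - F ws.1) ^+ 2)%:E).
  apply/measurable_EFinP; apply: measurable_funX; apply: measurable_funB.
    apply: measurableT_comp mF _; apply: measurable_fun_pair => /=.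
      exact: measurableT_comp measurable_fst measurable_fst.
    exact: measurable_snd.
  exact: measurableT_comp mF measurable_fst.
have K0 ws : 0 <= ((F (ws.1.1, ws.2) - F ws.1) ^+ 2)%:E :> \bar R.
  by rewrite lee_fin sqr_ge0.
have mJK := @measurable_fun_fubini_tonelli_F _ _ _ _ _ m2 _ mK K0.
rewrite ge0_integralZl_EFin //; last 2 first.
- by move=> z _; apply: integral_ge0 => y _; rewrite lee_fin sqr_ge0.
- by rewrite mulr_ge0 ?fine_ge0.
rewrite [(_ * C2)%:E]EFinM -muleA lee_wpmul2l ?lee_fin ?mulr_ge0 ?fine_ge0 //.
have mG2' : measurable_fun setT (fun z => (G2 z)%:E) by exact/measurable_EFinP.
rewrite /P fubini_tonelli1 //; last by move=> z; apply: integral_ge0 => y _; rewrite lee_fin sqr_ge0.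
rewrite fubini_tonelli1 //.
rewrite -ge0_integralZl_EFin //; last 2 first.
- by move=> s _; apply: integral_ge0 => x _; rewrite lee_fin.
- by apply: (@measurable_fun_fubini_tonelli_F _ _ _ _ _ _ _ mG2') => z; rewrite lee_fin.
apply: ge0_le_integral => //.
- by move=> s _; apply: integral_ge0 => x _; apply: integral_ge0 => y _; rewrite lee_fin sqr_ge0.
- by apply: (@measurable_fun_fubini_tonelli_F _ _ _ _ _ _ _ mJK) => z; apply: integral_ge0 => y _; rewrite lee_fin sqr_ge0.
- apply: measurable_funeM; apply: (@measurable_fun_fubini_tonelli_F _ _ _ _ _ _ _ mG2') => z.
  by rewrite lee_fin.
by move=> y _; exact: H2.
Qed.

End tensorization.

Section interval_poincare.
Variable R : realType.
Local Notation mu := (@lebesgue_measure R).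

(** The Cauchy-Schwarz bound for the integral of [g'], obtained from
    [g' u ^+ 2 >= 2 * l * g' u - l ^+ 2] with [l] the mean slope: the right side has the
    antiderivative [F], whose increment is [(g s - g t) ^+ 2 / (s - t)]. *)
Lemma sqr_increment_le (g : R -> R) (r s t : R) :
  (forall x, derivable g x 1) -> continuous (g^`())%classic ->
  s \in `[-r, r] -> t \in `[-r, r] ->
  (((g s - g t) ^+ 2)%R%:E <=
   (2 * r)%R%:E * \int[mu]_(u in `[(- r)%R, r]) (((g^`())%classic u) ^+ 2)%R%:E)%E.
Proof.
move=> dg cg'.
wlog st : s t / t < s.
  move=> H sr tr; have [st|st|->] := ltgtP s t; last 2 first.
  - exact: H.
  - rewrite subrr expr0n /= mule_ge0 //.
      move: sr; rewrite in_itv /= lee_fin => /andP[]; lra.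
    by apply: integral_ge0 => u _; rewrite lee_fin sqr_ge0.
  by rewrite -sqrrN opprB; exact: H.
rewrite !in_itv /= => /andP[s1 s2] /andP[t1 t2].
pose g' : R -> R := (g^`())%classic; pose l := (g s - g t) / (s - t).
have st0 : s - t != 0 by rewrite subr_eq0 gt_eqF.
have cg (u : R) : {for u, continuous g}.
  exact/differentiable_continuous/derivable1_diffP.
pose F u := 2 * l * g u - l ^+ 2 * u.
pose f u := 2 * l * g' u - l ^+ 2.
have dF (u : R) : is_derive u 1 F (f u).
  have dgu : is_derive u 1 g (g' u) by rewrite /g' derive1E; exact: derivableP.
  by apply: is_derive_eq; rewrite /f /GRing.scale /= !mulr1.
have cf : continuous f.
  move=> u; apply: cvgB; last exact: cvg_cst.
  by apply: cvgM; [exact: cvg_cst|exact: cg'].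
have cF (u : R) : {for u, continuous F}.
  by apply/differentiable_continuous/derivable1_diffP.
have mg'2 : measurable_fun setT (fun u => (g' u ^+ 2)%:E).
  apply/measurable_EFinP; apply: measurable_funX; exact: continuous_measurable_fun.
have iF : (\int[mu]_(u in `[t, s]) (f u)%:E = ((g s - g t) ^+ 2 / (s - t))%:E)%E.
  rewrite (@continuous_FTC2 _ f F) //.
  - rewrite -EFinB; congr (_%:E); rewrite /F /l; field.
    by rewrite subr_eq0 gt_eqF.
  - exact: continuous_subspaceT.
  - by split=> [u _||]; [exact: ex_derive|apply: cvg_at_right_filter; exact: cF|
      apply: cvg_at_left_filter; exact: cF].
  - by move=> u _; rewrite derive1E; apply: derive_val.
have le1 : (((g s - g t) ^+ 2 / (s - t))%:E <=
    \int[mu]_(u in `[(- r)%R, r]) (g' u ^+ 2)%:E)%E.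
  rewrite -iF; apply: (@le_trans _ _ (\int[mu]_(u in `[t, s]) (g' u ^+ 2)%:E)%E).
    apply: le_integral => //.
    - by apply: continuous_compact_integrable; [exact: segment_compact|
        exact: continuous_subspaceT].
    - apply: continuous_compact_integrable; first exact: segment_compact.
      apply: continuous_subspaceT => u; apply: cvgM; exact: cg'.
    - move=> u _; rewrite lee_fin /f; have := sqr_ge0 (g' u - l); nra.
  apply: ge0_subset_integral => //.
  - exact: measurable_funTS.
  - by move=> u _; rewrite lee_fin sqr_ge0.
  - by move=> u /=; rewrite !in_itv /= => /andP[? ?]; apply/andP; split; lra.
have -> : (g s - g t) ^+ 2 = (s - t) * ((g s - g t) ^+ 2 / (s - t)).
  by field.
rewrite EFinM; apply: lee_pmul => //.
- by rewrite lee_fin subr_ge0 ltW.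
- by rewrite lee_fin divr_ge0 ?sqr_ge0 // subr_ge0 ltW.
- by rewrite lee_fin; lra.
Qed.

End interval_poincare.

Section cube_poincare.
Variable R : realType.
Local Notation leb n := (@lebesgue_cV R n).
Local Notation mu := (@lebesgue_measure R).

Definition cube n (r : R) : set 'cV[R]_n :=
  [set x | forall i, `[- r, r]%classic (x i 0)].

Lemma measurable_cube n r : measurable (@cube n r).
Proof.
have -> : @cube n r = \bigcap_(i in [set: 'I_n])
    ((fun x : 'cV[R]_n => x i 0) @^-1` `[- r, r]%classic).
  by apply/seteqP; split=> x /= h i; [move=> _|]; exact: h.
apply: fin_bigcap_measurable => // i _.
by rewrite -[X in measurable X]setTI; apply: measurable_entry.
Qed.

Lemma lebesgue_cube n r : 0 <= r -> leb n (@cube n r) = ((2 * r) ^+ n)%:E.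
Proof.
move=> r0; rewrite (@lebesgue_cV_box R n (fun=> `[- r, r]%classic)) //.
have -> : (\prod_(i < n) mu `[(- r)%R, r]%classic = \prod_(i < n) (2 * r)%R%:E)%E.
  apply: eq_bigr => i _; rewrite lebesgue_measure_itv /= lte_fin.
  have [_|r1] := ltP (- r) r; first by rewrite -EFinB; congr (_%:E); ring.
  by congr (_%:E); lra.
elim: n => [|n IH]; first by rewrite big_ord0 expr0.
by rewrite big_ord_recl IH -EFinM exprS.
Qed.

Lemma cube_fin n r : 0 <= r -> (leb n (@cube n r) < +oo)%E.
Proof. by move=> r0; rewrite lebesgue_cube // ltry. Qed.

Lemma segment_fin (r : R) : (mu `[(- r)%R, r]%classic < +oo)%E.
Proof. by rewrite lebesgue_measure_itv /=; case: ifP => _; rewrite -?EFinB ltry. Qed.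

Local Open Scope ereal_scope.

(** Tensorization asks for finite measures, while the inequalities to be used are integrals over a
    cube; this passes from one to the other. *)
Lemma ge0_integral_mfrestr d (T : measurableType d) (nu : {measure set T -> \bar R})
    (D : set T) (mD : measurable D) (Doo : nu D < +oo) (f : T -> \bar R) :
  measurable_fun setT f -> (forall x, 0 <= f x) ->
  \int[mfrestr mD Doo]_x f x = \int[nu]_(x in D) f x.
Proof.
move=> mf f0.
rewrite (@ge0_negligible_integral _ _ _ _ setT (~` D)) //; last 2 first.
- exact: measurableC.
- by rewrite /= /mfrestr /mrestr setICl measure0.
rewrite setTD setCK; apply: eq_measure_integral => A mA AD.
by rewrite /= /mfrestr /mrestr setIidl.
Qed.

Definition segment_measure (r : R) : {finite_measure set (measurableTypeR R) -> \bar R} :=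
  @mfrestr _ (measurableTypeR R) R `[(- r)%R, r]%classic mu
    (measurable_itv `[(- r)%R, r]) (segment_fin r).

Definition cube_measure n r (r0 : (0 <= r)%R) : {finite_measure set 'cV[R]_n -> \bar R} :=
  @mfrestr _ 'cV[R]_n R (@cube n r) (leb n) (measurable_cube r) (cube_fin n r0).

Lemma integral_segment_measure (r : R) (f : R -> \bar R) :
  measurable_fun setT f -> (forall x, 0 <= f x) ->
  \int[segment_measure r]_x f x = \int[mu]_(x in `[(- r)%R, r]) f x.
Proof. exact: (@ge0_integral_mfrestr _ (measurableTypeR R) mu). Qed.

Lemma integral_cube_measure n r (r0 : (0 <= r)%R) (f : 'cV[R]_n -> \bar R) :
  measurable_fun setT f -> (forall x, 0 <= f x) ->
  \int[cube_measure n r0]_x f x = \int[leb n]_(x in @cube n r) f x.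
Proof. exact: ge0_integral_mfrestr. Qed.

Lemma integral_cubeS n r (r0 : (0 <= r)%R) (g : 'cV[R]_n.+1 -> \bar R) :
  measurable_fun setT g -> (forall x, 0 <= g x) ->
  \int[leb n.+1]_(z in @cube n.+1 r) g z =
  \int[cube_measure n r0 \x segment_measure r]_z g (cons_cV z).
Proof.
move=> mg g0; rewrite integral_mkcond integral_cVS; last 2 first.
- by apply/(measurable_restrictT _ (measurable_cube r)); exact: measurable_funTS.
- by move=> z; exact: erestrict_ge0.
have mgc : measurable_fun setT (g \o @cons_cV R n).
  exact: measurableT_comp mg (@measurable_cons_cV R n).
rewrite (@fubini_tonelli1 _ _ 'cV[R]_n (measurableTypeR R) R
  (cube_measure n r0) (segment_measure r) (g \o @cons_cV R n)) //;
  last by move=> z; exact: g0.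
rewrite integral_cube_measure; last 2 first.
- apply: (@measurable_fun_fubini_tonelli_F _ _ 'cV[R]_n (measurableTypeR R) R
    (segment_measure r)) => //.
  by move=> z; exact: g0.
- by move=> x; apply: integral_ge0 => s _; exact: g0.
rewrite [RHS]integral_mkcond; apply: eq_integral => x _.
rewrite patchE; case: ifPn => [/set_mem xQ|/negP xQ].
  rewrite /fubini_F integral_segment_measure //; last 2 first.
  - exact: measurableT_comp mgc (measurable_pair1 x).
  - by move=> s; exact: g0.
  rewrite [RHS]integral_mkcond; apply: eq_integral => s _ /=.
  rewrite !patchE; congr (if _ then _ else _); apply: asbool_equiv_eq.
  split=> [h|h i]; first by have := h ord0; rewrite cons_cV0.
  by case: (unliftP ord0 i) => [k|] ->; rewrite ?cons_cV0 ?cons_cVS.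
rewrite integral0_eq // => s _; rewrite patchE; case: ifPn => // /set_mem h.
exfalso; apply: xQ; apply/mem_set => i.
by have := h (lift ord0 i); rewrite cons_cVS.
Qed.

(** Only what a one-dimensional argument along coordinate lines uses. The class is stable under
    freezing the first coordinate, as the induction on the dimension requires. *)
Definition coord_C1 n (f : 'cV[R]_n -> R) := [/\ measurable_fun setT f,
  forall i x, derivable f x (delta_mx i 0%R),
  forall i, measurable_fun setT (fun x => 'D_(delta_mx i 0%R) f x) &
  forall i x, continuous (fun s : R => 'D_(delta_mx i 0%R) f (x + s *: delta_mx i 0)%R)].

Lemma cons_cV_addl n (x v : 'cV[R]_n) (s h : R) :
  cons_cV (h *: v + x, s)%R = (h *: cons_cV (v, 0) + cons_cV (x, s))%R.
Proof.
apply/colP => i; rewrite [RHS]mxE [X in _ = (X + _)%R]mxE.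
by case: (unliftP ord0 i) => [k|] ->; rewrite ?cons_cV0 ?cons_cVS ?mxE // mulr0 add0r.
Qed.

Lemma cons_cV_addr n (x : 'cV[R]_n) (s h : R) :
  cons_cV (x, h + s)%R = (h *: delta_mx ord0 0 + cons_cV (x, s))%R.
Proof.
apply/colP => i; rewrite [RHS]mxE [X in _ = (X + _)%R]mxE [X in (_ * X)%R]mxE andbT.
case: (unliftP ord0 i) => [k|] ->; rewrite ?cons_cV0 ?cons_cVS ?mulr1 ?eqxx ?mulr1 //.
by rewrite eq_sym (negPf (neq_lift ord0 k)) mulr0 add0r.
Qed.

Lemma cons_cV_delta n (i : 'I_n) :
  cons_cV (delta_mx i 0%R : 'cV[R]_n, 0%R) = delta_mx (lift ord0 i) 0%R.
Proof.
apply/colP => j; rewrite [RHS]mxE andbT.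
case: (unliftP ord0 j) => [k|] ->; rewrite ?cons_cV0 ?cons_cVS.
  by rewrite mxE andbT (inj_eq lift_inj).
by rewrite (negPf (neq_lift ord0 i)).
Qed.

(** Being an identity of difference quotients, it transfers both the existence and the value of
    partial derivatives to slices. *)
Lemma slice_quotient n (f : 'cV[R]_n.+1 -> R) (x : 'cV[R]_n) (s : R) (i : 'I_n) :
  (fun h : R => h^-1 *: (((fun z => f (cons_cV (z, s))) \o shift x)
    (h *: delta_mx i 0) - f (cons_cV (x, s))))%R =
  (fun h : R => h^-1 *: ((f \o shift (cons_cV (x, s)))
    (h *: delta_mx (lift ord0 i) 0) - f (cons_cV (x, s))))%R.
Proof.
by apply/funext => h /=; rewrite cons_cV_addl cons_cV_delta.
Qed.

Lemma last_quotient n (f : 'cV[R]_n.+1 -> R) (x : 'cV[R]_n) (s : R) :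
  (fun h : R => h^-1 *: (((fun t => f (cons_cV (x, t))) \o shift s)
    (h *: 1) - f (cons_cV (x, s))))%R =
  (fun h : R => h^-1 *: ((f \o shift (cons_cV (x, s)))
    (h *: delta_mx ord0 0) - f (cons_cV (x, s))))%R.
Proof.
by apply/funext => h /=; rewrite cons_cV_addr [(_%:A)%R]mulr1.
Qed.

Lemma derive_slice n (f : 'cV[R]_n.+1 -> R) (x : 'cV[R]_n) (s : R) (i : 'I_n) :
  'D_(delta_mx i 0%R) (fun z => f (cons_cV (z, s))) x =
  'D_(delta_mx (lift ord0 i) 0%R) f (cons_cV (x, s)).
Proof. by rewrite /derive slice_quotient. Qed.

Lemma derive1_last n (f : 'cV[R]_n.+1 -> R) (x : 'cV[R]_n) :
  ((fun t => f (cons_cV (x, t)))^`())%classic =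
  (fun s => 'D_(delta_mx ord0 0%R) f (cons_cV (x, s))).
Proof. by apply/funext => s; rewrite derive1E /derive last_quotient. Qed.

Lemma coord_C1_slice n (f : 'cV[R]_n.+1 -> R) (s : R) :
  coord_C1 f -> coord_C1 (fun x => f (cons_cV (x, s))).
Proof.
move=> [mf df mD cD].
have ms : measurable_fun setT (fun x : 'cV[R]_n => cons_cV (x, s)).
  exact: measurableT_comp (@measurable_cons_cV R n) (measurable_pair2 s).
split.
- exact: measurableT_comp mf ms.
- by move=> i x; rewrite /derivable slice_quotient; exact: df.
- move=> i; under eq_fun do rewrite derive_slice.
  exact: measurableT_comp (mD (lift ord0 i)) ms.
- move=> i x.
  have -> : (fun t : R => 'D_(delta_mx i 0)
        (fun x => f (cons_cV (x, s))) (x + t *: delta_mx i 0))%R =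
      (fun t : R => 'D_(delta_mx (lift ord0 i) 0) f
        (cons_cV (x, s) + t *: delta_mx (lift ord0 i) 0))%R.
    apply/funext => t.
    by rewrite derive_slice (addrC x) cons_cV_addl cons_cV_delta addrC.
  exact: (cD (lift ord0 i) (cons_cV (x, s))).
Qed.

(** The double integral, twice the volume times the variance, spares the mean of [f]. In the
    induction [tensorized_variance] combines the induction hypothesis, applied to slices with the
    first coordinate fixed, with [sqr_increment_le] along that coordinate. *)
Lemma poincare_cube n (r : R) : (0 <= r)%R ->
  exists2 C : R, (0 <= C)%R & forall f : 'cV[R]_n -> R, coord_C1 f ->
  \int[leb n]_(x in @cube n r) \int[leb n]_(y in @cube n r) ((f x - f y) ^+ 2)%R%:E <=
  C%:E * \int[leb n]_(x in @cube n r) (\sum_i ('D_(delta_mx i 0) f x) ^+ 2)%R%:E.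
Proof.
move=> r0; elim: n => [|n [C C0 IH]].
  exists 0%R => // f _; rewrite mul0e integral0_eq // => x _.
  rewrite integral0_eq // => y _.
  by rewrite (_ : x = y) ?subrr ?expr0n //; apply/colP => -[].
pose M2 := fine (segment_measure r setT); pose M1 := fine (cube_measure n r0 setT).
(* The pointwise bound of [sqr_increment_le] is integrated over two variables, and each contributes
   the length [M2] of the segment. *)
pose C2 := (2 * r * M2 * M2)%R.
have M20 : (0 <= M2)%R by rewrite fine_ge0.
have M10 : (0 <= M1)%R by rewrite fine_ge0.
have C20 : (0 <= C2)%R by rewrite !mulr_ge0.
exists (2 * M2 * C + 2 * M1 * C2)%R; first by rewrite addr_ge0 // !mulr_ge0.
move=> f f1; have [mf df mD cD] := f1.
pose F z := f (cons_cV z).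
pose G1 (z : 'cV[R]_n * R) := (\sum_(i < n) ('D_(delta_mx (lift ord0 i) 0) f (cons_cV z)) ^+ 2)%R.
pose G2 (z : 'cV[R]_n * R) := ('D_(delta_mx ord0 0) f (cons_cV z) ^+ 2)%R.
have mF : measurable_fun setT F by exact: measurableT_comp mf (@measurable_cons_cV R n).
have mDc i : measurable_fun setT (fun z : 'cV[R]_n * R => 'D_(delta_mx i 0%R) f (cons_cV z)).
  exact: measurableT_comp (mD i) (@measurable_cons_cV R n).
have mG1 : measurable_fun setT G1.
  by apply: measurable_sum => i; apply: measurable_funX.
have mG2 : measurable_fun setT G2 by exact: measurable_funX.
have mff : measurable_fun setT (fun xy : 'cV[R]_n.+1 * 'cV[R]_n.+1 =>
    ((f xy.1 - f xy.2) ^+ 2)%R%:E).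
  apply/measurable_EFinP; apply: measurable_funX; apply: measurable_funB.
    exact: measurableT_comp mf measurable_fst.
  exact: measurableT_comp mf measurable_snd.
have mff1 x : measurable_fun setT (fun y => ((f x - f y) ^+ 2)%R%:E).
  by apply/measurable_EFinP; apply: measurable_funX; apply: measurable_funB.
have sq0 (u : R) : 0 <= (u ^+ 2)%R%:E by rewrite lee_fin sqr_ge0.
have innerE x : \int[leb n.+1]_(y in @cube n.+1 r) ((f x - f y) ^+ 2)%R%:E =
    \int[cube_measure n.+1 r0]_y ((f x - f y) ^+ 2)%R%:E.
  by rewrite integral_cube_measure.
have mJ : measurable_fun setT
    (fun x => \int[cube_measure n.+1 r0]_y ((f x - f y) ^+ 2)%R%:E).
  by apply: (@measurable_fun_fubini_tonelli_F _ _ _ _ _ (cube_measure n.+1 r0) _ mff).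
under eq_integral do rewrite innerE.
rewrite [leLHS](integral_cubeS r0) //; last by move=> x; apply: integral_ge0 => y _.
have innerE2 x : \int[cube_measure n.+1 r0]_y ((f x - f y) ^+ 2)%R%:E =
    \int[cube_measure n r0 \x segment_measure r]_w ((f x - F w) ^+ 2)%R%:E.
  by rewrite integral_cube_measure // (integral_cubeS r0).
under eq_integral do rewrite innerE2.
have mgrad : measurable_fun setT
    (fun x => (\sum_i ('D_(delta_mx i 0) f x) ^+ 2)%R%:E).
  by apply/measurable_EFinP; apply: measurable_sum => i; exact: measurable_funX.
have grad0 x : 0 <= (\sum_i ('D_(delta_mx i 0) f x) ^+ 2)%R%:E.
  by rewrite lee_fin sumr_ge0 // => i _; exact: sqr_ge0.
rewrite [X in _ <= _ * X](integral_cubeS r0) //.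
have G10 z : (0 <= G1 z)%R by rewrite sumr_ge0 // => i _; exact: sqr_ge0.
have G20 z : (0 <= G2 z)%R by exact: sqr_ge0.
have H1 (s : R) : \int[cube_measure n r0]_x \int[cube_measure n r0]_y
    ((F (x, s) - F (y, s)) ^+ 2)%R%:E <=
    C%:E * \int[cube_measure n r0]_x (G1 (x, s))%:E.
  have ms : measurable_fun setT (fun x : 'cV[R]_n => F (x, s)).
    exact: measurableT_comp mF (measurable_pair2 s).
  rewrite [X in _ <= _ * X]integral_cube_measure; last 2 first.
  - apply/measurable_EFinP; exact: measurableT_comp mG1 (measurable_pair2 s).
  - by move=> x; rewrite lee_fin.
  rewrite integral_cube_measure; last 2 first.
  - apply: (@measurable_fun_fubini_tonelli_F _ _ _ _ _ (cube_measure n r0)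
      (fun xy => ((F (xy.1, s) - F (xy.2, s)) ^+ 2)%R%:E)) => //.
    apply/measurable_EFinP; apply: measurable_funX; apply: measurable_funB.
      exact: measurableT_comp ms measurable_fst.
    exact: measurableT_comp ms measurable_snd.
  - by move=> x; apply: integral_ge0 => y _.
  have := IH _ (coord_C1_slice s f1).
  rewrite (_ : \int[leb n]_(x in @cube n r) (\sum_i _)%R%:E =
    \int[leb n]_(x in @cube n r) (G1 (x, s))%:E); last first.
    by apply: eq_integral => x _; under eq_bigr do rewrite derive_slice.
  apply: le_trans; rewrite le_eqVlt; apply/orP; left; apply/eqP.
  apply: eq_integral => x _; rewrite integral_cube_measure //.
  by apply/measurable_EFinP; apply: measurable_funX; apply: measurable_funB.
have H2 (y : 'cV[R]_n) : \int[segment_measure r]_t \int[segment_measure r]_s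
    ((F (y, s) - F (y, t)) ^+ 2)%R%:E <=
    C2%:E * \int[segment_measure r]_s (G2 (y, s))%:E.
  have my : measurable_fun setT (fun s : R => F (y, s)).
    exact: measurableT_comp mF (measurable_pair1 y).
  have mG2y : measurable_fun setT (fun s : R => (G2 (y, s))%:E).
    by apply/measurable_EFinP; exact: measurableT_comp mG2 (measurable_pair1 y).
  have G2y0 s : 0 <= (G2 (y, s))%:E by rewrite lee_fin.
  have myy : measurable_fun setT (fun st : R * R => ((F (y, st.2) - F (y, st.1)) ^+ 2)%R%:E).
    apply/measurable_EFinP; apply: measurable_funX; apply: measurable_funB.
      exact: measurableT_comp my measurable_snd.
    exact: measurableT_comp my measurable_fst.
  have m2E : segment_measure r setT = M2%:E by rewrite fineK // fin_num_measure.
  rewrite [X in _ <= _ * X]integral_segment_measure //.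
  set E := \int[mu]_(s in `[(- r)%R, r]) (G2 (y, s))%:E.
  have E0 : 0 <= E by apply: integral_ge0.
  have mK t : measurable_fun setT (fun s : R => ((F (y, s) - F (y, t)) ^+ 2)%R%:E).
    exact: measurableT_comp myy (measurable_pair1 t).
  have pt s t : s \in `[(- r)%R, r] -> t \in `[(- r)%R, r] ->
      ((F (y, s) - F (y, t)) ^+ 2)%R%:E <= (2 * r)%R%:E * E.
    move=> sr tr; have := @sqr_increment_le R (fun s => F (y, s)) r s t _ _ sr tr.
    rewrite derive1_last; apply.
      by move=> u; rewrite /derivable last_quotient; exact: df.
    have := cD ord0 (cons_cV (y, 0%R)).
    rewrite (_ : (fun s0 : R => 'D__ f (_ + _)%R) =
      (fun s0 => 'D_(delta_mx ord0 0%R) f (cons_cV (y, s0)))) //.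
    by apply/funext => u; rewrite addrC -cons_cV_addr addr0.
  rewrite integral_segment_measure //; last 2 first.
  - apply: (@measurable_fun_fubini_tonelli_F _ _ _ (measurableTypeR R) _
      (segment_measure r) _ myy) => //.
  - by move=> t; apply: integral_ge0.
  apply: (@le_trans _ _ (\int[mu]_(t in `[(- r)%R, r]) ((2 * r)%R%:E * E * M2%:E))).
    apply: ge0_le_integral => //.
    - by move=> t _; apply: integral_ge0.
    - apply: measurable_funTS.
      exact: (@measurable_fun_fubini_tonelli_F _ _ _ (measurableTypeR R) _
        (segment_measure r) _ myy).
    move=> t tr; rewrite integral_segment_measure // -m2E.
    rewrite -(integral_cst (segment_measure r) measurableT) integral_segment_measure //.
    apply: ge0_le_integral => //.
    - by apply: measurable_funTS; exact: mK.
    - by move=> s sr; exact: pt.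
    by move=> s; rewrite /cst mule_ge0 // lee_fin mulr_ge0.
  rewrite -integral_segment_measure //; last first.
    by move=> _; rewrite !mule_ge0 // lee_fin ?mulr_ge0.
  rewrite (_ : \int[_]__ _ = (2 * r)%R%:E * E * M2%:E * M2%:E); last first.
    by rewrite -m2E; exact: (integral_cst (segment_measure r) measurableT).
  by rewrite /C2 -muleA -EFinM muleAC -EFinM mulrA.
have := @tensorized_variance _ _ _ _ R (cube_measure n r0) (segment_measure r)
  F G1 G2 C C2 mF mG1 mG2 C0 C20 G10 G20 H1 H2.
move=> /le_trans; apply.
rewrite EFinD ge0_muleDl ?lee_fin ?mulr_ge0 //.
have mGc : measurable_fun setT (fun z : 'cV[R]_n * R =>
    (\sum_i ('D_(delta_mx i 0) f (cons_cV z)) ^+ 2)%R%:E).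
  exact: measurableT_comp mgrad (@measurable_cons_cV R n).
apply: leeD; rewrite lee_wpmul2l ?lee_fin ?mulr_ge0 //; apply: ge0_le_integral => //.
- by move=> z _; rewrite lee_fin.
- exact/measurable_EFinP.
- by move=> z _; rewrite lee_fin big_ord_recl lerDr sqr_ge0.
- by move=> z _; rewrite lee_fin.
- exact/measurable_EFinP.
- move=> z _; rewrite lee_fin big_ord_recl lerDl sumr_ge0 // => i _; exact: sqr_ge0.
Qed.

End cube_poincare.

(** * Poincare inequality for dissipative potentials *)

Section weighted_integral.
Variables (R : realType) (n : nat) (w : 'cV[R]_n -> R).
Hypothesis wdom : gauss_dom w.
Hypothesis w_ge0 : forall x, 0 <= w x.
Implicit Types (f g h : 'cV[R]_n -> R) (x v : 'cV[R]_n) (k : R).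
Local Notation leb := (@lebesgue_cV R n).

Definition wint (w : 'cV[R]_n -> R) g : R := \int[leb]_x (g x * w x).

Lemma wint_integrable g : quad_growth g ->
  leb.-integrable setT (EFin \o (fun x => g x * w x)).
Proof. by move=> gq; apply/gauss_dom_integrable/gauss_domM. Qed.

Lemma EFin_wint g : quad_growth g ->
  ((wint w g)%:E = \int[leb]_x (g x * w x)%:E)%E.
Proof.
by move=> gq; rewrite fineK //; apply: integrable_fin_num => //; exact: wint_integrable.
Qed.

Lemma eq_wint f g : (forall x, f x = g x) -> wint w f = wint w g.
Proof. by move=> fg; apply: eq_Rintegral => x _; rewrite fg. Qed.

Lemma wintD f g : quad_growth f -> quad_growth g ->
  wint w (fun x => f x + g x) = wint w f + wint w g.
Proof.
move=> fq gq; rewrite /wint -RintegralD //; try exact: wint_integrable.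
by apply: eq_Rintegral => x _; rewrite mulrDl.
Qed.

Lemma wintZ k f : quad_growth f -> wint w (fun x => k * f x) = k * wint w f.
Proof.
move=> fq; rewrite /wint -RintegralZl //; last exact: wint_integrable.
by apply: eq_Rintegral => x _; rewrite mulrA.
Qed.

Lemma quad_growth_cst k : quad_growth (fun _ : 'cV[R]_n => k).
Proof. by apply: (@quad_growth_bounded _ _ _ `|k|). Qed.

Lemma quad_growthZ k f : quad_growth f -> quad_growth (fun x => k * f x).
Proof. by move=> fq; apply: (@quad_growthMl _ _ (fun=> k) f `|k|). Qed.

Lemma quad_growthB f g : quad_growth f -> quad_growth g ->
  quad_growth (fun x => f x - g x).
Proof.
move=> fq gq; have := quad_growthD fq (quad_growthZ (-1) gq).
by under [X in quad_growth X -> _]eq_fun do rewrite mulN1r.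
Qed.

Lemma wintB f g : quad_growth f -> quad_growth g ->
  wint w (fun x => f x - g x) = wint w f - wint w g.
Proof.
move=> fq gq; rewrite -[- wint w g]mulN1r -wintZ // -wintD //; last exact: quad_growthZ.
by apply: eq_wint => x; rewrite mulN1r.
Qed.

Lemma ler_wint f g : quad_growth f -> quad_growth g ->
  (forall x, f x <= g x) -> wint w f <= wint w g.
Proof.
move=> fq gq fg; apply: le_Rintegral; rewrite //; try exact: wint_integrable.
by move=> x _; rewrite ler_wpM2r.
Qed.

Lemma wint_ge0 f : (forall x, 0 <= f x) -> 0 <= wint w f.
Proof. by move=> f0; apply: Rintegral_ge0 => x _; rewrite mulr_ge0. Qed.

Lemma quad_growth_sum (I : Type) (s : seq I) (F : I -> 'cV[R]_n -> R) :
  (forall i, quad_growth (F i)) -> quad_growth (fun x => \sum_(i <- s) F i x).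
Proof.
move=> Fq; elim: s => [|i s IH].
  by under eq_fun do rewrite big_nil; exact: quad_growth_cst.
by under eq_fun do rewrite big_cons; exact: quad_growthD.
Qed.

Lemma wint_sum (I : Type) (s : seq I) (F : I -> 'cV[R]_n -> R) :
  (forall i, quad_growth (F i)) ->
  wint w (fun x => \sum_(i <- s) F i x) = \sum_(i <- s) wint w (F i).
Proof.
move=> Fq; elim: s => [|i s IH].
  rewrite big_nil -[RHS](mul0r (wint w (fun=> 0))) -wintZ; last exact: quad_growth_cst.
  by apply: eq_wint => x; rewrite big_nil mul0r.
rewrite big_cons -IH -wintD //; last exact: quad_growth_sum.
by apply: eq_wint => x; rewrite big_cons.
Qed.

(** Huygens' identity for an unnormalized weight, by expanding both squares. It shows that the
    second moment about any [c] dominates the one about the mean. *)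
Lemma wint_variance f (C c : R) : measurable_fun setT f -> (forall x, `|f x| <= C) ->
  0 < wint w (fun=> 1) ->
  let m := wint w f / wint w (fun=> 1) in
  wint w (fun x => (f x - m) ^+ 2) = wint w (fun x => (f x - c) ^+ 2)
    - wint w (fun=> 1) * (m - c) ^+ 2.
Proof.
move=> mf fC Z0 m; set Z := wint w (fun=> 1).
have fq : quad_growth f by exact: quad_growth_bounded mf fC.
have f2q : quad_growth (fun x => f x ^+ 2).
  apply: (@quad_growth_bounded _ _ _ (C ^+ 2)); first exact: measurable_funX.
  by move=> x; rewrite normrX ler_sqr ?nnegrE // (le_trans _ (fC x)).
have E k : wint w (fun x => (f x - k) ^+ 2) =
    wint w (fun x => f x ^+ 2) - 2 * k * wint w f + k ^+ 2 * Z.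
  rewrite -(wintZ (2 * k)) // -(wintZ (k ^+ 2)); last exact: quad_growth_cst.
  rewrite -wintB //; last exact: quad_growthZ.
  rewrite -wintD //; [|apply: quad_growthB => //; exact: quad_growthZ|
    apply: quad_growthZ; exact: quad_growth_cst].
  by apply: eq_wint => x; ring.
rewrite !E; have -> : wint w f = m * Z by rewrite /m divfK ?lt0r_neq0.
by ring.
Qed.

End weighted_integral.

Section chain_rule.
Variables (R : realType) (n : nat).
Implicit Types (f : 'cV[R]_n -> R) (x v : 'cV[R]_n).

Lemma derive_comp1 f (g : R -> R) (x v : 'cV[R]_n) (g' : R) :
  differentiable f x -> is_derive (f x) 1 g g' ->
  'D_v (g \o f) x = g' * 'D_v f x.
Proof.
move=> df dg; have dg1 : differentiable g (f x).
  by apply/derivable1_diffP; exact: ex_derive.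
rewrite deriveE; last exact: differentiable_comp.
rewrite diff_comp //= deriv1E; last exact: ex_derive.
by rewrite derive1E derive_val -deriveE // [LHS]mulrC.
Qed.

Lemma differentiable_comp1 f (g : R -> R) (x : 'cV[R]_n) (g' : R) :
  differentiable f x -> is_derive (f x) 1 g g' -> differentiable (g \o f) x.
Proof.
move=> df dg; apply: differentiable_comp => //.
by apply/derivable1_diffP; exact: ex_derive.
Qed.

End chain_rule.

Section lyapunov.
Variables (R : realType) (n : nat).
Implicit Types (f g h W : 'cV[R]_n -> R) (x v : 'cV[R]_n).
Local Notation leb := (@lebesgue_cV R n).

(** Meant for coordinates and for components of Lipschitz gradients: products of two such functions
    are [quad_growth]. *)
Definition lin_growth f := measurable_fun setT f /\
  exists2 C : R, 0 <= C & forall x, `|f x| <= C * (1 + enorm x).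

Lemma lin_growth_bounded f (C : R) : measurable_fun setT f ->
  (forall x, `|f x| <= C) -> lin_growth f.
Proof.
move=> mf fC; have C0 : 0 <= C by exact: le_trans (fC 0).
split=> //; exists C => // x; apply: le_trans (fC x) _.
by rewrite ler_peMr // lerDl enorm_ge0.
Qed.

Lemma lin_growthM f g : lin_growth f -> lin_growth g ->
  quad_growth (fun x => f x * g x).
Proof.
move=> [mf [C C0 fC]] [mg [D D0 gD]]; split; first exact: measurable_funM.
exists (C * D * 2) => x; rewrite normrM.
apply: le_trans (ler_pM _ _ (fC x) (gD x)) _ => //.
have := sqr_ge0 (enorm x - 1); have : 0 <= C * D by exact: mulr_ge0.
set c := C * D; set u := enorm x => c0 u1.
rewrite (_ : C * (1 + u) * (D * (1 + u)) = c * (1 + u) ^+ 2); last by rewrite /c; ring.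
rewrite -mulrA ler_wpM2l //; lra.
Qed.

Lemma continuous_coord i : continuous (fun x : 'cV[R]_n => x i 0).
Proof. exact: coord_continuous. Qed.

Lemma lin_growth_coord i : lin_growth (fun x => x i 0).
Proof.
split; first by apply: continuous_measurable_cV; exact: continuous_coord.
exists 1 => // x; rewrite mul1r; apply: le_trans (ler_coord_enorm x i) _.
by rewrite lerDr.
Qed.

(** The Lipschitz bound is Euclidean and the topology is that of the sup norm; continuity of [enorm]
    links them. *)
Lemma lipschitz_coord_continuous (F : 'cV[R]_n -> 'cV[R]_n) (L : R) i :
  lipschitz_with F L -> continuous (fun x => F x i 0).
Proof.
move=> [L0 FL]; suff cx (x : 'cV[R]_n) : {for x, continuous (fun x => F x i 0)} by [].
apply: (proj2 (@cvgrPdist_le R R _ (nbhs x) (nbhs_filter x) (fun z => F z i 0) (F x i 0)))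
  => e e0.
(* [L] may be 0, hence the denominator [L + 1]. *)
have e1 : 0 < e / (L + 1) by rewrite divr_gt0 // ltr_wpDl.
have ce : {for x, continuous (fun z : 'cV[R]_n => enorm (x - z))}.
  apply: (@continuous_comp _ _ _ (fun z : 'cV[R]_n => x - z) (@enorm R n)).
    apply: differentiable_continuous.
    by apply: (@differentiableB _ _ _ (cst x) id); [exact: differentiable_cst|].
  exact: continuous_enorm.
have {}ce : (fun z : 'cV[R]_n => enorm (x - z)) @ x --> (0 : R).
  by rewrite -(@enorm0 R n) -(subrr x).
have := proj1 (@cvgrPdist_le R R _ (nbhs x) (nbhs_filter x) _ _) ce _ e1.
apply: (@filterS _ _ (nbhs_filter x)) => z; rewrite sub0r normrN (ger0_norm (enorm_ge0 _)) => ze.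
have -> : F x i 0 - F z i 0 = (F x - F z) i 0 by rewrite !mxE.
apply: le_trans (ler_coord_enorm _ i) _; apply: le_trans (FL x z) _.
apply: (@le_trans _ _ ((L + 1) * enorm (x - z))).
  by rewrite ler_wpM2r ?enorm_ge0 // lerDl.
by rewrite mulrC -ler_pdivlMr // ltr_wpDl.
Qed.

Lemma lipschitz_lin_growth (F : 'cV[R]_n -> 'cV[R]_n) (L : R) i :
  lipschitz_with F L -> lin_growth (fun x => F x i 0).
Proof.
move=> FL; split.
  apply: continuous_measurable_cV; exact: (lipschitz_coord_continuous FL).
have [L0 FLe] := FL; exists (L + enorm (F 0)) => [|x].
  by rewrite addr_ge0 ?enorm_ge0.
apply: le_trans (ler_coord_enorm _ i) _.
rewrite -(subrK (F 0) (F x)); apply: le_trans (ler_enormD _ _) _.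
have := FLe x 0; rewrite subr0 => h.
have := enorm_ge0 x; have := enorm_ge0 (F 0); nra.
Qed.

(* [M] bounds the potential on balls; inequalities whose constants depend only on
   [a], [b] and [M] are uniform along a path of potentials. The Lipschitz constant
   only serves to justify integrations by parts and is not quantified. *)
Record potential_class (a b : R) (M : R -> R) (W : 'cV[R]_n -> R) : Prop := {
  pc_diff : forall x, differentiable W x ;
  pc_lip : exists L, lipschitz_with (grad W) L ;
  pc_diss : forall x, a * enorm x ^+ 2 - b <= dotp x (grad W x) ;
  pc_dom : gauss_dom (fun x => expR (- W x)) ;
  pc_bound : forall rho x, enorm x ^+ 2 <= rho -> `|W x| <= M rho }.

(** Contains the test functions and, unlike them, is stable under subtracting constants and contains
    the constants. Boundedness of [f] and its gradient makes all integrands of the Lyapunov argument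
    [quad_growth]. *)
Record bounded_C1 f : Prop := {
  bC1_diff : forall x, differentiable f x ;
  bC1_cont : forall i, continuous (fun x => 'D_(delta_mx i 0) f x) ;
  bC1_bound : exists C, forall x, `|f x| <= C ;
  bC1_grad : exists C, forall x, enorm (grad f x) <= C }.

Lemma is_derive_coord (i : 'I_n) x v : is_derive x v (fun z => z i 0) (v i 0).
Proof.
have h : (fun h : R => h^-1 *: (((fun z : 'cV[R]_n => z i 0) \o shift x) (h *: v) - x i 0))
    @ 0^' --> v i 0.
  apply: cvg_near_cst; near=> t; rewrite /= !mxE addrK.
  rewrite /GRing.scale /= mulKf //; near: t; exact: nbhs_dnbhs_neq.
by apply: DeriveDef; [apply/cvg_ex; exists (v i 0)|exact: cvg_lim].
Unshelve. all: by end_near. Qed.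

Lemma bC1_continuous f : bounded_C1 f -> continuous f.
Proof. by move=> fb x; apply: differentiable_continuous; exact: bC1_diff. Qed.

Lemma bC1_measurable f : bounded_C1 f -> measurable_fun setT f.
Proof. move=> fb; apply: continuous_measurable_cV; exact: bC1_continuous. Qed.

Lemma bC1_subcst f (c : R) : bounded_C1 f -> bounded_C1 (fun x => f x - c).
Proof.
move=> [df cf [C fC] [D gD]].
have DE v x : 'D_v (fun x => f x - c) x = 'D_v f x.
  rewrite (@deriveB _ _ _ f (cst c)); [|exact: diff_derivable|exact: derivable_cst].
  by rewrite derive_cst subr0.
split.
- by move=> x; apply: (@differentiableB _ _ _ f (cst c)) => //; exact: differentiable_cst.
- by move=> i; under eq_fun do rewrite DE; exact: cf.
- by exists (C + `|c|) => x; apply: le_trans (ler_normB _ _) _; rewrite lerD2r.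
- exists D => x; rewrite (_ : grad _ x = grad f x) //.
  by apply/colP => i; rewrite !mxE DE.
Qed.

Lemma grad_subcst f (c : R) x : differentiable f x ->
  grad (fun x => f x - c) x = grad f x.
Proof.
move=> df; apply/colP => i; rewrite !mxE.
rewrite (@deriveB _ _ _ f (cst c)); [|exact: diff_derivable|exact: derivable_cst].
by rewrite derive_cst subr0.
Qed.

Lemma bC1_quad f : bounded_C1 f -> quad_growth (fun x => f x ^+ 2).
Proof.
move=> fb; have mf := bC1_measurable fb; case: (bC1_bound fb) => C fC.
have fl := lin_growth_bounded mf fC; exact: (lin_growthM fl fl).
Qed.

Lemma measurable_bC1_grad f i : bounded_C1 f -> measurable_fun setT (fun x => grad f x i 0).
Proof.
move=> fb; have -> : (fun x => grad f x i 0) = (fun x => 'D_(delta_mx i 0) f x).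
  by apply/funext => x; rewrite mxE.
apply: continuous_measurable_cV; exact: bC1_cont.
Qed.

Lemma measurable_sqr_grad f : bounded_C1 f ->
  measurable_fun setT (fun x => enorm (grad f x) ^+ 2).
Proof.
move=> fb; under eq_fun do rewrite sqr_enormE.
by apply: measurable_sum => i; apply: measurable_funX; exact: measurable_bC1_grad.
Qed.

Lemma bC1_grad_quad f : bounded_C1 f -> quad_growth (fun x => enorm (grad f x) ^+ 2).
Proof.
move=> fb; case: (bC1_grad fb) => C gC.
apply: (@quad_growth_bounded _ _ _ (C ^+ 2)); first exact: measurable_sqr_grad.
move=> x; rewrite ger0_norm ?sqr_ge0 // ler_sqr ?nnegrE ?enorm_ge0 //.
exact: le_trans (enorm_ge0 _) (gC 0).
Qed.

Section integration_by_parts.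
Variables (a b : R) (M : R -> R) (W : 'cV[R]_n -> R).
Hypothesis WP : potential_class a b M W.
Local Notation w := (fun x => expR (- W x)).

Lemma derive_weight v x : 'D_v w x = - 'D_v W x * w x.
Proof.
have dW : differentiable (fun x => - W x) x by apply/differentiableN/(pc_diff WP).
rewrite (derive_comp1 (g := expR) (g' := expR (- W x)) v dW) mulrC.
by rewrite deriveN //; apply: diff_derivable; exact: (pc_diff WP).
Qed.

Lemma differentiable_weight x : differentiable w x.
Proof.
apply: (differentiable_comp1 (f := fun x => - W x) (g := expR) (g' := expR (- W x))).
by apply/differentiableN/(pc_diff WP).
Qed.

(** The integrand times the weight is the [i]-th partial derivative of [h x ^+ 2 * x i 0 * w x],
    which is Gaussian-dominated together with that derivative. *)
Lemma integration_by_parts_coord h i : bounded_C1 h ->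
  wint w (fun x => 2 * h x * (x i 0 * grad h x i 0) + h x ^+ 2
    - h x ^+ 2 * (x i 0 * grad W x i 0)) = 0.
Proof.
move=> hb; have [L WL] := pc_lip WP; case: (bC1_bound hb) => C hC.
case: (bC1_grad hb) => D hD; have mh := bC1_measurable hb.
pose phi x := h x ^+ 2 * x i 0 * w x.
pose p x := 2 * h x * (x i 0 * grad h x i 0) + h x ^+ 2
  - h x ^+ 2 * (x i 0 * grad W x i 0).
have C0 : 0 <= C by exact: le_trans (hC 0).
have h2C x : `|h x ^+ 2| <= C ^+ 2 by rewrite normrX ler_sqr ?nnegrE.
have mh2 : measurable_fun setT (fun x => h x ^+ 2) by exact: measurable_funX.
have pq : quad_growth p.
  apply: quad_growthB; last first.
    apply: quad_growthMl mh2 h2C _; apply: lin_growthM; first exact: lin_growth_coord.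
    exact: lipschitz_lin_growth WL.
  apply: quad_growthD; last exact: bC1_quad.
  apply: (@quad_growthMl _ _ _ _ (2 * C)); first exact: measurable_funM.
    by move=> x; rewrite normrM ger0_norm // ler_pM2l.
  apply: lin_growthM; first exact: lin_growth_coord.
  apply: (@lin_growth_bounded _ D) => [|x]; first exact: measurable_bC1_grad.
  exact: le_trans (ler_coord_enorm _ _) (hD x).
have pE x : dotp (grad phi x) (delta_mx i 0) = p x * w x.
  rewrite dotp_delta mxE.
  have dh : is_derive x (delta_mx i 0) h (grad h x i 0).
    by rewrite mxE; apply/derivableP/diff_derivable/(bC1_diff hb).
  have dw : is_derive x (delta_mx i 0) w (- grad W x i 0 * w x).
    rewrite mxE -derive_weight; apply/derivableP/diff_derivable.
    exact: differentiable_weight.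
  have dx : is_derive x (delta_mx i 0) (fun z : 'cV[R]_n => z i 0) 1.
    have := is_derive_coord i x (delta_mx i 0); by rewrite mxE !eqxx.
  have -> : phi = (h * h) * (fun z : 'cV[R]_n => z i 0) * w.
    by apply/funext => z; rewrite /phi expr2.
  rewrite (@derive_val _ _ _ _ _ _ _ (is_deriveM (is_deriveM (is_deriveM dh dh) dx) dw)).
  rewrite /p /= /GRing.scale /=; rewrite !fctE; ring.
have dphi x : differentiable phi x.
  apply: (@differentiableM _ _ (fun x => h x ^+ 2 * x i 0) w).
    apply: (@differentiableM _ _ (fun x => h x ^+ 2) (fun x => x i 0)).
      by apply: (@differentiableM _ _ h h); exact: (bC1_diff hb).
    exact: differentiable_coord.
  exact: differentiable_weight.
have pwd : gauss_dom (fun x => p x * w x) by exact: gauss_domM pq (pc_dom WP).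
have [mpw [K [k [k0 pwK]]]] := pwd.
rewrite -(@integral_dotp_grad _ _ phi (delta_mx i 0) K k) //.
- by apply: eq_Rintegral => x _; rewrite pE.
- by under eq_fun do rewrite pE.
- apply: gauss_domM (pc_dom WP); apply: lin_growthM; last exact: lin_growth_coord.
  exact: lin_growth_bounded mh2 h2C.
- by move=> x; rewrite pE.
Qed.

End integration_by_parts.

End lyapunov.

Section weighted_poincare.
Variables (R : realType) (n : nat).
Implicit Types (f g h W : 'cV[R]_n -> R) (x v : 'cV[R]_n).
Local Notation leb := (@lebesgue_cV R n).
Local Notation wt W := (fun x => expR (- W x)).

Lemma quad_growth_sqr_enorm : quad_growth (fun x : 'cV[R]_n => enorm x ^+ 2).
Proof.
split; first by apply: measurable_funX; exact: measurable_enorm.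
by exists 1 => x; rewrite mul1r ger0_norm ?sqr_ge0 // lerDr.
Qed.

Lemma bC1_quad_enorm h : bounded_C1 h -> quad_growth (fun x => h x ^+ 2 * enorm x ^+ 2).
Proof.
move=> hb; have mh := bC1_measurable hb; have [C hC] := bC1_bound hb.
apply: (@quad_growthMl _ _ _ _ (C ^+ 2)).
- exact: measurable_funX.
- move=> x; rewrite normrX ler_sqr ?nnegrE //; exact: le_trans (hC x).
- exact: quad_growth_sqr_enorm.
Qed.

(** Summed over the coordinates, the integration by parts says that the divergence of h^2 x w
    integrates to 0; the Lyapunov function behind it is |x|^2 / 2. Dissipativity yields [- a] times
    h^2 |x|^2, and Young's inequality spends half of it on the cross term with [grad h]. *)
Lemma lyapunov_inequality (a b : R) (M : R -> R) W h : 0 < a ->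
  potential_class a b M W -> bounded_C1 h ->
  a / 2 * wint (wt W) (fun x => h x ^+ 2 * enorm x ^+ 2) <=
  (n%:R + b) * wint (wt W) (fun x => h x ^+ 2) +
  2 / a * wint (wt W) (fun x => enorm (grad h x) ^+ 2).
Proof.
move=> a0 WP hb; have wdom := pc_dom WP.
pose phi i x := 2 * h x * (x i 0 * grad h x i 0) + h x ^+ 2
    - h x ^+ 2 * (x i 0 * grad W x i 0).
have [C hC] := bC1_bound hb; have [D hD] := bC1_grad hb; have mh := bC1_measurable hb.
have [L WL] := pc_lip WP.
have C0 : 0 <= C by exact: le_trans (hC 0).
have phiq i : quad_growth (phi i).
  apply: quad_growthB; last first.
    apply: (@quad_growthMl _ _ _ _ (C ^+ 2)); first exact: measurable_funX.
      by move=> x; rewrite normrX ler_sqr ?nnegrE.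
    apply: lin_growthM; first exact: lin_growth_coord.
    exact: lipschitz_lin_growth WL.
  apply: quad_growthD; last exact: bC1_quad.
  apply: (@quad_growthMl _ _ _ _ (2 * C)); first exact: measurable_funM.
    by move=> x; rewrite normrM ger0_norm // ler_pM2l.
  apply: lin_growthM; first exact: lin_growth_coord.
  apply: (@lin_growth_bounded _ _ _ D) => [|x]; first exact: measurable_bC1_grad.
  exact: le_trans (ler_coord_enorm _ _) (hD x).
have h2q := bC1_quad hb; have gq := bC1_grad_quad hb; have hxq := bC1_quad_enorm hb.
have sum0 : wint (wt W) (fun x => \sum_i phi i x) = 0.
  rewrite (wint_sum wdom) // big1 // => i _; exact: (integration_by_parts_coord WP).
have phiE x : \sum_i phi i x =
    2 * h x * dotp x (grad h x) + n%:R * h x ^+ 2 - h x ^+ 2 * dotp x (grad W x).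
  rewrite /phi big_split /= big_split /= sumrN !dotpE !mulr_sumr.
  by rewrite sumr_const card_ord -[h x ^+ 2 *+ n]mulr_natl.
have le_phi x : \sum_i phi i x <=
    (n%:R + b) * h x ^+ 2 + 2 / a * enorm (grad h x) ^+ 2 - a / 2 * (h x ^+ 2 * enorm x ^+ 2).
  rewrite phiE.
  have h1 : h x ^+ 2 * (a * enorm x ^+ 2 - b) <= h x ^+ 2 * dotp x (grad W x).
    by rewrite ler_wpM2l ?sqr_ge0 //; exact: (pc_diss WP).
  have h2 : 2 * h x * dotp x (grad h x) <=
      2 / a * enorm (grad h x) ^+ 2 + a / 2 * (h x ^+ 2 * enorm x ^+ 2).
    apply: le_trans (_ : 2 * (`|h x| * (enorm x * enorm (grad h x))) <= _).
      rewrite -mulrA ler_pM2l //; apply: le_trans (ler_norm _) _.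
      by rewrite normrM ler_wpM2l // ler_norm_dotp.
    rewrite -[h x ^+ 2]real_normK ?num_real //.
    set p := `|h x| * enorm x; set q := enorm (grad h x).
    have -> : `|h x| ^+ 2 * enorm x ^+ 2 = p ^+ 2 by rewrite exprMn.
    rewrite [`|h x| * (_ * q)]mulrA -/p -subr_ge0.
    rewrite [leRHS](_ : _ = (2 * a)^-1 * (2 * q - a * p) ^+ 2); last first.
      by field; exact: lt0r_neq0.
    by rewrite mulr_ge0 ?sqr_ge0 // invr_ge0 mulr_ge0 // ltW.
  lra.
have rq : quad_growth (fun x => (n%:R + b) * h x ^+ 2 + 2 / a * enorm (grad h x) ^+ 2
    - a / 2 * (h x ^+ 2 * enorm x ^+ 2)).
  by apply: quad_growthB; [apply: quad_growthD|]; exact: quad_growthZ.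
have := ler_wint wdom (fun x => expR_ge0 (- W x)) (quad_growth_sum _ phiq) rq le_phi.
rewrite sum0 (wintB wdom) ?(wintD wdom) ?(wintZ wdom) ?subr_ge0 //;
  try exact: quad_growthZ; by apply: quad_growthD; exact: quad_growthZ.
Qed.

Lemma bC1_coord_C1 f : bounded_C1 f -> coord_C1 f.
Proof.
move=> fb; split.
- exact: bC1_measurable.
- by move=> i x; apply: diff_derivable; exact: bC1_diff.
- by move=> i; apply: continuous_measurable_cV; exact: bC1_cont.
- move=> i x; suff cx (s : R) : {for s, continuous (fun s : R =>
      'D_(delta_mx i 0) f (x + s *: delta_mx i 0))} by [].
  apply: (@continuous_comp _ _ _ (fun s : R => x + s *: (delta_mx i 0 : 'cV[R]_n))
    (fun z => 'D_(delta_mx i 0) f z)); last exact: bC1_cont.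
  apply: differentiable_continuous.
  apply: (@differentiableD _ _ _ (cst x) (fun s : R => s *: (delta_mx i 0 : 'cV[R]_n))).
    exact: differentiable_cst.
  exact: ex_diff.
Qed.

Lemma cube_sqr_enorm r x : cube r x -> enorm x ^+ 2 <= n%:R * r ^+ 2.
Proof.
move=> xr; rewrite sqr_enormE -[n in n%:R]card_ord mulr_natl -sumr_const.
apply: ler_sum => i _; have := xr i; rewrite /= in_itv /= => /andP[? ?]; nra.
Qed.

Lemma notin_cube r x : 0 <= r -> ~ cube r x -> r ^+ 2 <= enorm x ^+ 2.
Proof.
move=> r0 /existsNP[i]; rewrite /= in_itv /= -ler_norml => /negP.
rewrite -ltNge => /ltW ri; rewrite ler_sqr ?nnegrE ?enorm_ge0 //.
exact: le_trans ri (ler_coord_enorm x i).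
Qed.

(** Together with [le_wint_restrict] it trades the weight for Lebesgue measure and back on a set
    where the two are comparable. The right side stays in the extended reals, so that no finiteness
    over [D] has to be shown. *)
Lemma wint_indic_le (w g : 'cV[R]_n -> R) (D : set 'cV[R]_n) (B : R) :
  gauss_dom w -> (forall x, 0 <= w x) -> measurable D ->
  measurable_fun setT g -> (forall x, 0 <= g x) ->
  quad_growth (fun x => \1_D x * g x) -> 0 <= B ->
  (forall x, D x -> w x <= B) ->
  ((wint w (fun x => \1_D x * g x))%:E <= B%:E * \int[leb]_(x in D) (g x)%:E)%E.
Proof.
move=> wdom w0 mD mg g0 gq B0 wB.
have mg' : measurable_fun D (fun x => (g x)%:E).
  by apply: measurable_funTS; exact/measurable_EFinP.
rewrite (EFin_wint wdom gq) -ge0_integralZl_EFin //; last first.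
  by move=> x _; rewrite lee_fin.
rewrite [leRHS]integral_mkcond; apply: ge0_le_integral => //.
- by move=> x _; rewrite lee_fin !mulr_ge0 // indicE.
- by have /measurable_int := wint_integrable wdom gq.
- by apply/(measurable_restrictT _ mD); exact: measurable_funeM.
move=> x _; rewrite patchE indicE; case: ifPn => xr; last by rewrite !mul0r.
by rewrite mul1r lee_fin mulrC ler_wpM2r //; apply: wB; exact: set_mem.
Qed.

Lemma le_wint_restrict (w g : 'cV[R]_n -> R) (D : set 'cV[R]_n) (B : R) :
  gauss_dom w -> (forall x, 0 <= w x) -> measurable D ->
  (forall x, 0 <= g x) -> quad_growth g -> 0 <= B ->
  (forall x, D x -> 1 <= B * w x) ->
  (\int[leb]_(x in D) (g x)%:E <= B%:E * (wint w g)%:E)%E.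
Proof.
move=> wdom w0 mD g0 gq B0 wB.
have mg : measurable_fun setT (fun x => (g x)%:E) by apply/measurable_EFinP; case: gq.
have mgw : measurable_fun setT (fun x => (g x * w x)%:E).
  by have /measurable_int := wint_integrable wdom gq.
have gw0 x : (0 <= (g x * w x)%:E)%E by rewrite lee_fin mulr_ge0.
rewrite (EFin_wint wdom gq) -ge0_integralZl_EFin //.
apply: (@le_trans _ _ (\int[leb]_(x in D) (B%:E * (g x * w x)%:E))%E).
  apply: ge0_le_integral => //.
  - by move=> x _; rewrite lee_fin.
  - exact: measurable_funTS.
  - by apply: measurable_funTS; exact: measurable_funeM.
  - move=> x Dx; rewrite -EFinM lee_fin mulrCA ler_peMr //; exact: wB.
apply: ge0_subset_integral => //; first exact: measurable_funeM.
by move=> x _; rewrite mule_ge0.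
Qed.

Lemma lee_double_add (I B K : R) (X : \bar R) :
  (I%:E <= B%:E * X)%E -> ((2 * I + K)%:E <= (2 * B)%:E * X + K%:E)%E.
Proof.
move=> IX; rewrite EFinD leeD2r // EFinM EFinM -muleA lee_wpmul2l //.
Qed.

(** The bound on [V] holds for each [y]; integrating it over [y] in [D] produces the double integral
    of the Poincare inequality of the cube, at the price of the volume [Q]. *)
Lemma average_bound (D : set 'cV[R]_n) f (V B K X Q : R) :
  measurable D -> measurable_fun setT f -> leb D = Q%:E -> 0 <= V -> 0 <= B -> 0 <= K ->
  (forall y, (V%:E <= B%:E * \int[leb]_(x in D) ((f y - f x) ^+ 2)%R%:E + K%:E)%E) ->
  (\int[leb]_(y in D) \int[leb]_(x in D) ((f y - f x) ^+ 2)%R%:E <= X%:E)%E ->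
  V * Q <= B * X + K * Q.
Proof.
move=> mD mf DQ V0 B0 K0 step intX.
(* With the indicator inside the integrand, measurability of the partial integral [J] follows from
   Tonelli on the whole product. *)
have mff : measurable_fun setT (fun xy : 'cV[R]_n * 'cV[R]_n =>
    (((f xy.1 - f xy.2) ^+ 2) * \1_D xy.2)%R%:E).
  apply/measurable_EFinP; apply: measurable_funM.
    apply: measurable_funX; apply: measurable_funB.
      exact: measurableT_comp mf measurable_fst.
    exact: measurableT_comp mf measurable_snd.
  by apply: measurableT_comp measurable_snd; exact: measurable_indic.
have ff0 (xy : 'cV[R]_n * 'cV[R]_n) :
    (0 <= (((f xy.1 - f xy.2) ^+ 2) * \1_D xy.2)%R%:E)%E.
  by rewrite lee_fin mulr_ge0 ?sqr_ge0 // indicE.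
pose J y := (\int[leb]_(x in D) ((f y - f x) ^+ 2)%R%:E)%E.
have mJ : measurable_fun setT J.
  have := @measurable_fun_fubini_tonelli_F _ _ _ _ _ leb _ mff ff0.
  congr (measurable_fun _ _); apply/funext => y; rewrite /J [RHS]integral_mkcond.
  apply: eq_integral => x _; rewrite patchE indicE /=.
  by case: ifPn => _; rewrite ?mulr1 ?mulr0.
have J0 y : (0 <= J y)%E by apply: integral_ge0 => x _; rewrite lee_fin sqr_ge0.
rewrite -lee_fin EFinD !EFinM -DQ -!(integral_cst leb mD).
apply: (@le_trans _ _ (\int[leb]_(y in D) (B%:E * J y + K%:E))%E).
  apply: ge0_le_integral => //.
  - by apply: measurable_funTS; apply: emeasurable_funD => //; exact: measurable_funeM.
  - by move=> y _; exact: step.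
rewrite ge0_integralD //; last 2 first.
- by move=> y _; rewrite mule_ge0.
- by apply: measurable_funTS; exact: measurable_funeM.
rewrite leeD2r // ge0_integralZl_EFin //; last exact: measurable_funTS.
by apply: lee_wpmul2l.
Qed.

(** Here [I] is the mass inside the cube and [r2^-1 * J] bounds the mass outside. The Lyapunov
    inequality bounds the latter by [2 * c / (a * r2) * H] plus energy; the choice of [r2] makes
    that coefficient at most 1/2, so the term moves to the left. *)
Lemma absorb_lyapunov (a c r2 H I J E : R) : 0 < a -> 0 < r2 -> a * r2 = 4 * c + a ->
  0 <= H -> a / 2 * J <= c * H + 2 / a * E -> H <= I + r2^-1 * J ->
  H <= 2 * I + 8 / (a ^+ 2 * r2) * E.
Proof.
move=> a0 r20 r2a H0 ly HI.
have J1 : r2^-1 * J <= H / 2 + 4 / (a ^+ 2 * r2) * E.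
  have -> : r2^-1 * J = (2 / (a * r2)) * (a / 2 * J) by field; rewrite !lt0r_neq0.
  have ar0 : 0 <= 2 / (a * r2) by rewrite divr_ge0 // mulr_ge0 // ltW.
  apply: le_trans (ler_wpM2l ar0 ly) _; rewrite mulrDr; apply: lerD.
    rewrite mulrA mulrC; apply: ler_wpM2l => //.
    rewrite mulrAC ler_pdivrMr ?mulr_gt0 //; lra.
  by rewrite le_eqVlt; apply/orP; left; apply/eqP; field; rewrite !lt0r_neq0.
have -> : 8 / (a ^+ 2 * r2) * E = 2 * (4 / (a ^+ 2 * r2) * E).
  by field; rewrite !lt0r_neq0.
lra.
Qed.

(* The Lyapunov inequality confines a fixed fraction of the mass of
   [(f - f y) ^+ 2] to a cube, where the Poincare inequality of the cube applies;
   averaging over [y] in the cube avoids choosing a constant to subtract. *)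
Lemma weighted_poincare (a b : R) (M : R -> R) : 0 < a -> 0 <= b ->
  exists2 C : R, 0 <= C & forall W f, potential_class a b M W -> bounded_C1 f ->
  let m := wint (wt W) f / wint (wt W) (fun=> 1) in
  0 < wint (wt W) (fun=> 1) ->
  wint (wt W) (fun x => (f x - m) ^+ 2) <=
  C * wint (wt W) (fun x => enorm (grad f x) ^+ 2).
Proof.
move=> a0 b0.
have nb0 : 0 <= n%:R + b by rewrite addr_ge0.
have [r2 r2_gt0 r2a] : exists2 r2, 0 < r2 & a * r2 = 4 * (n%:R + b) + a.
  exists (4 * (n%:R + b) / a + 1); last by field; exact: lt0r_neq0.
  by rewrite ltr_wpDl // divr_ge0 ?mulr_ge0 // ltW.
have [r r_gt0 r2E] : exists2 r, 0 < r & r ^+ 2 = r2.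
  by exists (Num.sqrt r2); rewrite ?sqrtr_gt0 // sqr_sqrtr // ltW.
have r2V0 : 0 <= r2^-1 by rewrite invr_ge0 ltW.
have [CQ CQ0 PQ] := @poincare_cube R n r (ltW r_gt0).
(* Points of the cube have squared norm at most [n%:R * r ^+ 2], so [B] bounds both the weight and
   its inverse there. *)
pose B := expR (M (n%:R * r ^+ 2)); pose Q := (2 * r) ^+ n.
have Q0 : 0 < Q by rewrite exprn_gt0 // mulr_gt0.
have B0 : 0 < B by rewrite expR_gt0.
pose k := 8 / (a ^+ 2 * r2).
have k0 : 0 <= k by rewrite divr_ge0 // mulr_ge0 ?sqr_ge0 // ltW.
(* One factor [B] passes from the weight to Lebesgue measure and the other one back; 2 and [k] come
   from [absorb_lyapunov], and [1 / Q] from averaging over the cube. *)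
exists (2 * B ^+ 2 * CQ / Q + k).
  apply: addr_ge0 => //; apply: divr_ge0; last exact: ltW.
  by rewrite mulr_ge0 // mulr_ge0 // sqr_ge0.
move=> W f WP fb m Z0.
have wdom := pc_dom WP.
set E := wint (wt W) (fun x => enorm (grad f x) ^+ 2).
have gq := bC1_grad_quad fb.
have E0 : 0 <= E by apply: wint_ge0 => // x; exact: sqr_ge0.
have mf := bC1_measurable fb; have [C fC] := bC1_bound fb.
have mQ := @measurable_cube R n r.
set V := wint (wt W) (fun x => (f x - m) ^+ 2).
have wB x : cube r x -> expR (- W x) <= B.
  move=> /cube_sqr_enorm /(pc_bound WP); rewrite ler_norml ler_expR => /andP[h _].
  by rewrite lerNl.
have wBV x : cube r x -> 1 <= B * expR (- W x).
  move=> /cube_sqr_enorm /(pc_bound WP); rewrite ler_norml => /andP[_ h].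
  by rewrite /B -expRD -[leLHS]expR0 ler_expR subr_ge0.
have step y : (V%:E <= (2 * B)%:E *
    \int[leb]_(x in cube r) ((f y - f x) ^+ 2)%R%:E + (k * E)%:E)%E.
  have hb := bC1_subcst (f y) fb.
  have hq := bC1_quad hb; have hxq := bC1_quad_enorm hb.
  set H := wint (wt W) (fun x => (f x - f y) ^+ 2).
  (* The mean minimizes the second moment, so the value [f y] may replace it. *)
  have VH : V <= H.
    rewrite /V (wint_variance wdom (f y) mf fC Z0) gerBl.
    by rewrite mulr_ge0 ?sqr_ge0 // ltW.
  have m1 : measurable_fun setT (\1_(cube r) : 'cV[R]_n -> R) by exact: measurable_indic.
  have iq : quad_growth (fun x => \1_(cube r) x * (f x - f y) ^+ 2).
    apply: (@quad_growthMl _ _ _ _ 1) => // x.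
    by rewrite indicE ger0_norm ?ler0n // lern1; case: (_ \in _).
  have ly := lyapunov_inequality a0 WP hb.
  have gE : wint (wt W) (fun x => enorm (grad (fun x => f x - f y) x) ^+ 2) = E.
    by apply: eq_wint => x; rewrite grad_subcst //; exact: (bC1_diff fb).
  rewrite gE -/H in ly.
  pose I1 := wint (wt W) (fun x => \1_(cube r) x * (f x - f y) ^+ 2).
  have HI : H <= I1 + r2^-1 * wint (wt W) (fun x => (f x - f y) ^+ 2 * enorm x ^+ 2).
    have zq : quad_growth (fun x => r2^-1 * ((f x - f y) ^+ 2 * enorm x ^+ 2)).
      exact: quad_growthZ.
    have <- : wint (wt W) (fun x => \1_(cube r) x * (f x - f y) ^+ 2 +
        r2^-1 * ((f x - f y) ^+ 2 * enorm x ^+ 2)) =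
        I1 + r2^-1 * wint (wt W) (fun x => (f x - f y) ^+ 2 * enorm x ^+ 2).
      by rewrite (wintD wdom iq zq) (wintZ wdom _ hxq).
    apply: (ler_wint wdom (fun x => expR_ge0 (- W x)) hq (quad_growthD iq zq)).
    move=> x; set u := (f x - f y) ^+ 2; have u0 : 0 <= u by exact: sqr_ge0.
    have [xr|xr] := pselect (cube r x).
      have -> : \1_(cube r) x = 1 :> R by rewrite indicE mem_set.
      rewrite [1 * u]mul1r lerDl; apply: mulr_ge0; first exact: r2V0.
      by apply: mulr_ge0; [exact: u0|exact: sqr_ge0].
    have -> : \1_(cube r) x = 0 :> R by rewrite indicE memNset.
    rewrite [0 * u]mul0r add0r mulrCA; apply: ler_peMr; first exact: u0.
    rewrite mulrC (ler_pdivlMr _ _ r2_gt0) mul1r -r2E; apply: notin_cube xr; exact: ltW.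
  have H2 : H <= 2 * I1 + k * E.
    apply: absorb_lyapunov a0 r2_gt0 r2a _ ly HI.
    by apply: wint_ge0 => x; [exact: expR_ge0|exact: sqr_ge0].
  have EI : (I1%:E <= B%:E * \int[leb]_(x in cube r) ((f x - f y) ^+ 2)%R%:E)%E.
    apply: (wint_indic_le wdom _ mQ _ _ iq (ltW B0) wB).
    - by move=> x; exact: expR_ge0.
    - by apply: measurable_funX; exact: measurable_funB.
    - by move=> x; exact: sqr_ge0.
  apply: (@le_trans _ _ (2 * I1 + k * E)%:E).
    by rewrite lee_fin; exact: le_trans VH H2.
  apply: lee_double_add; apply: le_trans EI _; rewrite le_eqVlt; apply/orP; left.
  apply/eqP; congr (_ * _)%E; apply: eq_integral => x _.
  by rewrite -sqrrN opprB.
have int_le : (\int[leb]_(y in cube r) \int[leb]_(x in cube r) ((f y - f x) ^+ 2)%R%:E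
    <= (CQ * B * E)%:E)%E.
  apply: le_trans (PQ f (bC1_coord_C1 fb)) _; rewrite -mulrA EFinM.
  apply: lee_wpmul2l; first by rewrite lee_fin.
  have := le_wint_restrict wdom (fun x => expR_ge0 (- W x)) mQ
    (fun x => sqr_ge0 (enorm (grad f x))) gq (ltW B0) wBV.
  rewrite EFinM; apply: le_trans; rewrite le_eqVlt; apply/orP; left; apply/eqP.
  apply: eq_integral => x _; rewrite sqr_enormE; congr (_%:E).
  by apply: eq_bigr => i _; rewrite mxE.
have VQ : V * Q <= 2 * B * (CQ * B * E) + k * E * Q.
  apply: (@average_bound (cube r) f V (2 * B) (k * E) (CQ * B * E) Q) => //.
  - by rewrite lebesgue_cube // ltW.
  - by apply: wint_ge0 => x; [exact: expR_ge0|exact: sqr_ge0].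
  - by rewrite mulr_ge0 // ltW.
  - exact: mulr_ge0.
rewrite -ler_pdivlMr // in VQ.
apply: le_trans VQ _; rewrite le_eqVlt; apply/orP; left; apply/eqP.
by field; exact: lt0r_neq0.
Qed.

End weighted_poincare.

(** * Stability of the log-Sobolev inequality *)

Section tightening_function.
Variable R : realType.
Implicit Types u x : R.

(* Equal to [u * (u - 1) ^+ 2 / (1 + u ^+ 2)]: asymptotic to [u] at infinity, and of
   second order at [u = 1], so that [ramp f] has small mass when [f] is close to 1. *)
Definition ramp u : R := u - 2 + 2 / (1 + u ^+ 2).

Lemma ramp_den_gt0 u : 0 < 1 + u ^+ 2.
Proof. by rewrite ltr_pwDl // sqr_ge0. Qed.

Lemma rampE u : ramp u = u * (u - 1) ^+ 2 / (1 + u ^+ 2).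
Proof.
have := ramp_den_gt0 u; rewrite /ramp => /lt0r_neq0 h; field; exact: h.
Qed.

Lemma ramp_norm u : `|ramp u| <= (u - 1) ^+ 2 / 2.
Proof.
have h := ramp_den_gt0 u.
rewrite rampE normrM normfV (gtr0_norm h) normrM (ger0_norm (sqr_ge0 (u - 1))).
rewrite ler_pdivrMr // -[u ^+ 2]real_normK ?num_real //.
have := sqr_ge0 (u - 1); move: ((u - 1) ^+ 2) => s s0.
have := sqr_ge0 (`|u| - 1); move: `|u| => v v1.
have : 0 <= s * (v - 1) ^+ 2 by exact: mulr_ge0.
lra.
Qed.

Lemma ramp_sqr u : ramp u ^+ 2 <= 9 / 4 * (u - 1) ^+ 2.
Proof.
have h := ramp_den_gt0 u; rewrite rampE.
have -> : u * (u - 1) ^+ 2 / (1 + u ^+ 2) = (u * (u - 1) / (1 + u ^+ 2)) * (u - 1).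
  by field; exact: lt0r_neq0.
rewrite exprMn ler_wpM2r ?sqr_ge0 //.
have -> : 9 / 4 = (3 / 2) ^+ 2 :> R by field.
rewrite -real_normK ?num_real // ler_sqr ?nnegrE ?divr_ge0 //.
rewrite normrM normfV (gtr0_norm h) ler_pdivrMr // ler_norml.
have := sqr_ge0 (u - 1); have := sqr_ge0 (u + 1); have := sqr_ge0 u.
by move=> *; apply/andP; split; nra.
Qed.

Lemma ramp_ge u : 3 <= `|u| -> 4 / 25 * u ^+ 2 <= ramp u ^+ 2.
Proof.
move=> u3; have h := ramp_den_gt0 u; rewrite rampE.
have -> : u * (u - 1) ^+ 2 / (1 + u ^+ 2) = ((u - 1) ^+ 2 / (1 + u ^+ 2)) * u.
  by field; exact: lt0r_neq0.
rewrite exprMn; apply: ler_wpM2r; first exact: sqr_ge0.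
have -> : 4 / 25 = (2 / 5) ^+ 2 :> R by field.
have q0 : 0 <= (u - 1) ^+ 2 / (1 + u ^+ 2) by rewrite divr_ge0 ?sqr_ge0 // ltW.
have q1 : 0 <= 2 / 5 :> R by lra.
rewrite ler_sqr ?nnegrE // ler_pdivlMr //; have [u0|u0] := leP 0 u.
  by move: u3; rewrite ger0_norm // => u3; nra.
by move: u3; rewrite ltr0_norm // => u3; nra.
Qed.

(** From [ln (y^-1) <= y^-1 - 1] at [y = |x|]. A bound linear in [|x|] is enough, because it is used
    at [ramp u], itself of second order at [u = 1]. *)
Lemma sqr_mul_ln_ge x : - (2 * `|x|) <= x ^+ 2 * ln (x ^+ 2).
Proof.
have [->|x0] := eqVneq x 0; first by rewrite expr0n mul0r normr0 mulr0 oppr0.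
have nx0 : 0 < `|x| by rewrite normr_gt0.
have -> : x ^+ 2 = `|x| ^+ 2 by rewrite real_normK ?num_real.
set y := `|x| in nx0 *; rewrite lnXn // mulr2n.
have : ln (y^-1) <= y^-1 - 1.
  have := @le_ln1Dx R (y^-1 - 1); rewrite [1 + _]addrC subrK; apply.
  by rewrite ltrBrDr addNr invr_gt0.
rewrite lnV ?posrE // => h.
have h2 : y * (- ln y) <= 1 - y.
  by have := ler_wpM2l (ltW nx0) h; rewrite mulrBr mulr1 divff ?lt0r_neq0.
nra.
Qed.

Lemma ln_sqr_le u : u ^+ 2 * ln (u ^+ 2) - u ^+ 2 + 1 <= (u ^+ 2 - 1) ^+ 2.
Proof.
have [->|u0] := eqVneq u 0; first by rewrite expr0n /= mul0r; lra.
have u2 : 0 < u ^+ 2 by rewrite lt_def sqrf_eq0 u0 sqr_ge0.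
have h : ln (u ^+ 2) <= u ^+ 2 - 1.
  by have := @le_ln1Dx R (u ^+ 2 - 1); rewrite [1 + _]addrC subrK; apply; lra.
nra.
Qed.

(** The left side integrates to the entropy once the mean of [u ^+ 2] is 1. For [|u| < 3] it is at
    most [16 * (u - 1) ^+ 2], and the entropy term on the right is at least
    [- (25 / 4) * (u - 1) ^+ 2], whence 23. For [|u| >= 3] the function [ramp] is comparable to [u]:
    [25 / 4] compensates [ramp_ge], the logarithm loses at most 4 because [expR (- 4) <= 4 / 25],
    and the resulting multiple of [u ^+ 2] is bounded by the last term. *)
Lemma tightening_bound u :
  u ^+ 2 * ln (u ^+ 2) - u ^+ 2 + 1 <=
  25 / 4 * (ramp u ^+ 2 * ln (ramp u ^+ 2)) + 23 * (u - 1) ^+ 2.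
Proof.
have [u3|u3] := leP 3 `|u|; last first.
  have h1 := sqr_mul_ln_ge (ramp u); have h2 := ramp_norm u; have h3 := ln_sqr_le u.
  have h4 : (u ^+ 2 - 1) ^+ 2 <= 16 * (u - 1) ^+ 2.
    have -> : (u ^+ 2 - 1) ^+ 2 = (u + 1) ^+ 2 * (u - 1) ^+ 2 by ring.
    rewrite ler_wpM2r ?sqr_ge0 //; move: u3; rewrite ltr_norml => /andP[? ?]; nra.
  have := sqr_ge0 (u - 1); lra.
have h1 := ramp_ge u3.
have u9 : 9 <= u ^+ 2.
  by rewrite -[u ^+ 2]real_normK ?num_real //; nra.
have T1 : 1 <= ramp u ^+ 2 by lra.
have u20 : 0 < u ^+ 2 by lra.
have T0 : 0 < ramp u ^+ 2 by lra.
have lnT : ln (u ^+ 2) - 4 <= ln (ramp u ^+ 2).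
  have e4 : expR (- 4) <= 4 / 25 :> R.
    rewrite expRN (_ : 4 / 25 = (25 / 4)^-1); last by rewrite invf_div.
    rewrite lef_pV2 ?posrE ?expR_gt0 //.
    have -> : expR 4 = expR 1 ^+ 4 :> R by rewrite -expRM_natl mulr1.
    have : 2 <= expR 1 :> R by have := @expR_ge1Dx R 1; lra.
    move: (expR 1) => e e2; have : 4 <= e ^+ 2 by nra.
    rewrite (_ : e ^+ 4 = (e ^+ 2) ^+ 2); last by rewrite -exprM.
    move: (e ^+ 2) => z ?; nra.
  have : ln (expR (- 4) * u ^+ 2) <= ln (ramp u ^+ 2).
    rewrite ler_ln; [|by rewrite posrE; apply: mulr_gt0 => //; exact: expR_gt0|by rewrite posrE].
    apply: le_trans h1; rewrite ler_wpM2r //; exact: sqr_ge0.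
  rewrite lnM; [|by rewrite posrE expR_gt0|by rewrite posrE].
  by rewrite expRK; lra.
have lnT0 : 0 <= ln (ramp u ^+ 2) by exact: ln_ge0.
have u2 : u ^+ 2 <= 9 / 4 * (u - 1) ^+ 2.
  have [u0|u0] := leP 0 u.
    by move: u3; rewrite ger0_norm // => u3; nra.
  by move: u3; rewrite ltr0_norm // => u3; nra.
have h2 : 4 / 25 * (u ^+ 2 * (ln (u ^+ 2) - 4)) <= ramp u ^+ 2 * ln (ramp u ^+ 2).
  rewrite mulrA; apply: le_trans (_ : (4 / 25 * u ^+ 2) * ln (ramp u ^+ 2) <= _).
    by rewrite ler_wpM2l // mulr_ge0 ?sqr_ge0.
  by rewrite ler_wpM2r.
set t := ramp u ^+ 2 * _ in h2 *; set l := u ^+ 2 * ln (u ^+ 2).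
have h3 : u ^+ 2 * (ln (u ^+ 2) - 4) = l - 4 * u ^+ 2 by rewrite /l; ring.
rewrite h3 in h2; have := sqr_ge0 (u - 1); lra.
Qed.

End tightening_function.

(** * Smooth functions and test functions *)

Section smooth_functions.
Variables (R : realType) (n : nat).
Implicit Types (f g h : 'cV[R]_n -> R) (x v : 'cV[R]_n).

Lemma Cn_continuous k f : Cn k f -> continuous f.
Proof.
by case: k => [|k] //= [df _] x; exact: differentiable_continuous.
Qed.

Lemma CnW k f : Cn k.+1 f -> Cn k f.
Proof.
elim: k f => [|k IH] f [df Df]; first by move=> x; exact: differentiable_continuous.
by split=> // i; apply: IH; exact: Df.
Qed.

Lemma eq_Cn k f g : (forall x, f x = g x) -> Cn k g -> Cn k f.
Proof. by move=> fg; have -> : f = g by exact/funext. Qed.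

Lemma Cn_cst k (c : R) : Cn k (fun _ : 'cV[R]_n => c).
Proof.
elim: k c => [|k IH] c; first exact: cst_continuous.
split=> [x|i]; first exact: differentiable_cst.
apply: (@eq_Cn _ _ (fun=> 0)) => [x|]; last exact: IH.
exact: derive_cst.
Qed.

Lemma CnD k f g : Cn k f -> Cn k g -> Cn k (fun x => f x + g x).
Proof.
elim: k f g => [|k IH] f g.
  by move=> cf cg x; exact: (continuousD (cf x) (cg x)).
move=> [df Df] [dg Dg]; split=> [x|i]; first by apply: (@differentiableD _ _ _ f g).
apply: (@eq_Cn _ _ (fun x => 'D_(delta_mx i 0) f x + 'D_(delta_mx i 0) g x)) => [x|].
  by apply: deriveD; exact: diff_derivable.
by apply: IH; [exact: Df|exact: Dg].
Qed.

Lemma CnM k f g : Cn k f -> Cn k g -> Cn k (fun x => f x * g x).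
Proof.
elim: k f g => [|k IH] f g.
  by move=> cf cg x; exact: (continuousM (cf x) (cg x)).
move=> fk gk; have [df Df] := fk; have [dg Dg] := gk.
split=> [x|i]; first by apply: (@differentiableM _ _ f g).
apply: (@eq_Cn _ _
    (fun x => f x * 'D_(delta_mx i 0) g x + g x * 'D_(delta_mx i 0) f x)) => [x|].
  by apply: (@deriveM _ _ f g); exact: diff_derivable.
apply: CnD; apply: IH; [exact: CnW|exact: Dg|exact: CnW|exact: Df].
Qed.

Lemma CnZ k (c : R) f : Cn k f -> Cn k (fun x => c * f x).
Proof. by move=> fk; apply: CnM => //; exact: Cn_cst. Qed.

Lemma Cn_sum k (I : Type) (s : seq I) (F : I -> 'cV[R]_n -> R) :
  (forall i, Cn k (F i)) -> Cn k (fun x => \sum_(i <- s) F i x).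
Proof.
move=> Fk; elim: s => [|i s IH].
  by under eq_fun do rewrite big_nil; exact: Cn_cst.
by under eq_fun do rewrite big_cons; exact: CnD.
Qed.

Lemma Cn_coord k (i : 'I_n) : Cn k (fun x => x i 0).
Proof.
case: k => [|k]; first exact: continuous_coord.
split=> [x|j]; first exact: differentiable_coord.
apply: (@eq_Cn _ _ (fun=> (delta_mx j 0 : 'cV[R]_n) i 0)) => [x|]; last exact: Cn_cst.
by apply: (@derive_val _ _ _ _ _ _ _ (is_derive_coord i x _)).
Qed.

Lemma Cn_expR k f : Cn k f -> Cn k (fun x => expR (f x)).
Proof.
elim: k f => [|k IH] f.
  by move=> cf x; apply: (@continuous_comp _ _ _ f expR); [exact: cf|exact: continuous_expR].
move=> fk; have [df Df] := fk; split=> [x|i].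
  exact: (differentiable_comp1 (df x) (is_derive_expR (f x))).
apply: (@eq_Cn _ _ (fun x => expR (f x) * 'D_(delta_mx i 0) f x)) => [x|].
  exact: (derive_comp1 _ (df x) (is_derive_expR (f x))).
by apply: CnM; [apply: IH; exact: CnW|exact: Df].
Qed.

Lemma is_derive_inv (u : R) : u != 0 -> is_derive u 1 (fun v : R => v^-1) (- (u ^- 2)).
Proof.
move=> u0; apply: DeriveDef.
  exact: (@derivableV _ _ id).
by rewrite (@deriveV _ _ id) // derive_id /GRing.scale /= mulr1.
Qed.

Lemma Cn_inv k f : (forall x, f x != 0) -> Cn k f -> Cn k (fun x => (f x)^-1).
Proof.
move=> f0; elim: k => [|k IH].
  by move=> cf x; exact: (continuousV (f0 x) (cf x)).
move=> fk; have [df Df] := fk; split=> [x|i].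
  exact: (differentiable_comp1 (df x) (is_derive_inv (f0 x))).
have fVk : Cn k (fun x => (f x)^-1) by apply: IH; exact: CnW.
apply: (@eq_Cn _ _ (fun x => (-1) *
    (((f x)^-1 * (f x)^-1) * 'D_(delta_mx i 0) f x))) => [x|].
  rewrite (derive_comp1 _ (df x) (is_derive_inv (f0 x))).
  by rewrite mulrA mulN1r -invfM -expr2.
by apply: CnZ; apply: CnM; [exact: CnM|exact: Df].
Qed.

(** Off the closed support [f] is locally zero, so its derivatives vanish there as well; on the
    compact support continuity gives the bounds. *)
Lemma test_bounded_C1 f : test_function f -> bounded_C1 f.
Proof.
move=> [fk fc]; set S := closure [set x | f x != 0] in fc.
have bnd (g : 'cV[R]_n -> R) : continuous g -> (forall x, ~ S x -> g x = 0) ->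
    exists2 C, 0 <= C & forall x, `|g x| <= C.
  move=> cg g0; have := @continuous_compact _ _ g S _ fc.
  move=> /(_ (continuous_subspaceT cg)) /compact_bounded [M [Mr MP]].
  exists (`|M| + 1) => [|x]; first by rewrite addr_ge0.
  have [Sx|/g0 ->] := pselect (S x); last by rewrite normr0 addr_ge0.
  apply: (MP (`|M| + 1)); last by exists x.
  by rewrite (le_lt_trans (ler_norm M)) // ltrDl.
have Df0 i x : ~ S x -> 'D_(delta_mx i 0) f x = 0.
  move=> nS; have fn : {near x, f =1 cst 0}.
    have : nbhs x (~` S) by apply: open_nbhs_nbhs; split=> //; exact/closed_openC/closed_closure.
    apply: filterS => z nz; apply/eqP; apply: contra_notT nz => fz.
    exact: subset_closure.
  rewrite (near_eq_derive _ fn) ?derive_cst //.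
split.
- by case: (fk 1%N).
- by move=> i; case: (fk 1%N) => _ /(_ i).
- have f0 x : ~ S x -> f x = 0.
    move=> nS; apply/eqP; apply: contra_notT nS => fx; exact: subset_closure.
  by have [C _ fC] := bnd f (Cn_continuous (fk 0%N)) f0; exists C.
- have Dbnd i : exists C, forall x, `|grad f x i 0| <= C.
    have [C C0 DC] : exists2 C, 0 <= C & forall x, `|'D_(delta_mx i 0) f x| <= C.
      by apply: bnd; [case: (fk 1%N) => _ /(_ i)|exact: Df0].
    by exists C => x; rewrite mxE.
  have /choice [C CP] := Dbnd.
  exists (Num.sqrt (\sum_i C i ^+ 2)) => x.
  rewrite -[enorm _](ger0_norm (enorm_ge0 _)) -sqrtr_sqr ler_wsqrtr // sqr_enormE.
  apply: ler_sum => i _; rewrite -[leLHS]real_normK ?num_real //.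
  by rewrite ler_sqr ?nnegrE // (le_trans _ (CP i x)).
Qed.

(** The closed support can only shrink. This is where [ramp 0 = 0] is needed, and it applies equally
    to products with smooth functions. *)
Lemma test_function_vanish f g : test_function f -> (forall k, Cn k g) ->
  (forall x, f x = 0 -> g x = 0) -> test_function g.
Proof.
move=> [_ fc] gk fg; split=> //.
apply: (subclosed_compact _ fc); first exact: closed_closure.
apply: closureS => x /=; apply: contra_neq; exact: fg.
Qed.

Lemma test_ramp f : test_function f -> test_function (fun x => ramp (f x)).
Proof.
move=> ft; apply: (test_function_vanish ft) => [k|x fx]; last first.
  by rewrite /ramp fx; field.
have [fk _] := ft; rewrite /ramp; apply: CnD; first by apply: CnD => //; exact: Cn_cst.
apply: CnZ; apply: Cn_inv => [x|]; first by rewrite lt0r_neq0 // ramp_den_gt0.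
by apply: CnD; [exact: Cn_cst|exact: (CnM (fk k) (fk k))].
Qed.

Lemma test_functionZ (c : R) f : test_function f -> test_function (fun x => c * f x).
Proof.
move=> ft; apply: (test_function_vanish ft) => [k|x ->]; last by rewrite mulr0.
by apply: CnZ; case: ft.
Qed.

Lemma is_derive_ramp (u : R) :
  is_derive u 1 (@ramp R) (1 - 4 * u / (1 + u ^+ 2) ^+ 2).
Proof.
have h := ramp_den_gt0 u.
pose q : R -> R := cst 1 + id * id.
have d1 : is_derive u 1 q (2 * u).
  have dq := is_deriveD (is_derive_cst (1 : R^o) u 1)
    (is_deriveM (is_derive_id u (1 : R^o)) (is_derive_id u (1 : R^o))).
  apply: (@is_derive_eq _ _ _ q u 1 _ _ dq); rewrite /GRing.scale /=; ring.
have qu : q u = 1 + u ^+ 2 by rewrite expr2.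
have q0 : q u != 0 by rewrite qu lt0r_neq0.
have d2 : is_derive u 1 (fun z : R => (q z)^-1) (- (2 * u) / (1 + u ^+ 2) ^+ 2).
  have dq := @ex_derive _ _ _ _ _ _ _ d1; have Dq := @derive_val _ _ _ _ _ _ _ d1.
  apply: DeriveDef; first exact: derivableV.
  by rewrite deriveV // Dq qu /GRing.scale /= mulNr mulrC mulNr.
have -> : @ramp R = (id - cst 2) + 2 *: (fun z : R => (q z)^-1).
  by apply/funext => z; rewrite /ramp expr2.
have dr := is_deriveD (is_deriveB (is_derive_id u (1 : R^o)) (is_derive_cst (2 : R^o) u 1))
  (is_deriveZ 2 d2).
apply: (@is_derive_eq _ _ _ _ u 1 _ _ dr); rewrite /GRing.scale /=.
by field; exact: lt0r_neq0.
Qed.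

Lemma ramp_derive_norm (u : R) : `|1 - 4 * u / (1 + u ^+ 2) ^+ 2| <= 3.
Proof.
have h := ramp_den_gt0 u; set q := 4 * u / _.
have : `|q| <= 2; last by rewrite !ler_norml => /andP[? ?]; apply/andP; split; lra.
rewrite /q normrM normfV (gtr0_norm (exprn_gt0 2 h)) ler_pdivrMr ?exprn_gt0 //.
have := sqr_ge0 (u - 1); have := sqr_ge0 (u + 1); have := sqr_ge0 u.
by move=> *; rewrite ler_norml; apply/andP; split; nra.
Qed.

Lemma grad_ramp_le f x : differentiable f x ->
  enorm (grad (fun x => ramp (f x)) x) <= 3 * enorm (grad f x).
Proof.
move=> df; set k := 1 - 4 * f x / (1 + f x ^+ 2) ^+ 2.
have -> : grad (fun x => ramp (f x)) x = k *: grad f x.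
  by apply/colP => i; rewrite !mxE (derive_comp1 _ df (is_derive_ramp (f x))).
by rewrite enormZ; apply: ler_wpM2r; [exact: enorm_ge0|exact: ramp_derive_norm].
Qed.

End smooth_functions.

(** * Integration against a density *)

Section density_integral.
Variables (R : realType) (n : nat) (p : 'cV[R]_n -> R).
Hypothesis mp : measurable_fun setT p.
Hypothesis p_ge0 : forall x, 0 <= p x.
Hypothesis p_fin : (\int[@lebesgue_cV R n]_x (p x)%:E < +oo)%E.
Local Notation leb := (@lebesgue_cV R n).
Local Notation mu := (@lebesgue_measure R).
Local Open Scope ereal_scope.

Let nu := with_density p.

Let mpE : measurable_fun setT (EFin \o p). Proof. exact/measurable_EFinP. Qed.

Let pE_ge0 x : 0 <= (EFin \o p) x. Proof. by rewrite lee_fin. Qed.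

Let nu0 : nu set0 = 0. Proof. exact: integral_set0. Qed.

Let nu_ge0 A : 0 <= nu A. Proof. by apply: integral_ge0 => x _; exact: pE_ge0. Qed.

Let nu_sigma : semi_sigma_additive nu.
Proof. exact: (@semi_sigma_additive_nng_induced _ _ _ leb (EFin \o p)). Qed.

HB.instance Definition _ := isMeasure.Build _ 'cV[R]_n _ nu nu0 nu_ge0 nu_sigma.

Let nu_fin : fin_num_fun nu.
Proof.
move=> A mA; rewrite ge0_fin_numE //; apply: le_lt_trans p_fin.
by apply: ge0_subset_integral => // x _; exact: pE_ge0.
Qed.

HB.instance Definition _ := @Measure_isFinite.Build _ 'cV[R]_n _ nu nu_fin.

(* Layer cake: [f x] is the length of [`[0, f x[], so that Tonelli reduces the
   change of density to the definition of [with_density] on sets. *)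
Let ge0_integral_with_density (f : 'cV[R]_n -> R) :
  measurable_fun setT f -> (forall x, 0 <= f x)%R ->
  \int[nu]_x (f x)%:E = \int[leb]_x (f x * p x)%:E.
Proof.
move=> mf f0.
pose A := [set xs : 'cV[R]_n * R | (0 <= xs.2 < f xs.1)%R].
have mA : measurable A.
  have m1 : measurable_fun setT (fun xs : 'cV[R]_n * R => f xs.1).
    exact: measurableT_comp mf measurable_fst.
  have m2 : measurable_fun setT (fun xs : 'cV[R]_n * R => f xs.1 - xs.2)%R.
    by apply: measurable_funB => //; exact: measurable_snd.
  rewrite (_ : A = (snd @^-1` `[0%R, +oo[) `&`
      ((fun xs => f xs.1 - xs.2)%R @^-1` `]0%R, +oo[)); last first.
    apply/seteqP; split=> xs /=; rewrite !in_itv /= !andbT subr_gt0.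
      by move=> /andP.
    by move=> [? ?]; apply/andP.
  apply: measurableI; rewrite -[X in measurable X]setTI; last exact: m2.
  exact: measurable_snd.
have mI : measurable_fun setT (fun xs => (\1_A xs)%:E : \bar R).
  by apply/measurable_EFinP; exact: measurable_indic.
have I0 xs : 0 <= (\1_A xs)%:E :> \bar R by rewrite lee_fin indicE.
have lenE x : \int[mu]_s (\1_A (x, s))%:E = (f x)%:E.
  rewrite (_ : (fun s => _) = (fun s => (\1_(`[0%R, f x[%classic) s)%:E)); last first.
    by apply/funext => s; rewrite !indicE; congr (_%:R%:E); apply/idP/idP;
      rewrite !inE /= in_itv.
  transitivity (mu `[0%R, f x[%classic); first by rewrite integral_indic // setIT.
  rewrite lebesgue_measure_itv /= lte_fin.
  have [_|fx] := ltP 0%R (f x); first by rewrite -EFinB subr0.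
  by congr (_%:E); apply/eqP; rewrite eq_le f0.
have mIp : measurable_fun setT (fun xs : 'cV[R]_n * R => (\1_A xs * p xs.1)%:E).
  apply/measurable_EFinP; apply: measurable_funM; first exact: measurable_indic.
  exact: measurableT_comp mp measurable_fst.
have Ip0 (xs : 'cV[R]_n * R) : 0 <= (\1_A xs * p xs.1)%:E.
  by rewrite lee_fin mulr_ge0 // indicE.
transitivity (\int[nu]_x \int[mu]_s (\1_A (x, s))%:E).
  by apply: eq_integral => x _; rewrite lenE.
rewrite (@fubini_tonelli _ _ 'cV[R]_n (measurableTypeR R) R nu mu _ mI I0).
transitivity (\int[mu]_s \int[leb]_x (\1_A (x, s) * p x)%:E).
  apply: eq_integral => s _.
  have mAs : measurable (ysection A s) by exact: measurable_ysection.
  rewrite (_ : (fun x => (\1_A (x, s))%:E) = (fun x => (\1_(ysection A s) x)%:E)); last first.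
    by apply/funext => x; rewrite !indicE mem_ysection.
  transitivity (\int[leb]_(x in ysection A s) (p x)%:E).
    by rewrite integral_indic // setIT.
  rewrite integral_mkcond.
  apply: eq_integral => x _; rewrite patchE indicE mem_ysection.
  by case: ifPn => _; rewrite ?mul1r ?mul0r.
rewrite -(@fubini_tonelli _ _ 'cV[R]_n (measurableTypeR R) R leb mu _ mIp Ip0).
apply: eq_integral => x _ /=; under eq_integral do rewrite EFinM muleC.
rewrite ge0_integralZl_EFin //; last first.
  exact: measurableT_comp mI (measurable_pair1 x).
by rewrite lenE -EFinM mulrC.
Qed.

Lemma integral_with_density (g : 'cV[R]_n -> R) : measurable_fun setT g ->
  \int[with_density p]_x (g x)%:E = \int[leb]_x (g x * p x)%:E.
Proof.
move=> mg; rewrite -/nu [LHS]integralE [RHS]integralE; congr (_ - _).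
  transitivity (\int[nu]_x (Num.max (g x) 0)%:E).
    by apply: eq_integral => x _; rewrite funeposE EFin_max.
  rewrite ge0_integral_with_density; last 2 first.
  - exact: measurable_maxr.
  - by move=> x; rewrite le_max lexx orbT.
  apply: eq_integral => x _; rewrite funeposE -EFin_max; congr (_%:E).
  by rewrite maxr_pMl // mul0r.
transitivity (\int[nu]_x (Num.max (- g x) 0)%:E).
  by apply: eq_integral => x _; rewrite funenegE EFin_max EFinN.
rewrite ge0_integral_with_density; last 2 first.
- by apply: measurable_maxr => //; exact: measurableT_comp.
- by move=> x; rewrite le_max lexx orbT.
apply: eq_integral => x _; rewrite funenegE -EFinN -EFin_max; congr (_%:E).
by rewrite maxr_pMl // mul0r mulNr.
Qed.

End density_integral.

(** * Defective log-Sobolev inequality for the perturbed potential *)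

Section log_sobolev_perturbation.
Variables (R : realType) (n : nat).
Implicit Types (f g h U V W : 'cV[R]_n -> R) (x v : 'cV[R]_n).
Local Notation leb := (@lebesgue_cV R n).
Local Notation wt W := (fun x => expR (- W x)).

(** Serves test functions of zero mass, for which the inequality divides by 0 and has to be checked
    by hand. *)
Lemma wint_eq0 w f g : gauss_dom w -> (forall x, 0 <= w x) ->
  quad_growth f -> quad_growth g -> (forall x, 0 <= f x) ->
  (forall x, f x = 0 -> g x = 0) -> wint w f = 0 -> wint w g = 0.
Proof.
move=> wdom w0 fq gq f0 fg wf0.
have ifw := wint_integrable wdom fq; have igw := wint_integrable wdom gq.
have fae : ae_eq leb setT (EFin \o (fun x => f x * w x)) (cst 0%E).
  apply/(ae_eq_integral_abs leb measurableT (measurable_int _ ifw)).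
  rewrite -[RHS](congr1 EFin wf0) (EFin_wint wdom fq).
  by apply: eq_integral => x _; rewrite /= ger0_norm // mulr_ge0.
rewrite /wint /Rintegral (@ae_eq_integral _ _ _ leb setT (cst 0%E)) //.
- by rewrite integral0.
- exact: measurable_int igw.
- apply: filterS fae => x h xT; have /= [] := h xT => /eqP.
  rewrite mulf_eq0 => /orP[/eqP/fg ->|/eqP ->]; first by rewrite mul0r.
  by rewrite mulr0.
Qed.

Lemma entropy_quad h : bounded_C1 h ->
  quad_growth (fun x => h x ^+ 2 * ln (h x ^+ 2)).
Proof.
move=> hb; have mh := bC1_measurable hb; have [C hC] := bC1_bound hb.
have mh2 : measurable_fun setT (fun x => h x ^+ 2) by exact: measurable_funX.
have C0 : 0 <= C by exact: le_trans (hC 0).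
apply: (@quad_growth_bounded _ _ _ (2 * C + (C ^+ 2 + 1) ^+ 2)).
  by apply: measurable_funM => //; exact: measurableT_comp.
move=> x; have h1 := sqr_mul_ln_ge (h x); have h2 := ln_sqr_le (h x).
have hx := hC x; have h20 := sqr_ge0 (h x).
have h2C : h x ^+ 2 <= C ^+ 2.
  by rewrite -[h x ^+ 2]real_normK ?num_real // ler_sqr ?nnegrE.
have h3 : (h x ^+ 2 - 1) ^+ 2 + h x ^+ 2 <= (C ^+ 2 + 1) ^+ 2.
  by move: h20 h2C; move: (h x ^+ 2) (C ^+ 2) => s t s0 st; nra.
rewrite ler_norml; apply/andP; split; last by lra.
by have := sqr_ge0 (C ^+ 2 + 1); lra.
Qed.

Lemma Cn_half_weight k V : Cn k V -> Cn k (fun x => expR (- (V x / 2))).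
Proof.
move=> Vk; apply: Cn_expR; apply: (@eq_Cn _ _ _ _ (fun x => (- (1 / 2)) * V x)).
  by move=> x; field.
exact: CnZ.
Qed.

Lemma grad_half_weight h V x : differentiable h x -> differentiable V x ->
  grad (fun x => h x * expR (- (V x / 2))) x =
  expR (- (V x / 2)) *: (grad h x - (h x / 2) *: grad V x).
Proof.
move=> dh dV; apply/colP => i; rewrite !mxE.
have dV2 : differentiable (fun x => (- 2^-1) * V x) x by exact: differentiableZ.
have -> : (fun x => h x * expR (- (V x / 2))) = h * (expR \o (fun x => (- 2^-1) * V x)).
  by apply/funext => z /=; congr (_ * expR _); field.
rewrite (@deriveM _ _ h); [|exact: diff_derivable|]; last first.
  apply: diff_derivable.
  exact: (differentiable_comp1 dV2 (is_derive_expR _)).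
rewrite (derive_comp1 _ dV2 (is_derive_expR _)).
rewrite (@deriveZ _ _ _ V); last exact: diff_derivable.
rewrite /GRing.scale /= (_ : - 2^-1 * V x = - (V x / 2)); last by field.
by field.
Qed.

(* Apply the inequality of [U] to [h * expR (- V / 2)]. *)
Lemma defective_log_sobolev (C : R) U V h : 0 <= C ->
  (forall x, differentiable U x) -> (\int[leb]_x (expR (- U x))%:E = 1)%E ->
  log_sobolev (with_density (wt U)) C ->
  (forall k, Cn k V) -> (forall x, 0 <= V x) -> quad_growth V ->
  quad_growth (fun x => enorm (grad V x) ^+ 2) ->
  gauss_dom (wt (fun x => U x + V x)) -> test_function h ->
  forall w H, w = wt (fun x => U x + V x) -> H = wint w (fun x => h x ^+ 2) ->
  wint w (fun x => h x ^+ 2 * ln (h x ^+ 2)) <= H * ln H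
    + wint w (fun x => h x ^+ 2 * V x)
    + C * (2 * wint w (fun x => enorm (grad h x) ^+ 2)
           + 1 / 2 * wint w (fun x => h x ^+ 2 * enorm (grad V x) ^+ 2)).
Proof.
move=> C0 dU iU lsU Vs V0 Vq gVq wdom0 ht w H wE HE; have wdom : gauss_dom w by rewrite wE.
have hb := test_bounded_C1 ht; have mh := bC1_measurable hb.
have [B hB] := bC1_bound hb; have B0 : 0 <= B by exact: le_trans (hB 0).
have w0 x : 0 <= w x by rewrite wE; exact: expR_ge0.
have mh2 : measurable_fun setT (fun x => h x ^+ 2) by exact: measurable_funX.
have h2B x : `|h x ^+ 2| <= B ^+ 2 by rewrite normrX ler_sqr ?nnegrE.
have h2q := bC1_quad hb; have eq := entropy_quad hb; have gq := bC1_grad_quad hb.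
have hVq := quad_growthMl mh2 h2B Vq; have hgq := quad_growthMl mh2 h2B gVq.
have dV x : differentiable V x by case: (Vs 1%N).
have mU : measurable_fun setT (wt U).
  apply: continuous_measurable_cV; apply: (@Cn_continuous _ _ 0%N).
  apply: Cn_expR => x; apply: (@continuousN _ _ _ U).
  exact: differentiable_continuous.
have rhs0 : 0 <= C * (2 * wint w (fun x => enorm (grad h x) ^+ 2)
    + 1 / 2 * wint w (fun x => h x ^+ 2 * enorm (grad V x) ^+ 2)).
  have p1 : 0 <= wint w (fun x => enorm (grad h x) ^+ 2).
    by apply: wint_ge0 => // x; exact: sqr_ge0.
  have p2 : 0 <= wint w (fun x => h x ^+ 2 * enorm (grad V x) ^+ 2).
    by apply: wint_ge0 => // x; apply: mulr_ge0; exact: sqr_ge0.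
  apply: mulr_ge0 => //; lra.
have [H0|Hn0] := eqVneq H 0.
  rewrite HE in H0; rewrite (wint_eq0 wdom w0 h2q eq _ _ H0) => [|x|x ->]; last by rewrite mul0r.
    rewrite HE H0 mul0r add0r addr_ge0 //; apply: wint_ge0 => // x.
    by apply: mulr_ge0; [exact: sqr_ge0|exact: V0].
  exact: sqr_ge0.
have H_gt0 : 0 < H.
  by rewrite lt_def Hn0 HE wint_ge0 // => x; exact: sqr_ge0.
pose g x := h x * expR (- (V x / 2)).
have gt : test_function g.
  apply: (test_function_vanish ht) => [k|x hx]; last by rewrite /g hx mul0r.
  by apply: CnM; [case: ht|exact: Cn_half_weight].
(* The exponent is halved so that squares of [g] against the prior are squares of [h] against the
   posterior weight. *)
have e2 x : expR (- (V x / 2)) ^+ 2 * expR (- U x) = w x.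
  by rewrite expr2 -!expRD wE; congr expR; field.
have mg : measurable_fun setT g.
  by apply: continuous_measurable_cV; apply: (@Cn_continuous _ _ 0%N); case: gt.
have mg2 : measurable_fun setT (fun x => g x ^+ 2) by exact: measurable_funX.
have Ufin : (\int[leb]_x (expR (- U x))%:E < +oo)%E by rewrite iU ltry.
have idens := integral_with_density mU (fun x => expR_ge0 (- U x)) Ufin.
have meanE : fine (\int[with_density (wt U)]_x (g x ^+ 2)%:E)%E = H.
  rewrite idens // HE /wint /Rintegral; congr fine; apply: eq_integral => x _.
  by rewrite /g exprMn -mulrA e2.
have := lsU g gt; rewrite /= meanE.
have msg : measurable_fun setT (fun x => enorm (grad g x) ^+ 2).
  exact: (measurable_sqr_grad (test_bounded_C1 gt)).
rewrite idens; last first.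
  apply: measurable_funM => //; apply: measurableT_comp => //.
  exact: measurable_funM.
rewrite [X in (_ <= _ * X)%E]idens //.
have bq : quad_growth (fun x => 2 * enorm (grad h x) ^+ 2
    + 1 / 2 * (h x ^+ 2 * enorm (grad V x) ^+ 2)).
  by apply: quad_growthD; exact: quad_growthZ.
(* The gradient of [g] is a multiple of [grad h - (h / 2) grad V]; bounding the square of the
   difference gives the factors 2 and 1/2. *)
have gradle : (\int[leb]_x (enorm (grad g x) ^+ 2 * expR (- U x))%:E <=
    (wint w (fun x => 2 * enorm (grad h x) ^+ 2
      + 1 / 2 * (h x ^+ 2 * enorm (grad V x) ^+ 2)))%:E)%E.
  rewrite (EFin_wint wdom bq); apply: ge0_le_integral => //.
  - by move=> x _; rewrite lee_fin mulr_ge0 ?sqr_ge0 ?expR_ge0.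
  - by apply/measurable_EFinP; exact: measurable_funM.
  - exact: measurable_int (wint_integrable wdom bq).
  move=> x _; rewrite lee_fin grad_half_weight //; last exact: (bC1_diff hb).
  rewrite enormZ exprMn (ger0_norm (expR_ge0 _)) mulrAC e2 mulrC.
  apply: ler_wpM2r; first exact: w0.
  apply: le_trans (ler_enorm_add2 _ _) _; rewrite enormN enormZ exprMn lerD2l.
  rewrite real_normK ?num_real // le_eqVlt; apply/orP; left; apply/eqP.
  by field.
have lq : quad_growth (fun x => h x ^+ 2 * ln (h x ^+ 2) - h x ^+ 2 * V x - ln H * h x ^+ 2).
  by apply: quad_growthB; [exact: quad_growthB|exact: quad_growthZ].
rewrite (_ : (\int[leb]_x _)%E = (wint w (fun x => h x ^+ 2 * ln (h x ^+ 2)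
    - h x ^+ 2 * V x - ln H * h x ^+ 2))%:E); last first.
  rewrite (EFin_wint wdom lq); apply: eq_integral => x _; congr (_%:E).
  (* At zeros of [h] both integrands vanish whatever the value of [ln 0]; elsewhere the logarithm
     splits, and its part [- V] is the source of the defect [h ^+ 2 * V]. *)
  have [hx|hx] := eqVneq (h x) 0; first by rewrite /g hx !(mul0r, expr0n, mulr0, subr0).
  have h2 : 0 < h x ^+ 2 by rewrite lt_def sqrf_eq0 hx sqr_ge0.
  have -> : ln (g x ^+ 2 / H) = ln (h x ^+ 2) - V x - ln H.
    rewrite ln_div ?posrE //; last by rewrite exprMn mulr_gt0 // exprn_gt0 // expR_gt0.
    rewrite /g exprMn lnM ?posrE // ?exprn_gt0 ?expR_gt0 //.
    rewrite (_ : expR (- (V x / 2)) ^+ 2 = expR (- V x)) ?expRK //.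
    by rewrite expr2 -expRD; congr expR; field.
  by rewrite /g exprMn -[in RHS]e2; ring.
move=> ls; have {ls}: wint w (fun x => h x ^+ 2 * ln (h x ^+ 2)
    - h x ^+ 2 * V x - ln H * h x ^+ 2) <=
    C * wint w (fun x => 2 * enorm (grad h x) ^+ 2
      + 1 / 2 * (h x ^+ 2 * enorm (grad V x) ^+ 2)).
  rewrite -lee_fin EFinM; apply: le_trans ls _.
  by apply: lee_wpmul2l; rewrite ?lee_fin.
have q1 := quad_growthB eq hVq; have q2 := quad_growthZ (ln H) h2q.
rewrite (wintB wdom q1 q2) (wintB wdom eq hVq) (wintZ wdom _ h2q).
have q3 := quad_growthZ 2 gq; have q4 := quad_growthZ (1 / 2) hgq.
rewrite (wintD wdom q3 q4) (wintZ wdom _ gq) (wintZ wdom _ hgq) -HE.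
move: (wint w (fun x => h x ^+ 2 * V x)) => a1.
move: (wint w (fun x => h x ^+ 2 * ln (h x ^+ 2))) => a2.
by rewrite [ln H * H]mulrC => ?; lra.
Qed.

End log_sobolev_perturbation.

(** * Removing the defect *)

Section tight_log_sobolev.
Variables (R : realType) (n : nat).
Implicit Types (f g h U V W : 'cV[R]_n -> R) (x v : 'cV[R]_n).
Local Notation leb := (@lebesgue_cV R n).
Local Notation wt W := (fun x => expR (- W x)).

Lemma mulr_ln_le0 (H : R) : 0 <= H -> H <= 1 -> H * ln H <= 0.
Proof. by move=> H0 H1; rewrite mulr_ge0_le0 // ln_le0. Qed.

(** [H] and [E1] are the mass and energy of [ramp f]. The numbers 25/4 and 23 come from
    [tightening_bound], 9/4 from [ramp_sqr], and 9 is the square of the Lipschitz bound 3 of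
    [ramp]. *)
Lemma near_constant_bound (A CP E H E1 D V a h l : R) : 0 <= A ->
  a <= 25 / 4 * h + 23 * D -> h <= l + A * (H + E1) -> l <= 0 ->
  H <= 9 / 4 * D -> D <= 2 * V -> V <= CP * E -> E1 <= 9 * E ->
  a <= (25 / 4 * A * (9 / 2 * CP + 9) + 46 * CP) * E.
Proof.
move=> A0 ah hl l0 HD DV VE E1E.
have s : A * (H + E1) <= A * ((9 / 2 * CP + 9) * E) by apply: ler_wpM2l => //; lra.
lra.
Qed.

Lemma near_constant_le1 (D V Z H : R) :
  H <= 9 / 4 * D -> D <= 2 * V -> V <= Z / 8 -> Z <= 1 -> H <= 1.
Proof. lra. Qed.

(* The defective inequality is applied to [ramp f], whose mass is at most 1, so that
   its term [H * ln H] is nonpositive and its mass is controlled by the variance. *)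
Lemma tighten_near_constant w f (Z A CP E m : R) : gauss_dom w -> (forall x, 0 <= w x) ->
  test_function f -> 0 <= A -> 0 <= CP ->
  Z = wint w (fun=> 1) -> 0 < Z -> Z <= 1 ->
  E = wint w (fun x => enorm (grad f x) ^+ 2) ->
  (forall h, test_function h -> wint w (fun x => h x ^+ 2 * ln (h x ^+ 2)) <=
     wint w (fun x => h x ^+ 2) * ln (wint w (fun x => h x ^+ 2)) +
     A * (wint w (fun x => h x ^+ 2) + wint w (fun x => enorm (grad h x) ^+ 2))) ->
  wint w (fun x => f x ^+ 2) = Z -> m = wint w f / Z -> 0 <= m ->
  wint w (fun x => (f x - m) ^+ 2) <= CP * E ->
  wint w (fun x => (f x - m) ^+ 2) <= Z / 8 ->
  wint w (fun x => f x ^+ 2 * ln (f x ^+ 2)) <=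
    (25 / 4 * A * (9 / 2 * CP + 9) + 46 * CP) * E.
Proof.
move=> wdom w0 ft A0 CP0 ZE Z0 Z1 EE defect f2Z mE m0 poinc small.
have fb := test_bounded_C1 ft; have mf := bC1_measurable fb.
have [B fB] := bC1_bound fb.
have f2q := bC1_quad fb; have fbc c := bC1_subcst c fb.
have E0 : 0 <= E by rewrite EE wint_ge0 // => x; exact: sqr_ge0.
set V := wint w (fun x => (f x - m) ^+ 2) in poinc small.
have V0 : 0 <= V by apply: wint_ge0 => // x; exact: sqr_ge0.
have Zw0 : 0 < wint w (fun=> 1) by rewrite -ZE.
have V1 : V = Z - Z * m ^+ 2.
  have e0 : wint w (fun x => (f x - 0) ^+ 2) = Z.
    by rewrite -f2Z; apply: eq_wint => x; rewrite subr0.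
  by have := wint_variance wdom 0 mf fB Zw0; rewrite /= -ZE -mE -/V subr0 e0.
pose D := wint w (fun x => (f x - 1) ^+ 2).
have D1 : D = V + Z * (m - 1) ^+ 2.
  have := wint_variance wdom 1 mf fB Zw0; rewrite /= -ZE -mE -/V -/D => ->.
  by rewrite subrK.
(* The second moment of [f] is [Z], so [V = Z * (1 - m ^+ 2)], which is nonnegative. *)
have m1 : m <= 1.
  have : 0 <= Z * (1 - m ^+ 2) by rewrite mulrBr mulr1 -V1.
  by rewrite pmulr_rge0 // => h; nra.
have D2 : D <= 2 * V.
  (* For [0 <= m <= 1] one has [(m - 1) ^+ 2 <= 1 - m ^+ 2]: a small variance forces [f] close to 1.
     This is why the sign of [m] matters. *)
  rewrite D1 V1.
  have : Z * (m - 1) ^+ 2 <= Z * (1 - m ^+ 2) by rewrite ler_pM2l //; nra.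
  by rewrite mulrBr mulr1; lra.
pose h x := ramp (f x).
have ht : test_function h by exact: test_ramp.
have hb := test_bounded_C1 ht.
have Dq := bC1_quad (fbc 1); have hq := bC1_quad hb.
have eh := entropy_quad hb; have ef := entropy_quad fb.
have gq := bC1_grad_quad fb; have hgq := bC1_grad_quad hb.
have H1 : wint w (fun x => h x ^+ 2) <= 9 / 4 * D.
  rewrite -(wintZ wdom _ Dq); apply: ler_wint => //; first exact: quad_growthZ.
  by move=> x; exact: ramp_sqr.
have H0 : 0 <= wint w (fun x => h x ^+ 2) by apply: wint_ge0 => // x; exact: sqr_ge0.
have Eh : wint w (fun x => enorm (grad h x) ^+ 2) <= 9 * E.
  rewrite EE -(wintZ wdom _ gq); apply: ler_wint => //; first exact: quad_growthZ.
  move=> x; have -> : 9 = 3 ^+ 2 :> R by ring.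
  rewrite -exprMn ler_sqr ?nnegrE ?mulr_ge0 ?enorm_ge0 //.
  exact: grad_ramp_le (bC1_diff fb x).
have Hln : wint w (fun x => h x ^+ 2) * ln (wint w (fun x => h x ^+ 2)) <= 0.
  exact: (mulr_ln_le0 H0 (near_constant_le1 H1 D2 small Z1)).
have := defect h ht => def.
have key : wint w (fun x => f x ^+ 2 * ln (f x ^+ 2)) <=
    25 / 4 * wint w (fun x => h x ^+ 2 * ln (h x ^+ 2)) + 23 * D.
  have q1 := quad_growthB ef f2q; have q2 := quad_growth_cst n (1 : R).
  (* Adding [1 - f x ^+ 2] changes nothing, both terms having integral [Z]; it makes the integrand
     of second order at 1. *)
  have -> : wint w (fun x => f x ^+ 2 * ln (f x ^+ 2)) =
      wint w (fun x => f x ^+ 2 * ln (f x ^+ 2) - f x ^+ 2 + 1).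
    by rewrite (wintD wdom q1 q2) (wintB wdom ef f2q) f2Z -ZE subrK.
  have q3 := quad_growthZ (25 / 4) eh; have q4 := quad_growthZ 23 Dq.
  rewrite -(wintZ wdom (25 / 4) eh) -(wintZ wdom 23 Dq) -(wintD wdom q3 q4).
  apply: (ler_wint wdom w0 (quad_growthD q1 q2) (quad_growthD q3 q4)) => x.
  exact: tightening_bound.
exact: (near_constant_bound A0 key def Hln H1 D2 poinc Eh).
Qed.

(** When the variance is at least [Z / 8], the Poincare inequality bounds the mass [Z], hence the
    whole defect, by the energy. *)
Lemma far_from_constant_bound (A CP E Z V a l k : R) : 0 <= A -> 0 <= k * E ->
  Z / 8 <= V -> V <= CP * E -> a <= l + A * (Z + E) -> l <= 0 ->
  a <= (k + A * (8 * CP + 1)) * E.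
Proof.
move=> A0 kE ZV VE al l0.
have s : A * (Z + E) <= A * ((8 * CP + 1) * E) by apply: ler_wpM2l => //; lra.
lra.
Qed.

(** A dichotomy on the variance. If it is large, the defect is absorbed directly; if it is small,
    [tighten_near_constant] applies to [f] or, when the mean is negative, to [- f], which has the
    same entropy, energy and variance. The constant is the sum of those of the two cases. *)
Lemma tight_log_sobolev w f (Z A CP E : R) : gauss_dom w -> (forall x, 0 <= w x) ->
  test_function f -> 0 <= A -> 0 <= CP ->
  Z = wint w (fun=> 1) -> 0 < Z -> Z <= 1 ->
  E = wint w (fun x => enorm (grad f x) ^+ 2) ->
  (forall h, test_function h -> wint w (fun x => h x ^+ 2 * ln (h x ^+ 2)) <=
     wint w (fun x => h x ^+ 2) * ln (wint w (fun x => h x ^+ 2)) +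
     A * (wint w (fun x => h x ^+ 2) + wint w (fun x => enorm (grad h x) ^+ 2))) ->
  (forall h, bounded_C1 h -> let m := wint w h / Z in
    wint w (fun x => (h x - m) ^+ 2) <= CP * wint w (fun x => enorm (grad h x) ^+ 2)) ->
  wint w (fun x => f x ^+ 2) = Z ->
  wint w (fun x => f x ^+ 2 * ln (f x ^+ 2)) <=
    (25 / 4 * A * (9 / 2 * CP + 9) + 46 * CP + A * (8 * CP + 1)) * E.
Proof.
move=> wdom w0 ft A0 CP0 ZE Z0 Z1 EE defect poinc f2Z.
have fb := test_bounded_C1 ft.
have E0 : 0 <= E by rewrite EE wint_ge0 // => x; exact: sqr_ge0.
have k1 : 0 <= A * (8 * CP + 1) * E by rewrite !mulr_ge0 // addr_ge0 // mulr_ge0.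
have k2 : 0 <= (25 / 4 * A * (9 / 2 * CP + 9) + 46 * CP) * E.
  rewrite mulr_ge0 // addr_ge0 ?mulr_ge0 ?addr_ge0 ?mulr_ge0 // divr_ge0 //.
set m := wint w f / Z.
have [large|small] := leP (Z / 8) (wint w (fun x => (f x - m) ^+ 2)).
  have h1 := poinc f fb; rewrite -/m -EE /= in h1.
  have h2 := defect f ft; rewrite f2Z -EE in h2.
  have h3 : Z * ln Z <= 0 by apply: mulr_ln_le0 => //; exact: ltW.
  exact: far_from_constant_bound A0 k2 large h1 h2 h3.
have [m0|m0] := leP 0 m.
  apply: le_trans (tighten_near_constant wdom w0 ft A0 CP0 ZE Z0 Z1 EE defect f2Z
    (erefl m) m0 _ (ltW small)) _; last by rewrite [leRHS]mulrDl lerDl.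
  by rewrite EE; exact: poinc.
pose g x := (-1) * f x.
have gt : test_function g by exact: test_functionZ.
have gE x : g x = - f x by rewrite /g mulN1r.
have g2 x : g x ^+ 2 = f x ^+ 2 by rewrite gE sqrrN.
have gradg x : enorm (grad g x) = enorm (grad f x).
  rewrite -[RHS]enormN; congr enorm; apply/colP => i; rewrite !mxE.
  by rewrite (@deriveZ _ _ _ f) ?scaleN1r //; apply: diff_derivable; exact: (bC1_diff fb).
have wg : wint w g = - wint w f.
  rewrite wintZ ?mulN1r //; have [B fB] := bC1_bound fb.
  exact: quad_growth_bounded (bC1_measurable fb) fB.
have gm : wint w (fun x => (g x - - m) ^+ 2) = wint w (fun x => (f x - m) ^+ 2).
  by apply: eq_wint => x; rewrite gE -opprD sqrrN.
have -> : wint w (fun x => f x ^+ 2 * ln (f x ^+ 2)) =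
    wint w (fun x => g x ^+ 2 * ln (g x ^+ 2)).
  by apply: eq_wint => x; rewrite g2.
have Eg : E = wint w (fun x => enorm (grad g x) ^+ 2).
  by rewrite EE; apply: eq_wint => x; rewrite gradg.
have g2Z : wint w (fun x => g x ^+ 2) = Z by rewrite -f2Z; apply: eq_wint.
have mg : - m = wint w g / Z by rewrite wg mulNr.
apply: le_trans (tighten_near_constant wdom w0 gt A0 CP0 ZE Z0 Z1 Eg defect g2Z
  mg _ _ _) _; last by rewrite [leRHS]mulrDl lerDl.
- by rewrite oppr_ge0 ltW.
- by rewrite gm EE; exact: poinc.
- by rewrite gm; exact: ltW.
Qed.

End tight_log_sobolev.

(** * Normalization and uniform constants *)

Section uniform_log_sobolev.
Variables (R : realType) (n : nat).
Implicit Types (f g h U V W : 'cV[R]_n -> R) (x v : 'cV[R]_n).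
Local Notation leb := (@lebesgue_cV R n).
Local Notation wt W := (fun x => expR (- W x)).

Lemma wint_weight_gt0 (a b : R) (M : R -> R) W : potential_class a b M W ->
  0 < wint (wt W) (fun=> 1).
Proof.
move=> WP; have wdom := pc_dom WP.
pose B := expR (M (n%:R * 1 ^+ 2)).
have B0 : 0 < B by exact: expR_gt0.
have wB x : cube 1 x -> 1 <= B * expR (- W x).
  move=> /cube_sqr_enorm /(pc_bound WP); rewrite ler_norml => /andP[_ h].
  by rewrite /B -expRD -[leLHS]expR0 ler_expR subr_ge0.
have := le_wint_restrict wdom (fun x => expR_ge0 (- W x)) (@measurable_cube R n 1)
  (fun=> ler01) (quad_growth_cst n (1 : R)) (ltW B0) wB.
have lQ : leb (cube 1) = ((2 * 1) ^+ n)%:E by exact: lebesgue_cube.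
have mQ := @measurable_cube R n 1.
rewrite (integral_cst leb mQ) mul1e [leLHS]lQ -EFinM lee_fin => h.
rewrite -(pmulr_rgt0 _ B0); apply: lt_le_trans h; exact: exprn_gt0.
Qed.

Lemma wint_with_density w g (Z : R) : gauss_dom w -> (forall x, 0 <= w x) -> 0 < Z ->
  quad_growth g ->
  (\int[with_density (fun x => w x / Z)%R]_x (g x)%:E = (wint w g / Z)%R%:E)%E.
Proof.
move=> wdom w0 Z0 gq.
have pE : (fun x => w x / Z) = (fun x => Z^-1 * w x) by apply/funext => x; rewrite mulrC.
have pdom : gauss_dom (fun x => Z^-1 * w x).
  exact: gauss_domM (quad_growth_cst n Z^-1) wdom.
rewrite pE integral_with_density //; last 4 first.
- by case: pdom.
- by move=> x; rewrite mulr_ge0 // invr_ge0 ltW.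
- have /integrableP[_] := gauss_dom_integrable pdom; apply: le_lt_trans.
  by apply: ge0_le_integral => //=;
    (try by move=> x _; rewrite lee_fin mulr_ge0 // invr_ge0 ltW);
    (try by apply/measurable_EFinP; case: pdom);
    [apply/measurable_EFinP; apply: measurableT_comp => //; case: pdom
    |move=> x _; rewrite lee_fin ler_norm].
- by case: gq.
rewrite [wint w g / Z]mulrC -(wintZ wdom _ gq) (EFin_wint wdom (quad_growthZ _ gq)).
by apply: eq_integral => x _; rewrite mulrCA mulrA.
Qed.

(** Both sides are homogeneous of degree 2 in [f], so [f] can be scaled to have mean square 1, that
    is, mass [Z] against the unnormalized weight. *)
Lemma log_sobolev_normalized w (Z C : R) : gauss_dom w -> (forall x, 0 <= w x) ->
  Z = wint w (fun=> 1) -> 0 < Z -> 0 <= C ->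
  (forall f, test_function f -> wint w (fun x => f x ^+ 2) = Z ->
    wint w (fun x => f x ^+ 2 * ln (f x ^+ 2)) <=
    C * wint w (fun x => enorm (grad f x) ^+ 2)) ->
  log_sobolev (with_density (fun x => w x / Z)) C.
Proof.
move=> wdom w0 ZE Z0 C0 lsi f ft; cbv zeta; set mean := fine _.
have fb := test_bounded_C1 ft; have f2q := bC1_quad fb; have gq := bC1_grad_quad fb.
have E0 : 0 <= wint w (fun x => enorm (grad f x) ^+ 2).
  by apply: wint_ge0 => // x; exact: sqr_ge0.
rewrite (wint_with_density wdom w0 Z0 gq).
have meanE : mean = wint w (fun x => f x ^+ 2) / Z.
  by rewrite /mean (wint_with_density wdom w0 Z0 f2q).
have mean_ge0 : 0 <= mean.
  rewrite meanE; apply: divr_ge0; last exact: ltW.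
  by apply: wint_ge0 => // x; exact: sqr_ge0.
move: mean meanE mean_ge0 => S SE; rewrite le_eqVlt => /predU1P[<-|S0].
  (* With zero mean the quotient is 0 and so is its logarithm, by the default values of the inverse
     and of [ln]. *)
  have -> : (fun x => (f x ^+ 2 * ln (f x ^+ 2 / 0))%:E) = (fun x => (0 * f x ^+ 2)%:E).
    by apply/funext => x; rewrite invr0 mulr0 ln0 // mulr0 mul0r.
  rewrite (wint_with_density wdom w0 Z0 (quad_growthZ 0 f2q)) (wintZ wdom 0 f2q) !mul0r.
  by rewrite -EFinM lee_fin; apply: mulr_ge0 => //; apply: divr_ge0 => //; exact: ltW.
pose k := (Num.sqrt S)^-1.
have k2 : k ^+ 2 = S^-1 by rewrite /k exprVn sqr_sqrtr // ltW.
pose g x := k * f x.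
have gt : test_function g by exact: test_functionZ.
have gb := test_bounded_C1 gt; have eq := entropy_quad gb.
have g2 x : g x ^+ 2 = S^-1 * f x ^+ 2 by rewrite /g exprMn k2.
have gg x : enorm (grad g x) ^+ 2 = S^-1 * enorm (grad f x) ^+ 2.
  have -> : grad g x = k *: grad f x.
    apply/colP => i; rewrite !mxE (@deriveZ _ _ _ f) //.
    by apply: diff_derivable; exact: (bC1_diff fb).
  by rewrite enormZ exprMn -normrX k2 ger0_norm // invr_ge0 ltW.
have g2Z : wint w (fun x => g x ^+ 2) = Z.
  rewrite (eq_wint _ g2) (wintZ wdom _ f2q).
  have -> : wint w (fun x => f x ^+ 2) = S * Z by rewrite SE divfK // lt0r_neq0.
  by rewrite mulKf // lt0r_neq0.
have := lsi g gt g2Z; rewrite (eq_wint _ gg) (wintZ wdom _ gq) => ls.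
have -> : (fun x => (f x ^+ 2 * ln (f x ^+ 2 / S))%:E) =
    (fun x => (S * (g x ^+ 2 * ln (g x ^+ 2)))%:E).
  apply/funext => x; congr (_%:E).
  by rewrite !g2 mulrA mulVKf ?lt0r_neq0 // [S^-1 * _]mulrC.
rewrite (wint_with_density wdom w0 Z0 (quad_growthZ S eq)) (wintZ wdom S eq).
rewrite -EFinM lee_fin [leRHS]mulrA ler_pM2r ?invr_gt0 //.
apply: le_trans (ler_wpM2l (ltW S0) ls) _.
by rewrite mulrCA mulVKf // lt0r_neq0.
Qed.

(** [V1] and [V2] are the integrals of h^2 V and h^2 |grad V|^2, bounded through the quadratic
    growth of [V] by the second moment [J]. The Lyapunov inequality trades [J] for mass and energy;
    the constant is crude so as to be a single factor of [H + E]. *)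
Lemma lyapunov_defect (a b K C H J V1 V2 E : R) : 0 < a -> 0 <= b -> 0 <= K -> 0 <= C ->
  0 <= H -> 0 <= E ->
  a / 2 * J <= (n%:R + b) * H + 2 / a * E ->
  V1 <= K * (H + J) -> V2 <= K * (H + J) ->
  V1 + C * (2 * E + 1 / 2 * V2) <=
  ((K + C * K) * (1 + 2 * (n%:R + b) / a + 4 / a ^+ 2) + 2 * C) * (H + E).
Proof.
move=> a0 b0 K0 C0 H0 E0 J1 h1 h2.
set c := n%:R + b in J1 *; have c0 : 0 <= c by rewrite addr_ge0.
have J2 : J <= 2 * c / a * H + 4 / a ^+ 2 * E.
  have a2 : 0 <= 2 / a by rewrite divr_ge0 // ltW.
  have := ler_wpM2l a2 J1.
  have -> : 2 / a * (a / 2 * J) = J by field; exact: lt0r_neq0.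
  move/le_trans; apply; rewrite le_eqVlt; apply/orP; left; apply/eqP.
  by field; exact: lt0r_neq0.
have u0 : 0 <= 2 * c / a by rewrite divr_ge0 ?mulr_ge0 // ltW.
have v0 : 0 <= 4 / a ^+ 2 by rewrite divr_ge0 // sqr_ge0.
move: (2 * c / a) (4 / a ^+ 2) u0 v0 J2 => u v u0 v0 J2.
have k0 : 0 <= K + C * K by rewrite addr_ge0 // mulr_ge0.
have HJ : H + J <= (1 + u + v) * (H + E).
  have uE : 0 <= u * E by exact: mulr_ge0.
  have vH : 0 <= v * H by exact: mulr_ge0.
  lra.
have s1 := ler_wpM2l k0 HJ.
have s2 := ler_wpM2l C0 h2.
have CH : 0 <= C * H by exact: mulr_ge0.
have V0 : 0 <= (1 + u + v) * (H + E).
  by apply: mulr_ge0; rewrite addr_ge0 // addr_ge0.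
have s3 : 0 <= C * (K * ((1 + u + v) * (H + E))) by rewrite mulr_ge0 // mulr_ge0.
have s4 := ler_wpM2l C0 (ler_wpM2l K0 HJ).
have s5 := ler_wpM2l K0 HJ.
have -> : ((K + C * K) * (1 + u + v) + 2 * C) * (H + E) =
  K * ((1 + u + v) * (H + E)) + C * (K * ((1 + u + v) * (H + E))) + 2 * (C * E) + 2 * (C * H).
  by ring.
move: (K * ((1 + u + v) * (H + E))) s3 s4 s5 => q.
move: (C * q) => Cq s3 s4 s5.
have -> : C * (2 * E + 1 / 2 * V2) = 2 * (C * E) + 1 / 2 * (C * V2) by ring.
lra.
Qed.

(** The order of the quantifiers is the point: [C'] is fixed before [U], [V] and [Z], hence serves
    all times of a path at once. *)
Lemma uniform_log_sobolev (a b C K : R) (M : R -> R) :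
  0 < a -> 0 <= b -> 0 <= C -> 0 <= K ->
  exists2 C' : R, 0 < C' & forall U V Z,
    potential_class a b M (fun x => U x + V x) ->
    (forall x, differentiable U x) -> (\int[leb]_x (expR (- U x))%:E = 1)%E ->
    log_sobolev (with_density (wt U)) C ->
    (forall k, Cn k V) -> (forall x, 0 <= V x) ->
    (forall x, V x <= K * (1 + enorm x ^+ 2)) ->
    (forall x, enorm (grad V x) ^+ 2 <= K * (1 + enorm x ^+ 2)) ->
    Z = wint (wt (fun x => U x + V x)) (fun=> 1) ->
    log_sobolev (with_density (fun x => expR (- (U x + V x)) / Z)) C'.
Proof.
move=> a0 b0 C0 K0.
have [CP CP0 poinc] := @weighted_poincare R n a b M a0 b0.
pose A := (K + C * K) * (1 + 2 * (n%:R + b) / a + 4 / a ^+ 2) + 2 * C.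
have A0 : 0 <= A.
  have k1 : 0 <= 2 * (n%:R + b) / a by rewrite divr_ge0 ?mulr_ge0 ?addr_ge0 // ltW.
  have k2 : 0 <= 4 / a ^+ 2 by rewrite divr_ge0 // sqr_ge0.
  apply: addr_ge0; last exact: mulr_ge0.
  by apply: mulr_ge0; rewrite !addr_ge0 // mulr_ge0.
pose D := 25 / 4 * A * (9 / 2 * CP + 9) + 46 * CP + A * (8 * CP + 1).
have D0 : 0 <= D.
  have d1 k l : 0 <= k -> 0 <= l -> 0 <= k * CP + l by move=> *; rewrite addr_ge0 // mulr_ge0.
  rewrite /D !addr_ge0 //; first by apply: mulr_ge0; [apply: mulr_ge0|exact: d1].
    exact: mulr_ge0.
  by apply: mulr_ge0 => //; exact: d1.
(* [D] may be 0, and a log-Sobolev constant has to be positive. *)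
exists (D + 1); first exact: ltr_wpDl.
move=> U V Z WP dU iU lsU Vs V0 VK gVK ZE.
set w := fun x => expR (- (U x + V x)).
have wdom : gauss_dom w := pc_dom WP.
have w0 x : 0 <= w x by exact: expR_ge0.
have Z0 : 0 < Z by rewrite ZE; exact: wint_weight_gt0 WP.
have cV : continuous V by exact: (Vs 0).
have qV : quad_growth V.
  split; first exact: continuous_measurable_cV.
  by exists K => x; rewrite ger0_norm.
have qgV : quad_growth (fun x => enorm (grad V x) ^+ 2).
  split; last by exists K => x; rewrite ger0_norm // sqr_ge0.
  under eq_fun do rewrite sqr_enormE.
  apply: measurable_sum => i; apply: measurable_funX; apply: continuous_measurable_cV.
  under eq_fun do rewrite mxE.
  by have [_] := Vs 1; exact.
(* The weight lies below the normalized density of the prior, since [V] is nonnegative. *)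
have Z1 : Z <= 1.
  rewrite -lee_fin ZE (EFin_wint wdom (quad_growth_cst n 1)) -iU.
  have mU : measurable_fun setT (fun x => expR (- U x)).
    apply: measurableT_comp => //; apply: measurableT_comp => //.
    by apply: continuous_measurable_cV => x; exact: differentiable_continuous.
  apply: ge0_le_integral => //.
  - by move=> x _; rewrite lee_fin; apply: mulr_ge0.
  - by have /measurable_int := wint_integrable wdom (quad_growth_cst n 1).
  - exact/measurable_EFinP.
  - by move=> x _; rewrite lee_fin mul1r ler_expR lerN2 lerDl.
have defect h : test_function h -> wint w (fun x => h x ^+ 2 * ln (h x ^+ 2)) <=
     wint w (fun x => h x ^+ 2) * ln (wint w (fun x => h x ^+ 2)) +
     A * (wint w (fun x => h x ^+ 2) + wint w (fun x => enorm (grad h x) ^+ 2)).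
  move=> ht; have hb := test_bounded_C1 ht; have mh := bC1_measurable hb.
  apply: le_trans (defective_log_sobolev C0 dU iU lsU Vs V0 qV qgV wdom ht
    (erefl w) (erefl _)) _.
  rewrite -addrA lerD2l.
  have h2q := bC1_quad hb; have hxq := bC1_quad_enorm hb.
  have sumq := quad_growthZ K (quad_growthD h2q hxq).
  have [B hB] := bC1_bound hb; have B0 : 0 <= B by exact: le_trans (hB 0).
  have mh2 : measurable_fun setT (fun x => h x ^+ 2) by exact: measurable_funX.
  have h2B x : `|h x ^+ 2| <= B ^+ 2 by rewrite normrX ler_sqr ?nnegrE.
  have bnd g : quad_growth g -> (forall x, g x <= K * (1 + enorm x ^+ 2)) ->
      wint w (fun x => h x ^+ 2 * g x) <= K * (wint w (fun x => h x ^+ 2) +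
        wint w (fun x => h x ^+ 2 * enorm x ^+ 2)).
    move=> gq gK; rewrite -(wintD wdom h2q hxq) -(wintZ wdom K (quad_growthD h2q hxq)).
    apply: (ler_wint wdom w0 (quad_growthMl mh2 h2B gq) sumq) => x.
    apply: le_trans (ler_wpM2l (sqr_ge0 (h x)) (gK x)) _.
    by rewrite mulrCA mulrDr mulr1.
  apply: lyapunov_defect (lyapunov_inequality a0 WP hb) (bnd _ qV VK) (bnd _ qgV gVK) => //.
  - by apply: wint_ge0 => // x; exact: sqr_ge0.
  - by apply: wint_ge0 => // x; exact: sqr_ge0.
apply: (log_sobolev_normalized wdom w0 ZE Z0); first exact: addr_ge0.
move=> f ft f2Z.
have pc h : bounded_C1 h -> let m := wint w h / Z in
    wint w (fun x => (h x - m) ^+ 2) <= CP * wint w (fun x => enorm (grad h x) ^+ 2).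
  by move=> hb; rewrite /= ZE; apply: poinc => //; rewrite -ZE.
apply: le_trans (tight_log_sobolev wdom w0 ft A0 CP0 ZE Z0 Z1 (erefl _) defect pc f2Z) _.
rewrite -/D ler_wpM2r ?lerDl //.
by apply: wint_ge0 => // x; exact: sqr_ge0.
Qed.

End uniform_log_sobolev.

(** * Prior path *)

Section real_lemmas.
Variable R : realType.
Implicit Types (u : R -> R) (I : set R) (s t l e : R).

Lemma has_derivative_withinP I u t l : has_derivative_within I u t l <->
  forall e, 0 < e -> exists2 d, 0 < d & forall s, I s -> s != t -> `|s - t| < d ->
    `|(u s - u t) / (s - t) - l| <= e.
Proof.
split=> [|H].
  move=> /(@cvgrPdist_le R R^o) H e e0.
  have /nbhs_ballP[d d0 hd] : nbhs t (fun s => s != t -> I s ->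
    `|l - (u s - u t) / (s - t)| <= e) by exact: H.
  exists d => // s Is st sd; rewrite distrC; apply: (hd s) => //.
  by rewrite /ball /= distrC.
apply/(@cvgrPdist_le R R^o) => e e0; have [d d0 hd] := H e e0.
suff : nbhs t (fun s => s != t -> I s -> `|l - (u s - u t) / (s - t)| <= e) by [].
apply/nbhs_ballP; exists d => // s sd st Is; rewrite distrC; apply: hd => //.
by move: sd; rewrite /ball /= distrC.
Qed.

Lemma is_derive_within_interior I u t l : nbhs t I -> has_derivative_within I u t l ->
  is_derive t 1 u l.
Proof.
move=> It /has_derivative_withinP H.
have D : (fun h : R => h^-1 *: (u (h *: 1 + t) - u t)) @ (0 : R)^' --> (l : R).
  apply/(@cvgrPdist_le R R^o) => e e0; have [d d0 hd] := H e e0.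
  have /nbhs_ballP[d' d'0 hd'] := It.
  suff : nbhs (0 : R) (fun h : R => h != 0 -> `|l - h^-1 *: (u (h *: 1 + t) - u t)| <= e) by [].
  apply/nbhs_ballP; exists (Num.min d d') => [|h]; first by rewrite /= lt_min d0 d'0.
  rewrite /ball /= sub0r normrN lt_min => /andP[hd1 hd2] h0.
  have ht : h *: 1 + t - t = h by rewrite addrK [h *: 1]mulr1.
  have := hd (h *: 1 + t); rewrite ht distrC mulrC; apply => //.
    by apply: hd'; rewrite /ball /= distrC ht.
  by rewrite -subr_eq0 ht.
have Dc : derivable u t 1 by apply/cvg_ex; exists l.
by apply: DeriveDef => //; exact/cvg_lim.
Qed.

(* Composing with the projection onto [0, 1] turns [u] into a function that is
   continuous at every point of [0, 1], to which the mean value theorem applies. *)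
Lemma ler_dist_derivative_within u (K : R) s t : 0 <= s -> s < t -> t <= 1 ->
  (forall t, 0 <= t <= 1 -> exists2 l, has_derivative_within `[0, 1] u t l & `|l| <= K) ->
  `|u t - u s| <= K * (t - s).
Proof.
move=> s0 st t1 H.
pose clamp r : R := Num.max 0 (Num.min r 1).
have clamp_id r : 0 <= r <= 1 -> clamp r = r.
  by move=> /andP[r0 r1]; rewrite /clamp (min_idPl r1) (max_idPr r0).
have clamp01 r : 0 <= clamp r <= 1.
  by rewrite /clamp le_max lexx ge_max ler01 ge_min lexx orbT.
have clamp_dist r q : 0 <= r <= 1 -> `|clamp q - r| <= `|q - r|.
  move=> /andP[r0 r1]; rewrite /clamp; case: (leP q 1) => q1.
    by case: (leP 0 q) => // q0; rewrite (@ler0_norm _ (0 - r)) ?(@ler0_norm _ (q - r)); lra.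
  by rewrite (max_idPr ler01) !ger0_norm; lra.
pose v r := u (clamp r).
have vc r : 0 <= r <= 1 -> {for r, continuous v}.
  move=> r01; have [l /has_derivative_withinP Hl lK] := H r r01.
  apply/(@cvgrPdist_le R R^o) => e e0.
  have [d d0 hd] := Hl 1 ltr01.
  pose k := `|l| + 1; have k0 : 0 < k by rewrite ltr_wpDl.
  suff : nbhs r (fun q => `|v r - v q| <= e) by [].
  apply/nbhs_ballP; exists (Num.min d (e / k)) => [|q].
    by rewrite /= lt_min d0 divr_gt0.
  rewrite /ball /= lt_min distrC => /andP[qd qe].
  rewrite /v (clamp_id r r01) distrC.
  have [->|cr] := eqVneq (clamp q) r; first by rewrite subrr normr0 ltW.
  have cq := clamp_dist r q r01.
  have := hd (clamp q); rewrite /= in_itv /= => /(_ (clamp01 q) cr (le_lt_trans cq qd)).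
  move=> h; have : `|(u (clamp q) - u r) / (clamp q - r)| <= k.
    rewrite -[X in `|X|](subrK l) addrC; apply: le_trans (ler_normD _ _) _.
    by rewrite lerD2l.
  rewrite normrM normfV ler_pdivrMr ?normr_gt0 ?subr_eq0 // => h2.
  apply: le_trans h2 _; rewrite mulrC -ler_pdivlMr //.
  exact: le_trans cq (ltW qe).
have dv' r : r \in `]s, t[ -> is_derive r 1 v ('D_1 v r) /\ `|'D_1 v r| <= K.
  rewrite in_itv /= => /andP[sr rt].
  have r01 : 0 <= r <= 1 by rewrite (ltW (le_lt_trans s0 sr)) (ltW (lt_le_trans rt t1)).
  have [l Hl lK] := H r r01.
  suff : is_derive r 1 v l by move=> h; rewrite derive_val.
  apply: (@is_derive_within_interior `[0, 1]%classic); last first.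
    apply/has_derivative_withinP => e e0.
    have /has_derivative_withinP/(_ e e0)[d d0 hd] := Hl; exists d => // q q01 qr qd.
    have q01' : 0 <= q <= 1 by move: q01; rewrite /= in_itv.
    by rewrite /v (clamp_id q q01') (clamp_id r r01); exact: hd.
  have : r \in `]0, 1[ by rewrite in_itv /= (le_lt_trans s0 sr) (lt_le_trans rt t1).
  move=> /(@near_in_itvoo R 0 1); apply: filterS => q.
  by rewrite /= !in_itv /= => /andP[/ltW -> /ltW ->].
have dv r : r \in `]s, t[ -> is_derive r 1 v ('D_1 v r) by move=> /dv'[].
have vwc : {within `[s, t], continuous v}.
  apply: continuous_in_subspaceT => r; rewrite inE /= in_itv /= => /andP[sr rt].
  by apply: vc; rewrite (le_trans s0 sr) (le_trans rt t1).
have [r rst] := MVT st dv vwc.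
have s1 := ltW st.
rewrite /v !clamp_id ?s0 ?t1 ?(le_trans s0 s1) ?(le_trans s1 t1) // => ->.
rewrite normrM (ger0_norm (_ : 0 <= t - s)) ?subr_ge0 //.
rewrite ler_wpM2r ?subr_ge0 //.
by have [_] := dv' r rst.
Qed.

End real_lemmas.

(** * Growth of potentials with Lipschitz gradient *)

Section lipschitz_gradient.
Variables (R : realType) (n : nat).
Implicit Types (U : 'cV[R]_n -> R) (x v : 'cV[R]_n).

(** A single use of the mean value theorem, hence [L] where an integral remainder would give
    [L / 2]. *)
Lemma taylor_lipschitz_grad U (L : R) x v : (forall x, differentiable U x) ->
  lipschitz_with (grad U) L ->
  `|U (x + v) - U x - dotp (grad U x) v| <= L * enorm v ^+ 2.
Proof.
move=> dU [L0 LU].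
have der (s : R) : is_derive s 1 (fun s : R => U (x + s *: v)) (dotp (grad U (x + s *: v)) v).
  exact: is_derive_line.
have [s] := MVT ltr01 (fun s _ => der s) (derivable_within_continuous
  (fun s _ => @ex_derive _ _ _ _ _ _ _ (der s))).
rewrite in_itv /= => /andP[s0 s1]; rewrite scale1r scale0r addr0 subr0 mulr1 => ->.
rewrite -dotpBl; apply: le_trans (ler_norm_dotp _ _) _.
rewrite expr2 mulrA ler_wpM2r ?enorm_ge0 //.
apply: le_trans (LU _ _) _; rewrite addrAC subrr add0r enormZ ler_wpM2l //.
by rewrite ler_piMl ?enorm_ge0 // ger0_norm ltW.
Qed.

Lemma quadratic_bound U (L : R) x : (forall x, differentiable U x) ->
  lipschitz_with (grad U) L ->
  `|U x| <= (`|U 0| + enorm (grad U 0) + L) * (1 + enorm x ^+ 2).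
Proof.
move=> dU LU; have := taylor_lipschitz_grad 0 x dU LU; rewrite add0r => h.
have g := ler_norm_dotp (grad U 0) x.
have L0 := LU.1; have u0 := normr_ge0 (U 0).
have g0 := enorm_ge0 (grad U 0); have x0 := enorm_ge0 x.
have x1 : enorm x <= 1 + enorm x ^+ 2 by have := sqr_ge0 (enorm x - 1); nra.
have x2 := sqr_ge0 (enorm x).
have gx : enorm (grad U 0) * enorm x <= enorm (grad U 0) * (1 + enorm x ^+ 2).
  exact: ler_wpM2l.
have ux : 0 <= `|U 0| * enorm x ^+ 2 by exact: mulr_ge0.
have -> : U x = (U x - U 0 - dotp (grad U 0) x) + (U 0 + dotp (grad U 0) x) by ring.
apply: le_trans (ler_normD _ _) _; have := ler_normD (U 0) (dotp (grad U 0) x).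
lra.
Qed.

(** Gives the Gaussian majorant of the weights. Follow the ray towards [x] from the point [s0 *: x]
    where it leaves the ball |z|^2 <= 2 b / a: outside this ball dissipativity makes [U (s *: x) - a
    / 4 * enorm x ^+ 2 * s ^+ 2] nondecreasing in [s], and inside it the growth bound controls
    [U]. *)
Lemma quadratic_lower_bound U (a b K : R) x : 0 < a -> 0 <= b -> 0 <= K ->
  (forall x, differentiable U x) ->
  (forall x, a * enorm x ^+ 2 - b <= dotp x (grad U x)) ->
  (forall x, `|U x| <= K * (1 + enorm x ^+ 2)) ->
  a / 4 * enorm x ^+ 2 - (K * (1 + 2 * b / a) + b / 2) <= U x.
Proof.
move=> a0 b0 K0 dU diss UK.
pose r2 := 2 * b / a; have r20 : 0 <= r2 by rewrite divr_ge0 ?mulr_ge0 // ltW.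
have ar2 : a * r2 = 2 * b by rewrite /r2 mulrC divfK // lt0r_neq0.
have lowU z : enorm z ^+ 2 <= r2 -> - (K * (1 + r2)) <= U z.
  move=> zr; have := UK z; rewrite ler_norml => /andP[h _]; apply: le_trans h.
  by rewrite lerN2 ler_wpM2l // lerD2l.
rewrite -/r2; have [xr|xr] := leP (enorm x ^+ 2) r2.
  apply: le_trans (lowU x xr); have := ler_wpM2l (ltW a0) xr; rewrite ar2; lra.
have x20 : 0 < enorm x ^+ 2 by exact: le_lt_trans xr.
pose s0 := Num.sqrt (r2 / enorm x ^+ 2).
have s02 : s0 ^+ 2 = r2 / enorm x ^+ 2 by rewrite sqr_sqrtr // divr_ge0 // ltW.
have s0_ge0 : 0 <= s0 by exact: sqrtr_ge0.
have s0_lt1 : s0 < 1.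
  by rewrite -(@ltr_pXn2r _ 2) ?nnegrE // s02 expr1n ltr_pdivrMr // mul1r.
pose psi (s : R) := U (0 + s *: x) - a / 4 * enorm x ^+ 2 * s ^+ 2.
pose dpsi (s : R) := dotp (grad U (0 + s *: x)) x - a / 4 * enorm x ^+ 2 * (2 * s).
have der (s : R) : is_derive s 1 psi (dpsi s).
  have d1 : is_derive s 1 (fun s : R => U (0 + s *: x)) (dotp (grad U (0 + s *: x)) x).
    exact: is_derive_line.
  have d2 : is_derive s 1 (fun s : R => s ^+ 2) (2 * s).
    by apply: is_derive_eq; rewrite -[s%:A]/(s * 1) mulr1 mulr_natl.
  have d3 := is_deriveZ (a / 4 * enorm x ^+ 2) d2.
  exact: is_deriveB d1 d3.
have [s] := MVT s0_lt1 (fun s _ => der s) (derivable_within_continuous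
  (fun s _ => @ex_derive _ _ _ _ _ _ _ (der s))).
rewrite in_itv /= => /andP[ss s1].
have sgt0 : 0 < s by exact: le_lt_trans ss.
have dpsi0 : 0 <= dpsi s.
  rewrite -(pmulr_rge0 _ sgt0) mulrBr -dotpZr -[X in dotp _ X]add0r.
  have := diss (0 + s *: x); rewrite dotpC => d.
  have sx : enorm (0 + s *: x) ^+ 2 = s ^+ 2 * enorm x ^+ 2.
    by rewrite add0r enormZ exprMn real_normK ?num_real.
  rewrite sx in d.
  have s2 : r2 <= s ^+ 2 * enorm x ^+ 2.
    by rewrite -ler_pdivrMr // -s02 ler_sqr ?nnegrE // ltW.
  have := ler_wpM2l (ltW a0) s2; rewrite ar2 => s3.
  move: (dotp _ _) d => D d.
  have -> : s * (a / 4 * enorm x ^+ 2 * (2 * s)) = a * (s ^+ 2 * enorm x ^+ 2) / 2.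
    by field.
  lra.
move=> psiE; have : 0 <= psi 1 - psi s0 by rewrite psiE mulr_ge0 // subr_ge0 ltW.
rewrite /psi !add0r scale1r expr1n mulr1 s02 subr_ge0.
have -> : a / 4 * enorm x ^+ 2 * (r2 / enorm x ^+ 2) = b / 2.
  have -> : a / 4 * enorm x ^+ 2 * (r2 / enorm x ^+ 2) = a * r2 / 4.
    by move: (_ ^+ 2) x20 => X X0; field; exact: lt0r_neq0.
  by rewrite ar2; field.
have : - (K * (1 + r2)) <= U (s0 *: x).
  apply: lowU; rewrite enormZ exprMn real_normK ?num_real // s02 divfK //.
  exact: lt0r_neq0.
lra.
Qed.

Lemma ler_addMe (u v N : R) : 0 <= N ->
  (forall e, 0 < e -> e <= 1 -> u <= v + N * e) -> u <= v.
Proof.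
move=> N0 H; apply/ler_addgt0Pr => e e0.
have N1 : 0 < N + 1 by exact: ltr_wpDl.
pose d := Num.min 1 (e / (N + 1)).
have d0 : 0 < d by rewrite lt_min ltr01 divr_gt0.
apply: le_trans (H d d0 _) _; first by rewrite ge_min lexx.
rewrite lerD2l; apply: le_trans (_ : (N + 1) * d <= _).
  by rewrite ler_wpM2r ?lerDl // ltW.
by rewrite mulrC -ler_pdivlMr // ge_min lexx orbT.
Qed.

(** A space step [e] is paired with the time [e ^+ 2]: the time error and the Taylor remainders are
    then both of order [e ^+ 2], and remain of order [e] after dividing the difference quotient by
    [e]. *)
Lemma dissipative_initial_arith (P G D u1 u0 v1 v0 X e L c : R) :
  0 < e -> e <= 1 -> 0 <= c -> 0 <= X -> P <= D ->
  `|v1 - u1| <= c * ((1 + e) ^+ 2 * X + 1) * e ^+ 2 ->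
  `|v0 - u0| <= c * (X + 1) * e ^+ 2 ->
  `|u1 - u0 - e * G| <= L * (e ^+ 2 * X) ->
  `|v1 - v0 - e * D| <= L * (e ^+ 2 * X) ->
  P <= G + (2 * L * X + c * (4 * X + 1) + c * (X + 1)) * e.
Proof.
move=> e0 e1 c0 X0 PD; rewrite !ler_norml => /andP[_ h1] /andP[h2 _] /andP[_ h3] /andP[h4 _].
rewrite -(ler_pM2l e0).
have ee : (1 + e) ^+ 2 * X <= 4 * X by apply: ler_wpM2r => //; nra.
have h5 : c * ((1 + e) ^+ 2 * X + 1) * e ^+ 2 <= c * (4 * X + 1) * e ^+ 2.
  by apply: ler_wpM2r; [exact: sqr_ge0|apply: ler_wpM2l => //; lra].
have h6 := ler_wpM2l (ltW e0) PD.
have -> : e * (G + (2 * L * X + c * (4 * X + 1) + c * (X + 1)) * e) = e * G +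
  2 * (L * (e ^+ 2 * X)) + c * (4 * X + 1) * e ^+ 2 + c * (X + 1) * e ^+ 2 by ring.
lra.
Qed.

(* Gradients need not converge along the path, but their difference quotients
   do, and these approximate the gradients uniformly in time. *)
Lemma dissipative_initial (U : R -> 'cV[R]_n -> R) (a b c L : R) x :
  0 <= c ->
  (forall t, 0 <= t <= 1 -> forall x, differentiable (U t) x) ->
  (forall t, 0 <= t <= 1 -> lipschitz_with (grad (U t)) L) ->
  (forall t x, 0 < t <= 1 -> a * enorm x ^+ 2 - b <= dotp x (grad (U t) x)) ->
  (forall t x, 0 < t <= 1 -> `|U t x - U 0 x| <= c * (enorm x ^+ 2 + 1) * t) ->
  a * enorm x ^+ 2 - b <= dotp x (grad (U 0) x).
Proof.
move=> c0 dU LU diss UU.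
pose N := 2 * L * enorm x ^+ 2 + c * (4 * enorm x ^+ 2 + 1) + c * (enorm x ^+ 2 + 1).
have z01 : (0 : R) <= (0 : R) <= 1 by rewrite lexx /=.
have L0 := (LU 0 z01).1.
have x0 : 0 <= enorm x ^+ 2 by exact: sqr_ge0.
apply: (@ler_addMe _ _ N) => [|e e0 e1].
  have N1 : 0 <= 2 * L * enorm x ^+ 2 by apply: mulr_ge0 => //; exact: mulr_ge0.
  have N2 : 0 <= c * (4 * enorm x ^+ 2 + 1).
    by apply: mulr_ge0 => //; apply: addr_ge0 => //; exact: mulr_ge0.
  have N3 : 0 <= c * (enorm x ^+ 2 + 1) by apply: mulr_ge0 => //; exact: addr_ge0.
  exact: addr_ge0 (addr_ge0 N1 N2) N3.
have e2 : 0 < e ^+ 2 <= 1.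
  by rewrite exprn_gt0 // exprn_ile1 // ltW.
have e2' : 0 <= e ^+ 2 <= 1 by case/andP: e2 => /ltW -> ->.
have xe : x + e *: x = (1 + e) *: x by rewrite scalerDl scale1r.
have := taylor_lipschitz_grad x (e *: x) (dU _ e2') (LU _ e2').
have := taylor_lipschitz_grad x (e *: x) (dU _ z01) (LU _ z01).
have := UU _ (x + e *: x) e2; have := UU _ x e2; have := diss _ x e2.
rewrite xe !enormZ !exprMn !dotpZr !(dotpC _ x) (gtr0_norm e0).
rewrite (gtr0_norm (addr_gt0 ltr01 e0)).
move=> h1 h2 h3 h4 h5.
exact: (dissipative_initial_arith e0 e1 c0 x0 h1 h3 h2 h4 h5).
Qed.

End lipschitz_gradient.

(** * Uniform bounds along the prior path *)

Section prior_bounds.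
Variables (R : realType) (n : nat).
Implicit Types (U V f : 'cV[R]_n -> R) (x v : 'cV[R]_n) (D : set R) (F : R -> R).
Local Notation leb := (@lebesgue_cV R n).

Lemma ereal_sup_lty_ub D F : (ereal_sup [set (F t)%:E | t in D] < +oo)%E ->
  exists B : R, forall t, D t -> F t <= B.
Proof.
have := @ereal_sup_ubound _ [set (F t)%:E | t in D].
case: (ereal_sup _) => [r||] ub // _; [exists r|exists 0] => t Dt.
  by rewrite -lee_fin; apply: ub; exists t.
by have := ub (F t)%:E; rewrite leeNy_eq => /(_ (ex_intro2 _ _ t Dt erefl)).
Qed.

Lemma ereal_inf_gt0_lb D F : (0 < ereal_inf [set (F t)%:E | t in D])%E ->
  exists2 B : R, 0 < B & forall t, D t -> B <= F t.
Proof.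
have := @ereal_inf_lbound _ [set (F t)%:E | t in D].
case: (ereal_inf _) => [r||] lb // r0; [exists r|exists 1] => // t Dt.
  by rewrite -lee_fin; apply: lb; exists t.
by have := lb (F t)%:E; rewrite leye_eq => /(_ (ex_intro2 _ _ t Dt erefl)).
Qed.

Lemma log_sobolevW (p : 'cV[R]_n -> R) (C C' : R) : prob_density p -> C <= C' ->
  log_sobolev (with_density p) C -> log_sobolev (with_density p) C'.
Proof.
move=> [mp p0 p1] CC lsC f ft; apply: le_trans (lsC f ft) _.
apply: lee_wpmul2r; last by rewrite lee_fin.
rewrite integral_with_density ?p1 ?ltry //.
  by apply: integral_ge0 => x _; rewrite lee_fin; apply: mulr_ge0 => //; exact: sqr_ge0.
by apply: measurable_sqr_grad; exact: test_bounded_C1.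
Qed.

(** With a strict inequality there is no need to show that the infimum is attained. *)
Lemma lsi_const_log_sobolev (p : 'cV[R]_n -> R) (C : R) : prob_density p ->
  (lsi_const (with_density p) < C%:E)%E -> log_sobolev (with_density p) C.
Proof.
move=> pp /ereal_inf_lt[_ [c [c0 lsc] <-]]; rewrite lte_fin => /ltW cC.
exact: log_sobolevW lsc.
Qed.

(** What the posterior needs of the prior, with constants independent of time and time 0 included.
    The derivative bound in time is replaced by its Lipschitz form. *)
Record uniform_path (a b c L K C : R) (U : R -> 'cV[R]_n -> R) : Prop := {
  up_c : 0 <= c ; up_K : 0 <= K ;
  up_diff : forall t, 0 <= t <= 1 -> forall x, differentiable (U t) x ;
  up_lip : forall t, 0 <= t <= 1 -> lipschitz_with (grad (U t)) L ;
  up_diss : forall t, 0 <= t <= 1 -> forall x,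
    a * enorm x ^+ 2 - b <= dotp x (grad (U t) x) ;
  up_time : forall s t, 0 <= s <= 1 -> 0 <= t <= 1 -> forall x,
    `|U t x - U s x| <= c * (enorm x ^+ 2 + 1) * `|t - s| ;
  up_bound : forall t, 0 <= t <= 1 -> forall x, `|U t x| <= K * (1 + enorm x ^+ 2) ;
  up_prob : forall t, 0 <= t <= 1 -> (\int[leb]_x (expR (- U t x))%:E = 1)%E ;
  up_lsi : forall t, 0 <= t <= 1 ->
    log_sobolev (with_density (fun x => expR (- U t x))) C }.

Lemma potentialK (p : 'cV[R]_n -> R) : (forall x, 0 < p x) ->
  p = fun x => expR (- potential p x).
Proof. by move=> p0; apply/funext => x; rewrite /potential opprK lnK ?posrE. Qed.

Lemma path_assumption_uniform (p : R -> 'cV[R]_n -> R) :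
  path_assumption `[0, 1]%classic p ->
  exists a b c L K C, [/\ 0 < a, 0 <= b, 0 <= C &
    uniform_path a b c L K C (fun t => potential (p t))].
Proof.
move=> pp; set U := fun t => potential (p t).
have I01 (t : R) : 0 <= t <= 1 -> `[0, 1]%classic t by rewrite /= in_itv.
have pE t : 0 <= t <= 1 -> p t = fun x => expR (- U t x).
  by move=> /I01 t01; exact/potentialK/(path_positive pp t01).
have dU t : 0 <= t <= 1 -> forall x, differentiable (U t) x.
  by move=> /I01 t01 x; exact: (path_differentiable pp t01 x).
have [c c0 timec] := path_time pp.
have UU s t : 0 <= s <= 1 -> 0 <= t <= 1 -> forall x,
    `|U t x - U s x| <= c * (enorm x ^+ 2 + 1) * `|t - s|.
  wlog st : s t / s <= t => [H|] s01 t01 x.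
    have [st|/ltW st] := leP s t; first exact: H.
    by rewrite distrC (distrC t); exact: H.
  have [->|ne] := eqVneq s t; first by rewrite !subrr normr0 mulr0.
  rewrite (ger0_norm (_ : 0 <= t - s)) ?subr_ge0 //.
  case/andP: s01 => s0 _; case/andP: t01 => _ t1.
  apply: (@ler_dist_derivative_within _ (fun t => U t x)) => //.
    by rewrite lt_neqAle ne.
  by move=> r /I01 r01; exact: timec.
have [L' [a' [b' [r' [LU diss [Lsup ainf bsup _]]]]]] := path_constants pp.
have [L1 L1P] := ereal_sup_lty_ub Lsup.
have [a a0 aP] := ereal_inf_gt0_lb ainf.
have [b1 b1P] := ereal_sup_lty_ub bsup.
(* The supremum runs over positive times only, so the constant at time 0 is added. *)
pose L := Num.max L1 (L' 0).
have z01 : (0 : R) <= (0 : R) <= 1 by rewrite lexx /=.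
have LL t : 0 <= t <= 1 -> lipschitz_with (grad (U t)) L.
  move=> t01; have [l0 lU] := LU t (I01 t t01).
  have lL : L' t <= L.
    rewrite /L le_max; have [->|t0] := eqVneq t 0; first by rewrite lexx orbT.
    rewrite L1P //; split; first exact: I01.
    by rewrite /= lt_neqAle eq_sym t0; case/andP: t01.
  split=> [|x x']; first exact: le_trans lL.
  by apply: le_trans (lU x x') _; rewrite ler_wpM2r // enorm_ge0.
pose b := Num.max b1 0; have b0 : 0 <= b by rewrite le_max lexx orbT.
have diss0 t x : 0 < t <= 1 -> a * enorm x ^+ 2 - b <= dotp x (grad (U t) x).
  move=> /andP[t0 t1]; have t01 : 0 <= t <= 1 by rewrite ltW.
  have It : (`[0, 1]%classic `&` [set t | 0 < t]) t by split=> //; exact: I01.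
  have [_ bt0 _ H] := diss t It; apply: le_trans (H x).
  apply: lerB; first by rewrite ler_wpM2r ?sqr_ge0 // aP.
  rewrite indicE; apply: (@le_trans _ _ (b' t)); first by rewrite ler_piMr ?(ltW bt0) // lern1 leq_b1.
  by rewrite le_max b1P.
have dissU t : 0 <= t <= 1 -> forall x, a * enorm x ^+ 2 - b <= dotp x (grad (U t) x).
  move=> t01 x; have [t0|t0] := eqVneq t 0; last first.
    by apply: diss0; rewrite lt_neqAle eq_sym t0.
  rewrite t0; apply: (@dissipative_initial R n U a b c L x (ltW c0) dU LL diss0) => s y s01.
  have s01' : 0 <= s <= 1 by case/andP: s01 => /ltW -> ->.
  by have := UU 0 s z01 s01' y; rewrite subr0 (ger0_norm (_ : 0 <= s)) //; case/andP: s01'.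
(* The quadratic growth of [U 0], plus a drift of at most [c * (1 + enorm x ^+ 2)] over times in the
   unit interval. *)
pose K := `|U 0 0| + enorm (grad (U 0) 0) + L + c.
have K0 : 0 <= K.
  by rewrite /K !addr_ge0 ?enorm_ge0 ?(ltW c0) // (LL 0 z01).1.
have UK t : 0 <= t <= 1 -> forall x, `|U t x| <= K * (1 + enorm x ^+ 2).
  move=> t01 x; have := UU 0 t z01 t01 x; rewrite subr0.
  have := quadratic_bound x (dU 0 z01) (LL 0 z01).
  set Q := `|U 0 0| + _ + L => h1 h2.
  have h3 : c * (enorm x ^+ 2 + 1) * `|t| <= c * (1 + enorm x ^+ 2).
    rewrite addrC ler_piMr //; first by rewrite mulr_ge0 ?(ltW c0) // addr_ge0 ?sqr_ge0.
    by case/andP: t01 => t0 t1; rewrite ger0_norm.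
  have -> : U t x = U 0 x + (U t x - U 0 x) by ring.
  rewrite /K -/Q [leRHS]mulrDl; apply: le_trans (ler_normD _ _) _.
  by apply: lerD => //; exact: le_trans h2 h3.
have prob t : 0 <= t <= 1 -> prob_density (p t) by move=> /I01 t01; exact: (path_density pp t01).
have [C1 C1P] : exists C : R, forall t, 0 <= t <= 1 ->
    (lsi_const (with_density (p t)) < C%:E)%E.
  have := @ereal_sup_ubound _ [set lsi_const (with_density (p t)) | t in `[0, 1]%classic].
  have := path_LSI_bound pp.
  case: (ereal_sup _) => [r||] // _ ub; [exists (r + 1)|exists 0] => t /I01 t01.
    apply: (@le_lt_trans _ _ r%:E); first by apply: ub; exists t.
    by rewrite lte_fin ltrDl.
  apply: (@le_lt_trans _ _ -oo%E); first by apply: ub; exists t.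
  exact: ltNyr.
exists a, b, c, L, K, (Num.max C1 0); split=> //; first by rewrite le_max lexx orbT.
split=> // [|t t01|t t01]; first exact: ltW.
- by have [_ _] := prob t t01; rewrite {1}(pE t t01).
- rewrite -(pE t t01); apply: (@log_sobolevW _ C1); first exact: prob.
    by rewrite le_max lexx.
  apply: lsi_const_log_sobolev; [exact: prob|exact: C1P].
Qed.

End prior_bounds.

(** * Gaussian likelihood *)

Section least_squares.
Variables (R : realType) (m n : nat) (A : 'M[R]_(m, n)) (y : 'cV[R]_m) (s : R).
Implicit Types (x v : 'cV[R]_n).
Hypothesis s0 : 0 < s.

Definition least_squares x : R := enorm (A *m x - y) ^+ 2 / (2 * s ^+ 2).

Lemma Cn_least_squares k : Cn k least_squares.
Proof.
have -> : least_squares = fun x => (2 * s ^+ 2)^-1 *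
    \sum_i (\sum_j A i j * x j 0 + - y i 0) * (\sum_j A i j * x j 0 + - y i 0).
  apply/funext => x; rewrite /least_squares sqr_enormE mulrC; congr (_ * _).
  by apply: eq_bigr => i _; rewrite !mxE expr2.
apply: CnZ; apply: Cn_sum => i.
have h : Cn k (fun x : 'cV[R]_n => \sum_j A i j * x j 0 + - y i 0).
  by apply: CnD; [apply: Cn_sum => j; apply: CnZ; exact: Cn_coord|exact: Cn_cst].
exact: CnM.
Qed.

Lemma least_squares_ge0 x : 0 <= least_squares x.
Proof. by apply: divr_ge0; [exact: sqr_ge0|rewrite mulr_ge0 // sqr_ge0]. Qed.

(** Along a line the function is the quadratic polynomial [q], and the directional derivative is its
    linear coefficient. *)
Lemma grad_least_squares x : grad least_squares x = s ^- 2 *: (A^T *m (A *m x - y)).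
Proof.
have dV z : differentiable least_squares z by case: (Cn_least_squares 1).
apply/colP => i; rewrite -!dotp_delta; move: (delta_mx i 0 : 'cV[R]_n) => v.
rewrite dotpZl dotp_trmx; set r := A *m x - y.
have := @is_derive_line _ _ _ x v 0 (dV (x + 0 *: v)); rewrite scale0r addr0 => d.
pose q (t : R) := least_squares x + (s ^- 2 * dotp r (A *m v)) * t
  + dotp (A *m v) (A *m v) / (2 * s ^+ 2) * (t * t).
have qE : (fun t : R => least_squares (x + t *: v)) = q.
  apply/funext => t; rewrite /q /r /least_squares mulmxDr -scalemxAr addrAC.
  move: (A *m x - y) (A *m v) => u w.
  rewrite !sqr_enorm !dotpDl !dotpDr !dotpZl !dotpZr (dotpC w u).
  by field; exact: lt0r_neq0.
rewrite qE in d.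
have di := is_derive_id (0 : R) (1 : R).
have d1 : is_derive (0 : R) (1 : R) (fun t => s ^- 2 * dotp r (A *m v) * t)
  (s ^- 2 * dotp r (A *m v) * 1) := is_deriveZ _ di.
have d2 : is_derive (0 : R) (1 : R) (fun t => dotp (A *m v) (A *m v) / (2 * s ^+ 2) * (t * t))
  (dotp (A *m v) (A *m v) / (2 * s ^+ 2) * (0 * 1 + 0 * 1)) := is_deriveZ _ (is_deriveM di di).
have dc := is_derive_cst (least_squares x) (0 : R) (1 : R).
have d3 : is_derive (0 : R) 1 q (0 + s ^- 2 * dotp r (A *m v) * 1 +
    dotp (A *m v) (A *m v) / (2 * s ^+ 2) * (0 * 1 + 0 * 1)) :=
  is_deriveD (is_deriveD dc d1) d2.
have := @derive_val _ _ _ _ _ _ _ d; rewrite (@derive_val _ _ _ _ _ _ _ d3) => <-.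
by rewrite !mul0r addr0 mulr0 addr0 add0r mulr1.
Qed.

(** The pairing is |Ax|^2 - <y, Ax> up to the factor [s ^- 2]; completing the square leaves - |y|^2
    / 4. As [A] may have a kernel, [V] need not be dissipative itself, but adding it costs only a
    constant. *)
Lemma dotp_grad_least_squares x :
  - (s ^- 2 * (enorm y ^+ 2 / 4)) <= dotp x (grad least_squares x).
Proof.
rewrite grad_least_squares dotpZr -mulrN; apply: ler_wpM2l.
  by rewrite invr_ge0 sqr_ge0.
rewrite dotpC dotp_trmx dotpBl -sqr_enorm.
have := ler_dotp y (A *m x).
move: (dotp y (A *m x)) (enorm y) (enorm (A *m x)) => w p q wpq.
have := sqr_ge0 (p / 2 - q); have -> : (p / 2 - q) ^+ 2 = p ^+ 2 / 4 - p * q + q ^+ 2 by field.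
lra.
Qed.

Lemma lipschitz_grad_least_squares :
  lipschitz_with (grad least_squares) (s ^- 2 * spectral_norm (A^T *m A)).
Proof.
have s2 : 0 <= s ^- 2 by rewrite invr_ge0 sqr_ge0.
split=> [|x x']; first by apply: mulr_ge0 => //; exact: spectral_norm_ge0.
rewrite !grad_least_squares -scalerBr -mulmxBr opprB addrA subrK -mulmxBr mulmxA.
by rewrite enormZ ger0_norm // -mulrA ler_wpM2l // enorm_mulmx.
Qed.

Lemma least_squares_growth : exists2 K : R, 0 <= K & forall x,
  least_squares x <= K * (1 + enorm x ^+ 2) /\
  enorm (grad least_squares x) ^+ 2 <= K * (1 + enorm x ^+ 2).
Proof.
pose N := 2 * (spectral_norm A ^+ 2 + enorm y ^+ 2).
have N0 : 0 <= N by apply: mulr_ge0 => //; apply: addr_ge0; exact: sqr_ge0.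
have rN x : enorm (A *m x - y) ^+ 2 <= N * (1 + enorm x ^+ 2).
  apply: le_trans (ler_enorm_add2 _ _) _; rewrite enormN.
  have : enorm (A *m x) ^+ 2 <= spectral_norm A ^+ 2 * enorm x ^+ 2.
    rewrite -exprMn ler_sqr ?nnegrE ?enorm_ge0 ?mulr_ge0 ?enorm_ge0 ?spectral_norm_ge0 //.
    exact: enorm_mulmx.
  have := sqr_ge0 (spectral_norm A).
  have := mulr_ge0 (sqr_ge0 (enorm y)) (sqr_ge0 (enorm x)).
  rewrite /N; lra.
pose k1 := (2 * s ^+ 2)^-1; pose k2 := (s ^- 2 * spectral_norm A^T) ^+ 2.
have k10 : 0 <= k1 by rewrite invr_ge0 mulr_ge0 // sqr_ge0.
have k20 : 0 <= k2 by exact: sqr_ge0.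
exists ((k1 + k2) * N) => [|x]; first by apply: mulr_ge0 => //; exact: addr_ge0.
have NX : 0 <= N * (1 + enorm x ^+ 2).
  by apply: mulr_ge0 => //; apply: addr_ge0 => //; exact: sqr_ge0.
have h1 := ler_wpM2l k10 (rN x); have h2 := ler_wpM2l k20 (rN x).
have m1 := mulr_ge0 k10 NX; have m2 := mulr_ge0 k20 NX.
split; rewrite -mulrA mulrDl.
  by rewrite /least_squares mulrC -/k1; lra.
apply: (@le_trans _ _ (k2 * enorm (A *m x - y) ^+ 2)); last by lra.
rewrite grad_least_squares /k2 -exprMn.
rewrite ler_sqr ?nnegrE ?enorm_ge0 //; last first.
  by rewrite !mulr_ge0 ?enorm_ge0 ?spectral_norm_ge0 // invr_ge0 sqr_ge0.
have s2 : 0 <= s ^- 2 by rewrite invr_ge0 sqr_ge0.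
by rewrite enormZ ger0_norm // -mulrA ler_wpM2l // enorm_mulmx.
Qed.

End least_squares.

(** * Posterior path *)

Section derivative_within.
Variables (R : realType) (I : set R).
Implicit Types (u v g : R -> R) (t l : R).

Lemma eq_has_derivative_within u v t l : I t -> (forall s, I s -> u s = v s) ->
  has_derivative_within I u t l -> has_derivative_within I v t l.
Proof.
move=> It uv /has_derivative_withinP H; apply/has_derivative_withinP => e e0.
by have [d d0 hd] := H e e0; exists d => // s Is st sd; rewrite -!uv //; exact: hd.
Qed.

Lemma has_derivative_withinD u v t l m : has_derivative_within I u t l ->
  has_derivative_within I v t m -> has_derivative_within I (fun s => u s + v s) t (l + m).
Proof.
move=> hu hv; rewrite /has_derivative_within.
under eq_fun do rewrite opprD addrACA mulrDl.
exact: cvgD.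
Qed.

Lemma has_derivative_within_cst (c : R) t : has_derivative_within I (fun=> c) t 0.
Proof.
rewrite /has_derivative_within; under eq_fun do rewrite subrr mul0r.
exact: cvg_cst.
Qed.

Lemma has_derivative_within_cvg u t l : has_derivative_within I u t l ->
  u s @[s --> within I t^'] --> u t.
Proof.
move=> hu.
have idt : (s - t) @[s --> within I t^'] --> (0 : R).
  apply/(@cvgrPdist_le R R^o) => e e0.
  suff : nbhs t (fun s => s != t -> I s -> `|0 - (s - t)| <= e) by [].
  by apply/nbhs_ballP; exists e => // s; rewrite /ball /= sub0r opprB => /ltW.
have FI : Filter (within I t^') by exact: within_filter.
have := cvgD (cvg_cst (u t)) (cvgM hu idt); rewrite mulr0 addr0 => /(_ FI FI FI) h.
apply: (cvg_trans _ h).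
apply: near_eq_cvg; suff : nbhs t (fun s => s != t -> I s ->
    u t + (u s - u t) / (s - t) * (s - t) = u s) by [].
apply: filterE => s st _; rewrite divfK ?subr_eq0 //; ring.
Qed.

Lemma has_derivative_within_comp u g t l (g' : R) : has_derivative_within I u t l ->
  is_derive (u t) 1 g g' -> has_derivative_within I (g \o u) t (g' * l).
Proof.
move=> hu dg.
(* Caratheodory's slope function, continuous at [u t]; it avoids dividing by [u s - u t], which may
   vanish for [s] different from [t]. *)
pose phi y := if y == u t then g' else (g y - g (u t)) / (y - u t).
have cphi : phi y @[y --> u t] --> phi (u t).
  have : has_derivative_within setT g (u t) g'.
    have D : (fun h : R => h^-1 *: (g (h *: 1 + u t) - g (u t))) @ (0 : R)^' --> (g' : R).
      by rewrite -(@derive_val _ _ _ _ _ _ _ dg); exact: (@ex_derive _ _ _ _ _ _ _ dg).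
    apply/has_derivative_withinP => e e0.
    have /nbhs_ballP[d d0 hd] : nbhs (0 : R) (fun h : R => h != 0 ->
      `|g' - h^-1 *: (g (h *: 1 + u t) - g (u t))| <= e).
      by move/(@cvgrPdist_le R R^o): D => /(_ e e0).
    exists d => // s _ st sd; rewrite distrC.
    have := hd (s - u t); rewrite /ball /= sub0r normrN subr_eq0 => /(_ sd st).
    by rewrite [_ *: 1]mulr1 subrK mulrC.
  move=> /has_derivative_withinP H; apply/(@cvgrPdist_le R R^o) => e e0.
  have [d d0 hd] := H e e0; apply/nbhs_ballP; exists d => // y; rewrite /ball /= => yd.
  rewrite /phi eqxx; case: ifPn => yu; first by rewrite subrr normr0 ltW.
  by rewrite distrC; apply: hd => //; rewrite distrC.
have FI : Filter (within I t^') by exact: within_filter.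
have := cvgM (cvg_comp _ _ (has_derivative_within_cvg hu) cphi) hu.
rewrite {2}/phi eqxx => /(_ FI) h; apply: (cvg_trans _ h); apply: near_eq_cvg.
suff : nbhs t (fun s => s != t -> I s -> phi (u s) * ((u s - u t) / (s - t)) =
  (g (u s) - g (u t)) / (s - t)) by [].
apply: filterE => s st _; rewrite /phi; case: eqVneq => [->|us]; first by rewrite !subrr !mul0r mulr0.
by rewrite mulrA divfK // subr_eq0.
Qed.

End derivative_within.

Section sequential_derivative.
Variable R : realType.
Implicit Types (I : set R) (u : R -> R) (s : nat -> R).

Lemma has_derivative_within_seq I u (t l : R) s : has_derivative_within I u t l ->
  (forall k, I (s k) /\ s k != t) -> (s @ \oo --> t)%classic ->
  ((fun k => (u (s k) - u t) / (s k - t)) @ \oo --> l)%classic.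
Proof.
move=> /has_derivative_withinP H Is /(@cvgrPdist_lt R R^o) st.
apply/(@cvgrPdist_le R R^o) => e e0; have [d d0 hd] := H e e0.
apply: filterS (st d d0) => k kd; have [Ik kt] := Is k.
by rewrite distrC; apply: hd => //; rewrite distrC.
Qed.

(** Dominated convergence is about sequences, so derivatives in time are tested along sequences of
    times. If the limit fails, times within [k.+1%:R^-1] of [t] form a sequence that contradicts the
    hypothesis. *)
Lemma seq_has_derivative_within I u (t l : R) :
  (forall s, (forall k, I (s k) /\ s k != t) -> (s @ \oo --> t)%classic ->
    ((fun k => (u (s k) - u t) / (s k - t)) @ \oo --> l)%classic) ->
  has_derivative_within I u t l.
Proof.
move=> H; apply/has_derivative_withinP => e e0; apply: contrapT => nd.
have bad (k : nat) : exists r : R, [/\ I r, r != t, `|r - t| < k.+1%:R^-1 &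
    e < `|(u r - u t) / (r - t) - l|].
  apply: contrapT => ns; apply: nd; exists k.+1%:R^-1; first by rewrite invr_gt0.
  by move=> r Ir rt rk; rewrite leNgt; apply/negP => er; apply: ns; exists r.
have [s sP] := choice bad.
have st : (s @ \oo --> t)%classic.
  apply/(@cvgrPdist_le R R^o) => d d0.
  have /(@cvgrPdist_le R R^o)/(_ d d0) := @cvg_harmonic R.
  apply: filterS => k; rewrite sub0r normrN /= ger0_norm ?invr_ge0 // => kd.
  by have [_ _ sk _] := sP k; rewrite distrC; exact: le_trans (ltW sk) kd.
have := H s (fun k => let: And4 a b _ _ := sP k in conj a b) st.
move=> /(@cvgrPdist_le R R^o)/(_ e e0)[N _ HN].
have := HN N (leqnn N); rewrite distrC leNgt.
by have [_ _ _ ->] := sP N.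
Qed.

Lemma approaching_seq (t : R) : 0 <= t <= 1 -> exists s : nat -> R,
  (forall k, (0 <= s k <= 1) /\ s k != t) /\ (s @ \oo --> t)%classic.
Proof.
(* An end point of the unit interval different from [t]; the sequence approaches [t] from its
   side. *)
move=> /andP[t0 t1]; pose e : R := if t < 2^-1 then 1 else 0.
have e01 : 0 <= e <= 1 by rewrite /e; case: ifP => _; rewrite ?lexx ?ler01.
have et : e - t != 0.
  rewrite subr_eq0 /e; case: ltP => h; apply/eqP => E; move: h; rewrite -E; lra.
exists (fun k => t + (e - t) * k.+1%:R^-1); split=> [k|].
  have k0 : 0 < k.+1%:R^-1 :> R by rewrite invr_gt0.
  have k1 : k.+1%:R^-1 <= 1 :> R by rewrite invf_le1 // ler1n.
  split; last by rewrite -subr_eq0 addrAC subrr add0r mulf_neq0 // lt0r_neq0.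
  move: (_^-1) k0 k1 e01 => q k0 k1 /andP[e0 e1]; apply/andP; split; nra.
have := cvgD (cvg_cst t) (cvgM (cvg_cst (e - t)) (@cvg_harmonic R)).
by rewrite mulr0 addr0; apply.
Qed.

Lemma ler_dist_expRN (p q B : R) : expR (- p) <= B -> expR (- q) <= B ->
  `|expR (- p) - expR (- q)| <= `|p - q| * B.
Proof.
wlog pq : p q / p <= q => [H pB qB|pB _].
  have [pq|/ltW pq] := leP p q; first exact: H.
  by rewrite distrC (distrC p); exact: H.
rewrite ger0_norm ?subr_ge0 ?ler_expR ?lerN2 // distrC ger0_norm ?subr_ge0 //.
have -> : - q = - p + - (q - p) by ring.
rewrite expRD -{1}[expR (- p)]mulr1 -mulrBr mulrC.
have := expR_ge1Dx (- (q - p)) => h1.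
have h2 : 1 - expR (- (q - p)) <= q - p by lra.
apply: le_trans (ler_wpM2r (expR_ge0 (- p)) h2) _.
by apply: ler_wpM2l => //; rewrite subr_ge0.
Qed.

End sequential_derivative.

(** * Differentiation of the partition function *)

Section partition_function.
Variables (R : realType) (n : nat).
Implicit Types (f g : 'cV[R]_n -> R) (x : 'cV[R]_n).
Local Notation leb := (@lebesgue_cV R n).

Lemma measurable_differentiable f : (forall x, differentiable f x) ->
  measurable_fun setT f.
Proof.
by move=> df; apply: continuous_measurable_cV => x; exact: differentiable_continuous.
Qed.

(** The growth is a hypothesis; the content is that [l] is measurable, as a pointwise limit of
    difference quotients along a sequence of times. *)
Lemma derivative_quad_growth (W : R -> 'cV[R]_n -> R) (l : 'cV[R]_n -> R) (c t : R) :
  0 <= t <= 1 ->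
  (forall t, 0 <= t <= 1 -> forall x, differentiable (W t) x) ->
  (forall x, has_derivative_within `[0, 1]%classic (fun s => W s x) t (l x)) ->
  (forall x, `|l x| <= c * (enorm x ^+ 2 + 1)) -> quad_growth l.
Proof.
move=> t01 dW Wl lc; split; last by exists c => x; rewrite addrC.
have [s [s01 st]] := approaching_seq t01.
apply: (@measurable_fun_cvg _ _ _ _ (fun k x => (W (s k) x - W t x) / (s k - t))).
  move=> k; apply: measurable_funM => //; apply: measurable_funB.
    by apply: measurable_differentiable; apply: dW; case: (s01 k).
  by apply: measurable_differentiable; exact: dW.
move=> x _; apply: has_derivative_within_seq (Wl x) _ st => k.
by rewrite /= in_itv /=; exact: s01.
Qed.

(** The difference quotients of the weight are at most [c * (enorm x ^+ 2 + 1) * g x], by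
    [ler_dist_expRN] and the Lipschitz bound in time. *)
Lemma derivative_partition_function (W : R -> 'cV[R]_n -> R) (l g : 'cV[R]_n -> R)
    (c c' t : R) : 0 <= t <= 1 -> 0 <= c ->
  (forall t, 0 <= t <= 1 -> forall x, differentiable (W t) x) ->
  (forall s t, 0 <= s <= 1 -> 0 <= t <= 1 -> forall x,
    `|W t x - W s x| <= c * (enorm x ^+ 2 + 1) * `|t - s|) ->
  gauss_dom g -> (forall t x, 0 <= t <= 1 -> expR (- W t x) <= g x) ->
  (forall x, has_derivative_within `[0, 1]%classic (fun s => W s x) t (l x)) ->
  (forall x, `|l x| <= c' * (enorm x ^+ 2 + 1)) ->
  has_derivative_within `[0, 1]%classic
    (fun s => wint (fun x => expR (- W s x)) (fun=> 1)) t
    (wint (fun x => expR (- W t x)) (fun x => - l x)).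
Proof.
move=> t01 c0 dW WW gdom Wg Wl lc.
have mw s : 0 <= s <= 1 -> measurable_fun setT (fun x => expR (- W s x)).
  move=> s01; apply: measurableT_comp => //; apply: measurableT_comp => //.
  by apply: measurable_differentiable; exact: dW.
have wdom s : 0 <= s <= 1 -> gauss_dom (fun x => expR (- W s x)).
  move=> s01; apply: gauss_domW (mw s s01) gdom _ => x.
  rewrite !ger0_norm ?expR_ge0 ?Wg //; exact: le_trans (expR_ge0 _) (Wg t x t01).
have lq := derivative_quad_growth t01 dW Wl lc.
apply: seq_has_derivative_within => s s01' st.
have s01 k : 0 <= s k <= 1 by have [] := s01' k; rewrite /= in_itv.
pose F k x := (expR (- W (s k) x) - expR (- W t x)) / (s k - t).
have cq : quad_growth (fun x => c * (enorm x ^+ 2 + 1)).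
  apply: quad_growthZ; apply: quad_growthD; last exact: quad_growth_cst.
  exact: quad_growth_sqr_enorm.
have Gi := gauss_dom_integrable (gauss_domM cq gdom).
have FE k : \int[leb]_x F k x = (wint (fun x => expR (- W (s k) x)) (fun=> 1) -
    wint (fun x => expR (- W t x)) (fun=> 1)) / (s k - t).
  have i1 := wint_integrable (wdom _ (s01 k)) (quad_growth_cst n 1).
  have i2 := wint_integrable (wdom _ t01) (quad_growth_cst n 1).
  rewrite /wint -RintegralB // mulrC -RintegralZl //; last exact: (integrableB measurableT i1 i2).
  by apply: eq_Rintegral => x _; rewrite /F !mul1r mulrC.
suff cvF : ((fun k => \int[leb]_x F k x) @ \oo -->
    wint (fun x => expR (- W t x)) (fun x => - l x))%classic.
  by move: cvF; rewrite (funext FE).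
apply: (@dominated_Rintegral R n F (fun x => - l x * expR (- W t x)) _ _ _ _ Gi).
- move=> k; apply: measurable_funM => //; apply: measurable_funB; apply: mw => //.
- by apply: measurable_funM; [apply: measurableT_comp => //; case: lq|exact: mw].
- move=> x; apply: (has_derivative_within_seq _ s01' st (u := fun s => expR (- W s x))).
  rewrite mulNr -mulrN mulrC.
  apply: (@has_derivative_within_comp _ _ (fun s => W s x) (fun r => expR (- r))) (Wl x) _.
  have di := is_derive_id (W t x : R) (1 : R).
  have d1 : is_derive (W t x) (1 : R) (fun r : R => - r) (- 1) := is_deriveN di.
  have d2 := is_derive1_comp (is_derive_expR (- W t x)) d1.
  have : is_derive (W t x) 1 (fun r : R => expR (- r)) (expR (- W t x) * - 1) := d2.
  by rewrite mulrN1.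
- move=> k x; rewrite /F normrM normfV.
  have [_ skt] := s01' k.
  rewrite ler_pdivrMr ?normr_gt0 ?subr_eq0 //.
  apply: le_trans (ler_dist_expRN (Wg _ x (s01 k)) (Wg _ x t01)) _.
  rewrite mulrAC; apply: ler_wpM2r; first exact: le_trans (expR_ge0 _) (Wg t x t01).
  exact: WW.
Qed.

End partition_function.

Section posterior_weight.
Variables (R : realType) (n : nat).
Implicit Types (U V f g : 'cV[R]_n -> R) (x : 'cV[R]_n).
Local Notation leb := (@lebesgue_cV R n).
Local Notation wt W := (fun x => expR (- W x)).

Lemma gradD U V x : differentiable U x -> differentiable V x ->
  grad (fun x => U x + V x) x = grad U x + grad V x.
Proof.
move=> dU dV; apply/colP => i; rewrite !mxE (@deriveD _ _ _ U V) //;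
  exact: diff_derivable.
Qed.

Lemma gradDcst U (c : R) x : differentiable U x ->
  grad (fun x => U x + c) x = grad U x.
Proof.
move=> dU; rewrite (_ : (fun x => _) = (fun x => U x - - c)); last first.
  by apply/funext => z; rewrite opprK.
exact: grad_subcst.
Qed.

Lemma lipschitz_withD (F G : 'cV[R]_n -> 'cV[R]_n) (L M : R) : lipschitz_with F L ->
  lipschitz_with G M -> lipschitz_with (fun x => F x + G x) (L + M).
Proof.
move=> [L0 FL] [M0 GM]; split=> [|x x']; first exact: addr_ge0.
rewrite opprD addrACA; apply: le_trans (ler_enormD _ _) _.
by rewrite mulrDl lerD.
Qed.

Lemma bounded_C1_cst (c : R) : bounded_C1 (fun _ : 'cV[R]_n => c).
Proof.
have D0 v x : 'D_v (fun _ : 'cV[R]_n => c) x = 0 by exact: derive_cst.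
split=> [x|i||]; first exact: differentiable_cst.
- by have [_ h] := @Cn_cst R n 1 c; exact: h.
- by exists `|c|.
exists 0 => x; rewrite (_ : grad _ x = 0) ?enorm0 //.
by apply/colP => i; rewrite !mxE D0.
Qed.

(* The Lyapunov inequality for a constant function. *)
Lemma moment_le (a b : R) (M : R -> R) W : 0 < a -> potential_class a b M W ->
  wint (wt W) (fun x => enorm x ^+ 2 + 1) <=
  (1 + 2 / a * (n%:R + b)) * wint (wt W) (fun=> 1).
Proof.
move=> a0 WP; have wdom := pc_dom WP; have cb := bounded_C1_cst 1.
have := lyapunov_inequality a0 WP cb.
have -> : wint (wt W) (fun x => 1 ^+ 2 * enorm x ^+ 2) =
    wint (wt W) (fun x => enorm x ^+ 2) by apply: eq_wint => x; rewrite expr1n mul1r.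
have -> : wint (wt W) (fun x => 1 ^+ 2) = wint (wt W) (fun=> 1).
  by apply: eq_wint => x; rewrite expr1n.
have -> : wint (wt W) (fun x => enorm (grad (fun=> 1) x) ^+ 2) = 0 * wint (wt W) (fun=> 1).
  rewrite -(wintZ wdom _ (quad_growth_cst n 1)); apply: eq_wint => x.
  rewrite (_ : grad _ x = 0) ?enorm0 ?expr0n ?mul0r //.
  by apply/colP => i; rewrite !mxE derive_cst.
rewrite mul0r mulr0 addr0 (wintD wdom (@quad_growth_sqr_enorm R n) (quad_growth_cst n 1)).
move: (wint _ (fun x => enorm x ^+ 2)) (wint _ (fun=> 1)) => J Z h.
rewrite mulrDl mul1r addrC lerD2l.
have a2 : 0 <= 2 / a by rewrite divr_ge0 // ltW.
have := ler_wpM2l a2 h.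
have -> : 2 / a * (a / 2 * J) = J by field; exact: lt0r_neq0.
by rewrite mulrA.
Qed.

End posterior_weight.

(** * Uniform bounds for the posterior potential *)

Section posterior_path.
Variables (R : realType) (n : nat) (a b c L K C : R) (U : R -> 'cV[R]_n -> R).
Variables (V : 'cV[R]_n -> R) (B LV KV : R).
Hypotheses (a0 : 0 < a) (b0 : 0 <= b).
Hypothesis up : uniform_path a b c L K C U.
Hypotheses (V_smooth : forall k, Cn k V) (V_ge0 : forall x, 0 <= V x).
Hypothesis (V_diss : forall x, - B <= dotp x (grad V x)).
Hypothesis V_lip : lipschitz_with (grad V) LV.
Hypotheses (KV0 : 0 <= KV) (V_growth : forall x, V x <= KV * (1 + enorm x ^+ 2)).
Local Notation leb := (@lebesgue_cV R n).
Local Notation W := (fun t x => U t x + V x).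
Local Notation w := (fun t x => expR (- W t x)).
Local Notation M := (fun rho : R => (K + KV) * (1 + rho)).

Let dV x : differentiable V x. Proof. by case: (V_smooth 1). Qed.

Let dW t : 0 <= t <= 1 -> forall x, differentiable (W t) x.
Proof.
by move=> t01 x; apply: (@differentiableD _ _ _ (U t) V) => //; exact: (up_diff up).
Qed.

Definition gaussian_majorant (x : 'cV[R]_n) : R :=
  expR (K * (1 + 2 * b / a) + b / 2) * expR (- (a / 4 * enorm x ^+ 2)).

Lemma weight_le t x : 0 <= t <= 1 -> w t x <= gaussian_majorant x.
Proof.
move=> t01; rewrite /gaussian_majorant -expRD ler_expR.
have := quadratic_lower_bound x a0 b0 (up_K up) (up_diff up t01) (up_diss up t01)
  (up_bound up t01).
by have := V_ge0 x; lra.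
Qed.

Lemma gauss_dom_majorant : gauss_dom gaussian_majorant.
Proof.
split; first by apply: measurable_funM => //; exact: measurable_gauss.
exists (expR (K * (1 + 2 * b / a) + b / 2)), (a / 4); split; first exact: divr_gt0.
by move=> x; rewrite ger0_norm // mulr_ge0 ?expR_ge0.
Qed.

Lemma gauss_dom_weight t : 0 <= t <= 1 -> gauss_dom (w t).
Proof.
move=> t01; apply: gauss_domW gauss_dom_majorant _ => [|x].
  apply: measurableT_comp => //; apply: measurableT_comp => //.
  by apply: measurable_differentiable; exact: dW.
rewrite !ger0_norm ?expR_ge0 //; first exact: weight_le.
by rewrite mulr_ge0 ?expR_ge0.
Qed.

Lemma posterior_grad t x : 0 <= t <= 1 -> grad (W t) x = grad (U t) x + grad V x.
Proof. by move=> t01; apply: gradD => //; exact: (up_diff up). Qed.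

Lemma posterior_dissipative t x : 0 <= t <= 1 ->
  a * enorm x ^+ 2 - (b + B) <= dotp x (grad (W t) x).
Proof.
move=> t01; rewrite posterior_grad // dotpDr opprD addrA.
by apply: lerD; [exact: (up_diss up)|exact: V_diss].
Qed.

(** Stated for every Lipschitz constant [L'] of the prior gradient at time [t], because the
    comparison of [lip_const] runs over all of them. *)
Lemma posterior_lipschitz t L' : 0 <= t <= 1 -> lipschitz_with (grad (U t)) L' ->
  lipschitz_with (grad (W t)) (L' + LV).
Proof.
move=> t01 lU; rewrite (_ : grad (W t) = fun x => grad (U t) x + grad V x).
  exact: lipschitz_withD.
by apply/funext => x; exact: posterior_grad.
Qed.

Lemma posterior_class t : 0 <= t <= 1 -> potential_class a (b + B) M (W t).
Proof.
move=> t01; split.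
- exact: dW.
- by exists (L + LV); apply: posterior_lipschitz => //; exact: (up_lip up).
- by move=> x; exact: posterior_dissipative.
- exact: gauss_dom_weight.
- move=> rho x xr; apply: le_trans (ler_normD _ _) _.
  apply: (@le_trans _ _ ((K + KV) * (1 + enorm x ^+ 2))).
    by rewrite mulrDl lerD ?(up_bound up) // ger0_norm.
  by rewrite ler_wpM2l ?addr_ge0 ?(up_K up) // lerD2l.
Qed.

Lemma partition_function_gt0 t : 0 <= t <= 1 -> 0 < wint (w t) (fun=> 1).
Proof. move=> t01; exact: wint_weight_gt0 (posterior_class t01). Qed.

(* [l] is bounded by the second moment, which [moment_le] compares with the
   partition function itself; no lower bound on the latter is needed. *)
Lemma log_partition_derivative t l (c' : R) : 0 <= t <= 1 -> 0 <= c' ->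
  (forall x, has_derivative_within `[0, 1]%classic (fun s => U s x) t (l x)) ->
  (forall x, `|l x| <= c' * (enorm x ^+ 2 + 1)) ->
  exists2 k, has_derivative_within `[0, 1]%classic
      (fun s => ln (wint (w s) (fun=> 1))) t k &
    `|k| <= c' * (1 + 2 / a * (n%:R + (b + B))).
Proof.
move=> t01 c'0 Ul lc; have Z0 := partition_function_gt0 t01.
have Wl x : has_derivative_within `[0, 1]%classic (fun s => W s x) t (l x).
  by have := has_derivative_withinD (Ul x) (has_derivative_within_cst _ (V x) t);
     rewrite addr0.
have WW s r : 0 <= s <= 1 -> 0 <= r <= 1 -> forall x,
    `|W r x - W s x| <= c * (enorm x ^+ 2 + 1) * `|r - s|.
  by move=> s01 r01 x; rewrite opprD addrACA subrr addr0; exact: (up_time up).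
have dZ := derivative_partition_function t01 (up_c up) dW WW gauss_dom_majorant
  (fun s x => @weight_le s x) Wl lc.
have := has_derivative_within_comp dZ (is_derive1_ln Z0); set k := _ * _ => dlnZ.
exists k => //; rewrite /k normrM normfV (gtr0_norm Z0) mulrC ler_pdivrMr //.
have wdom := gauss_dom_weight t01.
have lq := derivative_quad_growth t01 (up_diff up) Ul lc.
have mq := quad_growthD (@quad_growth_sqr_enorm R n) (quad_growth_cst n 1).
have wc : wint (w t) (fun x => c' * (enorm x ^+ 2 + 1)) <=
    c' * (1 + 2 / a * (n%:R + (b + B))) * wint (w t) (fun=> 1).
  rewrite (wintZ wdom _ mq) -mulrA; apply: ler_wpM2l => //.
  exact: moment_le a0 (posterior_class t01).
have w0 x : 0 <= w t x by exact: expR_ge0.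
have nlq : quad_growth (fun x => - l x).
  by have := quad_growthZ (-1) lq; under eq_fun do rewrite mulN1r.
rewrite ler_norml; apply/andP; split; last first.
  apply: le_trans wc; apply: (ler_wint wdom w0 nlq (quad_growthZ _ mq)) => x.
  by apply: le_trans (lc x); rewrite -normrN ler_norm.
rewrite lerNl; apply: le_trans wc.
have -> : - wint (w t) (fun x => - l x) = wint (w t) l.
  have -> : wint (w t) (fun x => - l x) = -1 * wint (w t) l.
    by rewrite -(wintZ wdom _ lq); apply: eq_wint => x; rewrite mulN1r.
  by rewrite mulN1r opprK.
apply: (ler_wint wdom w0 lq (quad_growthZ _ mq)) => x.
exact: le_trans (ler_norm _) (lc x).
Qed.

End posterior_path.

Section posterior_density.
Variables (R : realType) (n : nat).
Implicit Types (U V W : 'cV[R]_n -> R) (x : 'cV[R]_n) (D : set R).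
Local Notation leb := (@lebesgue_cV R n).
Local Notation wt W := (fun x => expR (- W x)).

Lemma posterior_gibbs (k : R) U V : 0 < k -> gauss_dom (wt (fun x => U x + V x)) ->
  posterior (fun x => k * expR (- V x)) (wt U) =
  fun x => expR (- (U x + V x)) / wint (wt (fun x => U x + V x)) (fun=> 1).
Proof.
move=> k0 wdom; apply/funext => x; rewrite /posterior.
have E z : k * expR (- V z) * expR (- U z) = k * expR (- (U z + V z)).
  by rewrite -mulrA -expRD opprD addrC.
under eq_integral do rewrite E.
rewrite -(EFin_wint wdom (quad_growth_cst n k)) /= E.
have -> : wint (wt (fun x => U x + V x)) (fun=> k) =
    k * wint (wt (fun x => U x + V x)) (fun=> 1).
  rewrite -(wintZ wdom _ (quad_growth_cst n 1)).
  by apply: eq_wint => z; rewrite mulr1.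
by rewrite -mulf_div divff ?mul1r // lt0r_neq0.
Qed.

Lemma potential_gibbs W (Z : R) : 0 < Z ->
  potential (fun x => expR (- W x) / Z) = fun x => W x + ln Z.
Proof.
move=> Z0; apply/funext => x; rewrite /potential lnM ?posrE ?expR_gt0 ?invr_gt0 //.
by rewrite lnV ?posrE // expRK opprD !opprK.
Qed.

Lemma prob_density_gibbs W : gauss_dom (wt W) -> 0 < wint (wt W) (fun=> 1) ->
  prob_density (fun x => expR (- W x) / wint (wt W) (fun=> 1)).
Proof.
move=> wdom Z0; have [mw _] := wdom; split.
- exact: measurable_funM.
- by move=> x; apply: divr_ge0 => //; exact: ltW.
have := EFin_wint wdom (quad_growth_cst n (wint (wt W) (fun=> 1))^-1).
under eq_integral do rewrite mulrC.
move=> <-; congr (_%:E).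
have -> : wint (wt W) (fun=> (wint (wt W) (fun=> 1))^-1) =
    (wint (wt W) (fun=> 1))^-1 * wint (wt W) (fun=> 1).
  rewrite -(wintZ wdom _ (quad_growth_cst n 1)).
  by apply: eq_wint => z; rewrite mulr1.
by rewrite mulVf // lt0r_neq0.
Qed.

(** Returns to the form with an indicator. Where |x|^2 >= 2 b / a, half of a |x|^2 pays for [b], so
    no constant is subtracted outside the ball. The summands 1 keep the constants positive when [b]
    is 0. *)
Lemma dissipative_quadratic (F : 'cV[R]_n -> 'cV[R]_n) (a b : R) : 0 < a -> 0 <= b ->
  (forall x, a * enorm x ^+ 2 - b <= dotp x (F x)) ->
  dissipative F (a / 2) (b + 1) (Num.sqrt (2 * b / a) + 1).
Proof.
move=> a0 b0 H; split.
- exact: divr_gt0.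
- exact: ltr_wpDl.
- by apply: ltr_wpDl => //; exact: sqrtr_ge0.
move=> x; apply: le_trans (H x).
have ax : 0 <= a * enorm x ^+ 2 by apply: mulr_ge0; [exact: ltW|exact: sqr_ge0].
rewrite indicE; have [xr|xr] := boolP (x \in [set z | enorm z < Num.sqrt (2 * b / a) + 1]).
  by rewrite mulr1; lra.
rewrite mulr0 subr0; have ba : 0 <= 2 * b / a by rewrite divr_ge0 ?mulr_ge0 // ltW.
suff : 2 * b <= a * enorm x ^+ 2 by lra.
rewrite [leRHS]mulrC -ler_pdivrMr // -(sqr_sqrtr ba) ler_sqr ?nnegrE ?sqrtr_ge0 ?enorm_ge0 //.
have : ~~ (enorm x < Num.sqrt (2 * b / a) + 1).
  by apply: contraNN xr => xr; rewrite inE.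
by rewrite -leNgt; apply: le_trans; rewrite lerDl.
Qed.

Lemma ereal_sup_cst_lty D (c : R) : (ereal_sup [set c%:E | t in D] < +oo)%E.
Proof.
apply: (@le_lt_trans _ _ c%:E); last exact: ltry.
by apply: ge_ereal_sup => _ [t _ <-].
Qed.

Lemma ereal_inf_cst_gt0 D (c : R) : 0 < c -> (0 < ereal_inf [set c%:E | t in D])%E.
Proof.
move=> c0; apply: (@lt_le_trans _ _ c%:E); first by rewrite lte_fin.
by apply: le_ereal_inf_tmp => _ [t _ <-].
Qed.

End posterior_density.

Unset Implicit Arguments.

Theorem proposition4p17 (R : realType) (d m : nat)
    (pX : R -> 'cV[R]_d -> R)
    (A : 'M[R]_(m, d)) (sigma : R) (y : 'cV[R]_m)
    (pYX : 'cV[R]_m -> 'cV[R]_d -> R)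
    (pX_path : path_assumption `[0, 1]%classic pX)
    (sigma_gt0 : 0 < sigma)
    (pYX_gauss : propto (pYX y)
       (fun x => expR (- (enorm (A *m x - y) ^+ 2 / (2 * sigma ^+ 2))))) :
  let p := fun t => posterior (pYX y) (pX t) in
  path_assumption `[0, 1]%classic p /\
  (forall t, t \in `[0, 1] ->
     (lip_const (grad (potential (p t)))
      <= lip_const (grad (potential (pX t)))
         + (sigma ^- 2 * spectral_norm (A^T *m A))%:E)%E).
Proof.
move=> p.
have [a [b [c [L [K [C [a0 b0 C0 up]]]]]]] := path_assumption_uniform pX_path.
have [ct ct0 time] := path_time pX_path.
have [k k0 likE] := pYX_gauss.
set U := fun t => potential (pX t) in up.
pose V := least_squares A y sigma.
have Vs j : Cn j V by exact: Cn_least_squares.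
have V0 x : 0 <= V x by exact: least_squares_ge0.
have [KV KV0 Vgrowth] := least_squares_growth A y sigma_gt0.
have VK x : V x <= KV * (1 + enorm x ^+ 2) by case: (Vgrowth x).
have gVK x : enorm (grad V x) ^+ 2 <= KV * (1 + enorm x ^+ 2) by case: (Vgrowth x).
pose B := sigma ^- 2 * (enorm y ^+ 2 / 4).
have B0 : 0 <= B.
  by apply: mulr_ge0; [rewrite invr_ge0 sqr_ge0|apply: divr_ge0 => //; exact: sqr_ge0].
have Vdiss x : - B <= dotp x (grad V x) by exact: dotp_grad_least_squares.
have Vlip := lipschitz_grad_least_squares A y sigma_gt0.
set LV := sigma ^- 2 * _ in Vlip *.
have I01 (t : R) : `[0, 1]%classic t -> 0 <= t <= 1 by rewrite /= in_itv.
pose Z t := wint (fun x => expR (- (U t x + V x))) (fun=> 1).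
have wdom t : 0 <= t <= 1 -> gauss_dom (fun x => expR (- (U t x + V x))).
  exact: (gauss_dom_weight a0 b0 up Vs V0).
have Z0 t : 0 <= t <= 1 -> 0 < Z t.
  exact: (partition_function_gt0 a0 b0 up Vs V0 Vdiss Vlip KV0 VK).
have pE t : 0 <= t <= 1 -> p t = fun x => expR (- (U t x + V x)) / Z t.
  move=> t01; rewrite -(posterior_gibbs k0 (wdom t t01)) /p; congr posterior.
    by apply/funext => x; exact: likE.
  by apply/potentialK/(path_positive pX_path); rewrite /= in_itv.
have potE t : 0 <= t <= 1 -> potential (p t) = fun x => U t x + V x + ln (Z t).
  by move=> t01; rewrite (pE t t01) potential_gibbs //; exact: Z0.
have dW t : 0 <= t <= 1 -> forall x, differentiable (fun x => U t x + V x) x.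
  by move=> t01; exact: pc_diff (posterior_class a0 b0 up Vs V0 Vdiss Vlip KV0 VK t01).
have gradE t : 0 <= t <= 1 -> grad (potential (p t)) = grad (fun x => U t x + V x).
  by move=> t01; apply/funext => x; rewrite (potE t t01) gradDcst //; exact: dW.
have [C' C'0 lsi] := @uniform_log_sobolev R d a (b + B) C KV
  (fun rho => (K + KV) * (1 + rho)) a0 (addr_ge0 b0 B0) C0 KV0.
have lsip t : 0 <= t <= 1 -> log_sobolev (with_density (p t)) C'.
  move=> t01; rewrite (pE t t01); apply: lsi => //.
  - exact: (posterior_class a0 b0 up Vs V0 Vdiss Vlip KV0 VK).
  - exact: (up_diff up).
  - exact: (up_prob up).
  - exact: (up_lsi up).
split; last first.
  (* Once [LV] is moved to the left, the right side is an infimum and can be tested on each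
     Lipschitz constant of the prior gradient. *)
  move=> t; rewrite in_itv /= => t01; rewrite -leeBlDr //.
  apply: le_ereal_inf_tmp => _ [L' lipL' <-]; rewrite leeBlDr // -EFinD.
  apply: ereal_inf_lbound; exists (L' + LV) => //=.
  by rewrite (gradE t t01); exact: (posterior_lipschitz up Vs Vlip t01 lipL').
split.
- by move=> t /I01 t01; rewrite (pE t t01); apply: prob_density_gibbs; [exact: wdom|exact: Z0].
- by move=> t /I01 t01 x; rewrite (pE t t01) divr_gt0 ?expR_gt0 ?Z0.
(* [ct * N] bounds the derivative of [ln (Z t)]. That derivative does not depend on [x], and
   [1 <= enorm x ^+ 2 + 1] brings it into the required form. *)
- pose N := 1 + 2 / a * (d%:R + (b + B)).
  have N0 : 0 <= N.
    apply: addr_ge0 => //; apply: mulr_ge0; first by rewrite divr_ge0 // ltW.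
    by rewrite !addr_ge0.
  exists (ct * (1 + N)); first by rewrite mulr_gt0 // ltr_pwDl.
  move=> x t It; have t01 := I01 t It.
  have [l lP] := choice (fun x => iffLR (exists2P _ _) (time x t It)).
  have [k' dlnZ k'N] := log_partition_derivative a0 b0 up Vs V0 Vdiss Vlip KV0 VK t01
    (ltW ct0) (fun x => (lP x).1) (fun x => (lP x).2).
  (* The contributions of [U], of the time-independent [V], and of [ln (Z t)]. *)
  exists (l x + 0 + k').
    apply: (@eq_has_derivative_within R _ (fun s => U s x + V x + ln (Z s))) => //.
      by move=> s /I01 s01; rewrite (potE s s01).
    apply: has_derivative_withinD => //; apply: has_derivative_withinD.
      exact: (lP x).1.
    exact: has_derivative_within_cst.
  rewrite addr0; apply: le_trans (ler_normD _ _) _; have := (lP x).2.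
  have x0 : 0 <= enorm x ^+ 2 by exact: sqr_ge0.
  have cN : 0 <= ct * N by apply: mulr_ge0 => //; exact: ltW.
  have := mulr_ge0 cN x0; rewrite -/N in k'N; lra.
- by move=> t /I01 t01 x; rewrite (potE t t01); apply: differentiableD => //; exact: dW.
- exists (fun=> L + LV), (fun=> a / 2), (fun=> b + B + 1),
    (fun=> Num.sqrt (2 * (b + B) / a) + 1); split.
  + move=> t /I01 t01; rewrite (gradE t t01).
    exact: (posterior_lipschitz up Vs Vlip t01 (up_lip up t01)).
  + move=> t [/I01 t01 _]; rewrite (gradE t t01).
    apply: dissipative_quadratic => //; first exact: addr_ge0.
    by move=> x; exact: (posterior_dissipative up Vs Vdiss x t01).
  + split; [exact: ereal_sup_cst_lty|apply: ereal_inf_cst_gt0; exact: divr_gt0|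
      exact: ereal_sup_cst_lty|exact: ereal_sup_cst_lty].
- by move=> t /I01 t01; exists C' => //; exact: lsip.
- apply: (@le_lt_trans _ _ C'%:E); last exact: ltry.
  apply: ge_ereal_sup => _ [t /I01 t01 <-].
  by apply: ereal_inf_lbound; exists C' => //; split=> //; exact: lsip.
Qed.
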